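(* For any $s\in\mathbb{C}$, $$s(s-1)\,\zeta(s)\,\frac{\Gamma\left(\frac{s}{2}\right)}{\pi^{\frac{s}{2}}}=\int_{0}^{1}\left(\frac{\mathbf{K}(1-m)}{\mathbf{K}(m)}\right)^{\frac12\left(s-\frac12\right)}U(m)\,\mathrm{d}m,$$ where $U$ is the symmetric function (i.e. $U(m)=U(1-m)$) given for $0<m<1$ by $$U(m)=\frac{\bigl(\mathbf{K}(m)\mathbf{K}(1-m)\bigr)^{\frac14}}{\pi\sqrt{2\pi}\;m(1-m)}\Bigl(3(1-m)\,\mathbf{K}(m)\mathbf{E}(1-m)+3m\,\mathbf{E}(m)\mathbf{K}(1-m)-3\,\mathbf{E}(m)\mathbf{E}(1-m)-m(1-m)\,\mathbf{K}(m)\mathbf{K}(1-m)\Bigr).$$ The left-hand side is understood as an entire function of $s$, i.e. extended by continuity at its removable singularities $s=1$ and $s=0,-2,-4,\dots$.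
   Context: $\zeta$ is the Riemann zeta function (meromorphically continued to $\mathbb{C}$) and $\Gamma$ the Gamma function. For $0<m<1$ (parameter convention, $m=k^2$ with $k$ the modulus), $\mathbf{K}(m)=\int_0^{\pi/2}\frac{\mathrm{d}x}{\sqrt{1-m\sin^2 x}}$ is the complete elliptic integral of the first kind and $\mathbf{E}(m)=\int_0^{\pi/2}\sqrt{1-m\sin^2 x}\,\mathrm{d}x$ is the complete elliptic integral of the second kind. For a positive real base $a$, $a^{z}=e^{z\ln a}$. *)

(* Defs.v *)
From HB Require Import structures.
From mathcomp Require Import all_boot all_order all_algebra.
From mathcomp Require Import all_classical all_reals all_analysis.
From mathcomp Require Import complex.

Set Implicit Arguments.
Unset Strict Implicit.
Unset Printing Implicit Defensive.

Import Order.TTheory GRing.Theory Num.Theory.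
Import numFieldNormedType.Exports.

Local Open Scope classical_set_scope.
Local Open Scope ring_scope.
Local Open Scope complex_scope.

(* R[i] gets the topology and norm of its modulus, as the library does for the
   abstract numeric fields. *)
#[non_forgetful_inheritance]
HB.instance Definition _ (R : realType) := PseudoPointedMetric.copy R[i] R[i]^o.
#[non_forgetful_inheritance]
HB.instance Definition _ (R : realType) := NormedModule.copy R[i] R[i]^o.

Definition cexp (R : realType) (z : R[i]) : R[i] :=
  (expR (complex.Re z) * cos (complex.Im z)) +i*
  (expR (complex.Re z) * sin (complex.Im z)).

(* The power a^z = e^(z ln a) of a positive real base; junk for a <= 0. *)
Definition cpow (R : realType) (a : R) (z : R[i]) : R[i] :=
  cexp (z * (ln a)%:C).

Definition cintegrable (R : realType) (D : set R) (f : R -> R[i]) : Prop :=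
  (@lebesgue_measure R).-integrable D (fun x => (complex.Re (f x))%:E) /\
  (@lebesgue_measure R).-integrable D (fun x => (complex.Im (f x))%:E).

(* Meaningful when [cintegrable D f]. *)
Definition cintegral (R : realType) (D : set R) (f : R -> R[i]) : R[i] :=
  (\int[@lebesgue_measure R]_(x in D) complex.Re (f x)) +i*
  (\int[@lebesgue_measure R]_(x in D) complex.Im (f x)).

Definition analytic_at (R : realType) (f : R[i] -> R[i]) (z : R[i]) : Prop :=
  exists a : nat -> R[i],
    \forall w \near z, [series a n * (w - z) ^+ n]_n @ \oo --> f w.

Definition entire (R : realType) (f : R[i] -> R[i]) : Prop :=
  forall z, analytic_at f z.

(* [g] extends [f] by continuity at the points of [A], where the values of [f]
   are ignored. *)
Definition extends_by_continuity (R : realType) (A : set R[i])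
    (f g : R[i] -> R[i]) : Prop :=
  (forall z, ~ A z -> g z = f z) /\
  (forall z, A z -> f w @[w --> z^'] --> g z).

(* Euler's integral; absolutely convergent for 0 < Re z. *)
Definition Gamma_integral (R : realType) (z : R[i]) : R[i] :=
  cintegral `]0, +oo[ (fun t => cpow t (z - 1) * (expR (- t))%:C).

(* Continuation to the left by Gamma(z) = Gamma(z + n) / (z (z+1) ... (z+n-1)),
   with n the least natural number such that 0 < Re z + n. At the poles
   0, -1, -2, ... the value is the junk 0. *)
Definition Gamma (R : realType) (z : R[i]) : R[i] :=
  let n := if 0 < complex.Re z then 0%N
           else (Num.truncn (- complex.Re z)).+1 in
  Gamma_integral (z + n%:R) / \prod_(k < n) (z + k%:R).

(* The Riemann zeta function as the analytic continuation of its Dirichlet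
   series to the complement of the pole 1. By the identity theorem this
   determines zeta there; zeta 1 is unconstrained. *)
Definition is_riemann_zeta (R : realType) (zeta : R[i] -> R[i]) : Prop :=
  (forall s : R[i], 1 < complex.Re s ->
     [series cpow n.+1%:R (- s)]_n @ \oo --> zeta s) /\
  (forall s : R[i], s != 1 -> analytic_at zeta s).

(* Both complete elliptic integrals take the parameter m = k^2. *)
Definition ellipticK (R : realType) (m : R) : R :=
  \int[@lebesgue_measure R]_(x in `[0, pi / 2])
    (Num.sqrt (1 - m * sin x ^+ 2))^-1.

Definition ellipticE (R : realType) (m : R) : R :=
  \int[@lebesgue_measure R]_(x in `[0, pi / 2])
    Num.sqrt (1 - m * sin x ^+ 2).

Definition U (R : realType) (m : R) : R :=
  let K := ellipticK m in let K' := ellipticK (1 - m) in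
  let E := ellipticE m in let E' := ellipticE (1 - m) in
  (K * K') `^ (1 / 4) / (pi * Num.sqrt (2 * pi) * (m * (1 - m))) *
  (3 * (1 - m) * K * E' + 3 * m * E * K' - 3 * E * E' - m * (1 - m) * K * K').

Definition completed_zeta (R : realType) (zeta : R[i] -> R[i]) (s : R[i]) :
    R[i] :=
  s * (s - 1) * zeta s * (Gamma (s / 2) / cpow pi (s / 2)).

Definition removable_singularities (R : realType) : set R[i] :=
  [set s | s = 1 \/ exists n : nat, s = - (2 * n)%:R].

(* Main.v *)
Require Import Defs.
From HB Require Import structures.
From mathcomp Require Import all_boot all_order all_algebra.
From mathcomp Require Import all_classical all_reals all_analysis.
From mathcomp Require Import complex.
From mathcomp Require Import measurable_realfun ring lra zify.

Import Order.TTheory GRing.Theory Num.Theory.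
Import numFieldNormedType.Exports.

Local Open Scope classical_set_scope.
Local Open Scope ring_scope.
Local Open Scope complex_scope.

Set Implicit Arguments.
Unset Strict Implicit.
Unset Printing Implicit Defensive.

(** Let θ(t) be the sum of e^(-π n² t) over all integers n ([jacobi_theta]). The expression 2t²θ'' +
    3tθ', which is t times [xi_density], contains no trace of the constant term of θ. Its Mellin
    transform at s/2 can therefore be computed term by term from Euler's integral. Since
    4(s/2)(s/2+1) - 6(s/2) = s(s-1), for Re s > 1 it equals s(s-1) π^(-s/2) Γ(s/2) ζ(s)
    ([cintegral_xi_mellin]).

    The integral over (0, 1) is this Mellin transform after the substitution t = K(1-m)/K(m)
    ([K_ratio]). Legendre's relation gives dt/dm = -π / (4m(1-m)K(m)²) ([drv_K_ratio]), and Jacobi's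
    identity says K(m) = (π/2) θ(t)². Differentiating Jacobi's identity twice in m, with the
    differential equations of K and E, expresses θ'(t) and θ''(t) through K and E. Collecting all
    factors produces exactly U ([U_xi_density]), and hence the formula for Re s > 1
    ([cintegral_U_integrand]).

    Jacobi's identity is proved in the manner of Gauss. The theta series is split over even and odd
    integers, and the rotation (u, v) -> (u + v, u - v) of the lattice of pairs gives duplication
    formulas from q to q². They match Landen's transformation of K ([landen_transformation]). Along
    q, q², q⁴, ... the quotient K/θ² is therefore constant and π K'/K + ln q doubles at each step.
    The behaviour as q tends to 0 forces the values π/2 and 0 ([ellipticK_modulus],
    [K_ratio_modulus]).

    For the passage to all s, [K_ratio] is inverted by m -> 1 - m while U is invariant. Convergence
    for large Re s thus controls both ends of (0, 1) and makes e^(a |ln K_ratio|) |U| integrable for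
    every a > 1/4 ([integrable_U_bound]): the symmetry of U does the work of the functional
    equation. Expanding the exponential in s shows that the integral is entire
    ([exp_integral_analytic]). Finally, the difference of the two sides with denominators cleared
    ([xi_defect]) is analytic on a half-plane without the point 1 and vanishes for Re s > 1. The
    identity theorem along horizontal segments gives its vanishing at nonreal s, and continuity
    gives it at real s. The exceptional points are isolated, so the entire integral is the
    continuous extension. *)

(** * Modulus and limits of complex numbers *)

Definition cabs (R : realType) (z : R[i]) : R := complex.Re `|z|.

Lemma cabsE (R : realType) (z : R[i]) : `|z| = (cabs z)%:C.
Proof. by rewrite /cabs normc_def. Qed.

Lemma cabs_sqrt (R : realType) (z : R[i]) :
  cabs z = Num.sqrt (complex.Re z ^+ 2 + complex.Im z ^+ 2).
Proof. by rewrite /cabs normc_def. Qed.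

Lemma cabs_ge0 (R : realType) (z : R[i]) : 0 <= cabs z.
Proof. by rewrite cabs_sqrt sqrtr_ge0. Qed.

Lemma cabsM (R : realType) (z w : R[i]) : cabs (z * w) = cabs z * cabs w.
Proof. by apply: complexI; rewrite rmorphM/= -!cabsE normrM. Qed.

Lemma cabsX (R : realType) (z : R[i]) n : cabs (z ^+ n) = cabs z ^+ n.
Proof. by apply: complexI; rewrite rmorphXn/= -!cabsE normrX. Qed.

Lemma cabsD (R : realType) (z w : R[i]) : cabs (z + w) <= cabs z + cabs w.
Proof. by rewrite -lecR rmorphD/= -!cabsE ler_normD. Qed.

Lemma cabsN (R : realType) (z : R[i]) : cabs (- z) = cabs z.
Proof. by rewrite /cabs normrN. Qed.

Lemma cabs_dist (R : realType) (z w : R[i]) : cabs (z - w) = cabs (w - z).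
Proof. by rewrite /cabs distrC. Qed.

Lemma cabs0 (R : realType) : cabs (0 : R[i]) = 0.
Proof. by rewrite /cabs normr0. Qed.

Lemma cabs1 (R : realType) : cabs (1 : R[i]) = 1.
Proof. by rewrite /cabs normr1. Qed.

Lemma cabs_real (R : realType) (x : R) : cabs x%:C = `|x|.
Proof. by rewrite cabs_sqrt/= expr0n/= addr0 sqrtr_sqr. Qed.

Lemma cabs_eq0 (R : realType) (z : R[i]) : (cabs z == 0) = (z == 0).
Proof.
by apply/eqP/eqP => [z0|->]; [apply/eqP; rewrite -normr_eq0 cabsE z0|rewrite cabs0].
Qed.

Lemma cabs_sum (R : realType) (I : Type) (s : seq I) (P : pred I)
    (F : I -> R[i]) :
  cabs (\sum_(i <- s | P i) F i) <= \sum_(i <- s | P i) cabs (F i).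
Proof.
elim/big_ind2 : _ => [|x a y b xa yb|//]; first by rewrite cabs0.
exact: le_trans (cabsD _ _) (lerD xa yb).
Qed.

Lemma normr_Re_le (R : realType) (z : R[i]) : `|complex.Re z| <= cabs z.
Proof.
by rewrite cabs_sqrt -sqrtr_sqr ler_sqrt ?lerDl ?sqr_ge0// addr_ge0 ?sqr_ge0.
Qed.

Lemma normr_Im_le (R : realType) (z : R[i]) : `|complex.Im z| <= cabs z.
Proof.
by rewrite cabs_sqrt -sqrtr_sqr ler_sqrt ?lerDr ?sqr_ge0// addr_ge0 ?sqr_ge0.
Qed.

Lemma cabs_le_ReIm (R : realType) (z : R[i]) :
  cabs z <= `|complex.Re z| + `|complex.Im z|.
Proof.
case: z => x y; rewrite {1}[_ +i* _]complexE /=.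
apply: le_trans (cabsD _ _) _; rewrite cabsM !cabs_real.
by rewrite cabs_sqrt/= expr0n add0r expr1n sqrtr1 mul1r.
Qed.

Lemma ReD (R : realType) (z w : R[i]) :
  complex.Re (z + w) = complex.Re z + complex.Re w.
Proof. by case: z; case: w. Qed.

Lemma ImD (R : realType) (z w : R[i]) :
  complex.Im (z + w) = complex.Im z + complex.Im w.
Proof. by case: z; case: w. Qed.

Lemma ReN (R : realType) (z : R[i]) : complex.Re (- z) = - complex.Re z.
Proof. by case: z. Qed.

Lemma ImN (R : realType) (z : R[i]) : complex.Im (- z) = - complex.Im z.
Proof. by case: z. Qed.

Lemma ReM (R : realType) (z w : R[i]) : complex.Re (z * w) =
  complex.Re z * complex.Re w - complex.Im z * complex.Im w.
Proof. by case: z; case: w. Qed.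

Lemma ImM (R : realType) (z w : R[i]) : complex.Im (z * w) =
  complex.Re z * complex.Im w + complex.Im z * complex.Re w.
Proof. by case: z => a b; case: w => c d. Qed.

Lemma Re_sum (R : realType) (I : Type) (s : seq I) (P : pred I) (F : I -> R[i]) :
  complex.Re (\sum_(i <- s | P i) F i) = \sum_(i <- s | P i) complex.Re (F i).
Proof. by apply: (big_morph _ (@ReD R)). Qed.

Lemma Im_sum (R : realType) (I : Type) (s : seq I) (P : pred I) (F : I -> R[i]) :
  complex.Im (\sum_(i <- s | P i) F i) = \sum_(i <- s | P i) complex.Im (F i).
Proof. by apply: (big_morph _ (@ImD R)). Qed.

Lemma nbhs_cabsP (R : realType) (z : R[i]) (P : set R[i]) :
  nbhs z P <-> exists2 e : R, 0 < e & forall w, cabs (w - z) < e -> P w.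
Proof.
split.
  move=> /nbhs_ballP[[e e']/=]; rewrite ltcE/= => /andP[/eqP e'0 e0] h.
  exists e => // w wz; apply: h; rewrite /ball/=; subst e'.
  by rewrite distrC cabsE ltcR.
move=> [e e0 h]; apply/nbhs_ballP; exists e%:C => /=; first by rewrite ltcR.
by move=> w; rewrite /ball/= distrC cabsE ltcR; exact: h.
Qed.

Lemma cvgc_cabsP (R : realType) (T : Type) (F : set_system T) {FF : Filter F}
    (f : T -> R[i]) (l : R[i]) :
  (f x @[x --> F] --> l) <-> (cabs (f x - l) @[x --> F] --> (0:R)).
Proof.
split.
  move=> fl; apply/cvgr0Pnorm_lt => e e0.
  have h : nbhs l [set w : R[i] | cabs (w - l) < e].
    by apply: (proj2 (nbhs_cabsP _ _)); exists e.
  apply: (@filterS _ F FF _ _ _ (fl _ h)) => x/=.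
  by rewrite ger0_norm ?cabs_ge0.
move=> fl P /nbhs_cabsP[e e0 eP].
move/cvgr0Pnorm_lt : fl => /(_ _ e0) h; apply: (@filterS _ F FF _ _ _ h) => x.
by rewrite ger0_norm ?cabs_ge0// => ?; exact: eP.
Qed.

Lemma cvgc_ReImP (R : realType) (T : Type) (F : set_system T) {FF : Filter F}
    (f : T -> R[i]) (l : R[i]) :
  (f x @[x --> F] --> l) <->
  (complex.Re (f x) @[x --> F] --> complex.Re l) /\
  (complex.Im (f x) @[x --> F] --> complex.Im l).
Proof.
split.
  move=> /cvgc_cabsP fl; split; apply/cvgrPdist_lt => e e0;
    move/cvgr0Pnorm_lt : fl => /(_ _ e0) h; apply: (@filterS _ F FF _ _ _ h) => x;
    rewrite ger0_norm ?cabs_ge0//; apply: le_lt_trans; rewrite distrC.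
    by rewrite -ReN -ReD normr_Re_le.
  by rewrite -ImN -ImD normr_Im_le.
move=> [fr fi]; apply/cvgc_cabsP.
have h : (`|complex.Re (f x) - complex.Re l| + `|complex.Im (f x) - complex.Im l|)
    @[x --> F] --> (0 : R).
  rewrite -[0]addr0 -[X in X + _](@normr0 _ R) -[X in _ + X](@normr0 _ R).
  apply: cvgD; apply: cvg_norm.
    rewrite -[X in _ --> X](subrr (complex.Re l)).
    by apply: cvgB => //; exact: cvg_cst.
  rewrite -[X in _ --> X](subrr (complex.Im l)).
  by apply: cvgB => //; exact: cvg_cst.
apply: (squeeze_cvgr _ _ h); last exact: cvg_cst.
apply: nearW => x /=; rewrite cabs_ge0/=.
by rewrite -ReN -ReD -ImN -ImD cabs_le_ReIm.
Qed.

Lemma cvgc_unique (R : realType) (T : Type) (F : set_system T)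
    {FF : ProperFilter F} (f : T -> R[i]) (l l' : R[i]) :
  f x @[x --> F] --> l -> f x @[x --> F] --> l' -> l = l'.
Proof.
move=> /cvgc_ReImP[a b] /cvgc_ReImP[c d]; apply/eqP; rewrite eq_complex.
by rewrite (cvg_unique _ a c) ?(cvg_unique _ b d) ?eqxx//.
Qed.

Lemma cvgcM (R : realType) (T : Type) (F : set_system T) {FF : Filter F}
    (f g : T -> R[i]) (a b : R[i]) :
  f x @[x --> F] --> a -> g x @[x --> F] --> b ->
  f x * g x @[x --> F] --> a * b.
Proof.
move=> /cvgc_ReImP[fr fi] /cvgc_ReImP[gr gi].
apply/cvgc_ReImP; rewrite ReM ImM; split.
  by under eq_cvg do rewrite ReM; apply: cvgB; apply: cvgM.
by under eq_cvg do rewrite ImM; apply: cvgD; apply: cvgM.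
Qed.

Lemma cvgcD (R : realType) (T : Type) (F : set_system T) {FF : Filter F}
    (f g : T -> R[i]) (a b : R[i]) :
  f x @[x --> F] --> a -> g x @[x --> F] --> b ->
  f x + g x @[x --> F] --> a + b.
Proof.
move=> /cvgc_ReImP[fr fi] /cvgc_ReImP[gr gi].
apply/cvgc_ReImP; rewrite ReD ImD; split.
  by under eq_cvg do rewrite ReD; apply: cvgD.
by under eq_cvg do rewrite ImD; apply: cvgD.
Qed.

(** * Cauchy products and power series *)

(** Both sides sum a i * b j over the triangle i + j < n. *)
Lemma sum_antidiagonal (A : comPzRingType) (a b : nat -> A) (n : nat) :
  \sum_(0 <= k < n) \sum_(0 <= i < k.+1) a i * b (k - i)%N =
  \sum_(0 <= i < n) a i * \sum_(0 <= j < n - i) b j.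
Proof.
elim: n => [|n IH]; first by rewrite !big_geq.
rewrite big_nat_recr//= IH [RHS]big_nat_recr//= subSn// subnn.
rewrite [in RHS]big_nat1.
have -> : \sum_(0 <= i < n) a i * \sum_(0 <= j < n.+1 - i) b j =
    \sum_(0 <= i < n) a i * \sum_(0 <= j < n - i) b j +
    \sum_(0 <= i < n) a i * b (n - i)%N.
  rewrite -big_split/=; apply: eq_big_nat => i /andP[_ ilt].
  by rewrite subSn ?(ltnW ilt)// big_nat_recr//= mulrDr.
by rewrite -addrA [in LHS]big_nat_recr//= subnn.
Qed.

(** The product of the n-th partial sums exceeds the n-th partial sum of the Cauchy product by the
    terms with i, j < n <= i + j. There are at most n² <= 4^n of them, each at most M² 8^-n, so the
    ratio 1/8 leaves an error of M² 2^-n. *)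
Lemma cvg_cauchy_product (R : realType) (a b : nat -> R[i]) (M : R) (A B : R[i]) :
  (forall n, cabs (a n) <= M * 8^-1 ^+ n) ->
  (forall n, cabs (b n) <= M * 8^-1 ^+ n) ->
  series a @ \oo --> A -> series b @ \oo --> B ->
  series (fun n => \sum_(0 <= i < n.+1) a i * b (n - i)%N) @ \oo --> A * B.
Proof.
move=> aM bM aA bB.
have M0 : 0 <= M by have := le_trans (cabs_ge0 _) (aM 0%N); rewrite expr0 mulr1.
have h0 : (M * M) * 2^-1 ^+ n @[n --> \oo] --> (0 : R).
  by apply: (@cvg_geometric R (M * M)); rewrite ger0_norm ?invr_ge0// invf_lt1// ltr1n.
have h : cabs (series a n * series b n -
    series (fun n => \sum_(0 <= i < n.+1) a i * b (n - i)%N) n)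
    @[n --> \oo] --> (0 : R).
  apply: (squeeze_cvgr _ _ h0); last exact: cvg_cst.
  apply: nearW => n /=; rewrite cabs_ge0/=.
  rewrite /series/= sum_antidiagonal mulr_suml -sumrB.
  apply: (@le_trans _ _ (\sum_(0 <= i < n) \sum_(0 <= j < n)
                           M * M * 8^-1 ^+ n)); last first.
    rewrite !sumr_const_nat subn0 -[leLHS]mulrnA -[leLHS]mulr_natr -mulrA.
    apply: ler_wpM2l; first exact: mulr_ge0.
    have -> : 2^-1 ^+ n = 8^-1 ^+ n * (2 ^ n * 2 ^ n)%:R :> R.
      rewrite natrM !natrX -!exprMn; congr (_ ^+ _); by field.
    apply: ler_wpM2l; first by rewrite exprn_ge0// invr_ge0.
    by rewrite ler_nat leq_mul// ltnW// ltn_expl.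
  apply: le_trans (cabs_sum _ _ _) _.
  apply: ler_sum_nat => i /andP[_ ilt].
  rewrite -mulrBr.
  rewrite (@big_cat_nat _ _ _ (n - i) 0 n)//= ?leq_subr// addrAC subrr add0r.
  rewrite cabsM.
  apply: (@le_trans _ _ (\sum_(n - i <= j < n) M * M * 8^-1 ^+ n)); last first.
    rewrite [leRHS](@big_cat_nat _ _ _ (n - i) 0 n)//= ?leq_subr//.
    rewrite lerDr; apply: sumr_ge0 => *.
    by rewrite !mulr_ge0 ?exprn_ge0 ?invr_ge0.
  apply: (@le_trans _ _ (cabs (a i) * \sum_(n - i <= j < n) cabs (b j))).
    by apply: ler_wpM2l; rewrite ?cabs_ge0 ?cabs_sum.
  rewrite mulr_sumr; apply: ler_sum_nat => j /andP[ij jn].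
  apply: (@le_trans _ _ ((M * 8^-1 ^+ i) * (M * 8^-1 ^+ j))).
    by rewrite ler_pM ?cabs_ge0.
  rewrite mulrACA -exprD; apply: ler_wpM2l; first exact: mulr_ge0.
  rewrite ler_wiXn2l ?invr_ge0 ?invf_le1 ?ler1n//.
  by rewrite -leq_subLR.
apply/cvgc_cabsP.
pose proof (@cvgcM R nat \oo _ (series a) (series b) A B aA bB) as h1.
pose proof (proj1 (@cvgc_cabsP R nat \oo _ _ _) h1) as h2.
pose proof (cvgD h h2) as h3; rewrite addr0 in h3.
apply: (squeeze_cvgr _ _ h3); last exact: cvg_cst.
apply: nearW => n /=; rewrite cabs_ge0/=.
rewrite [leRHS]/(_ + _)/=.
set C := \sum_(0 <= k < n) _; set S := series a n * series b n.
rewrite (cabs_dist S); apply: le_trans (cabsD _ _).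
by rewrite addrA subrK.
Qed.

(** Analyticity with its radius and a Cauchy bound on the coefficients made explicit, so that tails
    can be estimated with constants. *)
Definition power_series_at (R : realType) (f : R[i] -> R[i]) (z : R[i])
    (a : nat -> R[i]) (r M : R) : Prop :=
  [/\ 0 < r, forall n, cabs (a n) * r ^+ n <= M &
      forall w, cabs (w - z) < r ->
        [series a n * (w - z) ^+ n]_n @ \oo --> f w].

Lemma power_series_at_analytic (R : realType) (f : R[i] -> R[i]) (z : R[i])
    (a : nat -> R[i]) (r M : R) :
  power_series_at f z a r M -> analytic_at f z.
Proof.
by move=> [r0 _ h]; exists a; apply/nbhs_cabsP; exists r.
Qed.

Lemma cvgc_seq_bounded (R : realType) (u : nat -> R[i]) (l : R[i]) :
  u @ \oo --> l -> exists M : R, forall n, cabs (u n) <= M.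
Proof.
move=> /cvgc_cabsP ul.
have : bounded_fun (fun n => cabs (u n - l)).
  by apply: cvg_seq_bounded; apply/cvg_ex; exists 0.
move=> /pinfty_ex_gt0[M M0 h]; exists (M + cabs l) => n.
rewrite -[u n](subrK l); apply: le_trans (cabsD _ _) _; rewrite lerD2r.
by have := h n I; rewrite /= ger0_norm ?cabs_ge0.
Qed.

(** At a point at distance e/2 the partial sums converge, hence are bounded by some M. Each term is
    a difference of two consecutive partial sums, which bounds the coefficients by M + M. *)
Lemma analytic_power_series_at (R : realType) (f : R[i] -> R[i]) (z : R[i]) :
  analytic_at f z -> exists a r M, power_series_at f z a r M.
Proof.
move=> [a /nbhs_cabsP[e e0 h]].
have ez : cabs (z + (e / 2)%:C - z) < e.
  rewrite addrAC subrr add0r cabs_real ger0_norm ?divr_ge0 ?(ltW e0)//.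
  by rewrite ltr_pdivrMr// ltr_pMr// ltr1n.
have /cvgc_seq_bounded[M hM] := h _ ez.
exists a, (e / 2), (M + M); split; first by rewrite divr_gt0.
  move=> n.
  have -> : cabs (a n) * (e / 2) ^+ n =
      cabs (a n * (z + (e / 2)%:C - z) ^+ n).
    rewrite addrAC subrr add0r cabsM cabsX cabs_real ger0_norm//.
    by rewrite divr_ge0 ?(ltW e0).
  rewrite -(seriesSB (fun n => a n * (z + (e / 2)%:C - z) ^+ n) n).
  apply: le_trans (cabsD _ _) _; rewrite cabsN.
  by apply: lerD; exact: hM.
move=> w we; apply: h; apply: (lt_trans we).
by rewrite ltr_pdivrMr// ltr_pMr// ltr1n.
Qed.

Lemma power_series_at_le (R : realType) (f : R[i] -> R[i]) (z : R[i])
    (a : nat -> R[i]) (r M r' M' : R) :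
  0 < r' -> r' <= r -> M <= M' ->
  power_series_at f z a r M -> power_series_at f z a r' M'.
Proof.
move=> r'0 r'r MM' [r0 aM h]; split => //.
  move=> n; apply: le_trans MM'; apply: le_trans (aM n).
  apply: ler_wpM2l; first exact: cabs_ge0.
  by rewrite lerXn2r// nnegrE ltW.
by move=> w wz; apply: h; exact: lt_le_trans r'r.
Qed.

Lemma nearcW (R : realType) (z : R[i]) (P : R[i] -> Prop) :
  (forall w, P w) -> \forall w \near z, P w.
Proof. by move=> h; apply/nbhs_cabsP; exists 1. Qed.

Lemma analytic_at_cst (R : realType) (c z : R[i]) : analytic_at (fun=> c) z.
Proof.
exists (fun n => if n is 0%N then c else 0); apply: nearcW => w.
apply/cvgc_cabsP; apply: cvg_near_cst; near=> n.
have /prednK <- : (0 < n)%N by near: n; exact: nbhs_infty_gt.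
rewrite /series/= big_nat_recl// big1 => [|i _]; last by rewrite mul0r.
by rewrite addr0 expr0 mulr1 subrr cabs0.
Unshelve. all: end_near. Qed.

Lemma nearcS2 (R : realType) (z : R[i]) (P Q S : R[i] -> Prop) :
  (forall w, P w -> Q w -> S w) ->
  (\forall w \near z, P w) -> (\forall w \near z, Q w) ->
  \forall w \near z, S w.
Proof.
move=> h /nbhs_cabsP[e e0 he] /nbhs_cabsP[f f0 hf]; apply/nbhs_cabsP.
exists (Num.min e f); first by rewrite lt_min e0 f0.
by move=> w; rewrite lt_min => /andP[we wf]; apply: h; [exact: he|exact: hf].
Qed.

Lemma analytic_at_ext (R : realType) (f g : R[i] -> R[i]) (z : R[i]) :
  (\forall w \near z, f w = g w) -> analytic_at f z -> analytic_at g z.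
Proof.
move=> fg [a h]; exists a.
by apply: nearcS2 fg h => w <-.
Qed.

Lemma analytic_atD (R : realType) (f g : R[i] -> R[i]) (z : R[i]) :
  analytic_at f z -> analytic_at g z -> analytic_at (fun w => f w + g w) z.
Proof.
move=> [a ha] [b hb]; exists (fun n => a n + b n).
apply: nearcS2 ha hb => w fw gw.
pose proof (cvgcD fw gw) as fgw; move: fgw; apply: cvg_trans; apply: near_eq_cvg; apply: nearW => n.
by rewrite /series/= -big_split/=; apply: eq_bigr => i _; rewrite mulrDl.
Qed.

Lemma analytic_at_id (R : realType) (z : R[i]) : analytic_at id z.
Proof.
exists (fun n => if n is 0%N then z else if n is 1%N then 1 else 0).
apply: nearcW => w; apply/cvgc_cabsP; apply: cvg_near_cst; near=> n.
have /subnKC <- : (1 < n)%N by near: n; exact: nbhs_infty_ge.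
rewrite /series/= addSn addSn !add0n !big_nat_recl// big1 => [|i _].
  by rewrite expr0 expr1 mulr1 mul1r addr0 [z + _]addrC subrK subrr cabs0.
by rewrite mul0r.
Unshelve. all: end_near. Qed.

Lemma analytic_atM (R : realType) (f g : R[i] -> R[i]) (z : R[i]) :
  analytic_at f z -> analytic_at g z -> analytic_at (fun w => f w * g w) z.
Proof.
move=> /analytic_power_series_at[a [r [M fa]]].
move=> /analytic_power_series_at[b [r' [M' gb]]].
pose s := Num.min r r'; pose N := Num.max M M'.
have r0 : 0 < r by case: fa.
have r'0 : 0 < r' by case: gb.
have s0 : 0 < s by rewrite lt_min r0 r'0.
have sr : s <= r by rewrite ge_min lexx.
have sr' : s <= r' by rewrite ge_min lexx orbT.
have MN : M <= N by rewrite le_max lexx.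
have MN' : M' <= N by rewrite le_max lexx orbT.
have {fa} [_ aM fa] := power_series_at_le s0 sr MN fa.
have {gb} [_ bM gb] := power_series_at_le s0 sr' MN' gb.
exists (fun n => \sum_(0 <= i < n.+1) a i * b (n - i)%N).
(* Within s/8 the coefficient bounds become geometric bounds of ratio 1/8, as [cvg_cauchy_product]
   requires. *)
apply/nbhs_cabsP; exists (s / 8); first by rewrite divr_gt0.
move=> w ws.
have wss : cabs (w - z) < s.
  by apply: (lt_le_trans ws); rewrite ler_pdivrMr// ler_peMr ?(ltW s0)// ler1n.
have bnd (c : nat -> R[i]) : (forall n, cabs (c n) * s ^+ n <= N) ->
    forall n, cabs (c n * (w - z) ^+ n) <= N * 8^-1 ^+ n.
  move=> cM n; rewrite cabsM cabsX.
  apply: (@le_trans _ _ (cabs (c n) * (s / 8) ^+ n)).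
    apply: ler_wpM2l; first exact: cabs_ge0.
    by rewrite lerXn2r ?nnegrE ?cabs_ge0 ?(ltW ws)// divr_ge0// ltW.
  by rewrite exprMn mulrA; apply: ler_wpM2r; rewrite ?exprn_ge0 ?invr_ge0.
have := cvg_cauchy_product (bnd a aM) (bnd b bM) (fa w wss) (gb w wss).
apply: cvg_trans; apply: near_eq_cvg; apply: nearW => n.
rewrite /series/=; apply: eq_bigr => k _; rewrite mulr_suml.
apply: eq_big_nat => i /andP[_ ik].
by rewrite mulrACA -exprD subnKC.
Qed.

Lemma analytic_at_prod (R : realType) (n : nat) (F : 'I_n -> R[i] -> R[i])
    (z : R[i]) :
  (forall i, analytic_at (F i) z) -> analytic_at (fun w => \prod_(i < n) F i w) z.
Proof.
elim: n F => [|n IH] F h.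
  apply: (@analytic_at_ext _ (fun=> 1)); last exact: analytic_at_cst.
  by apply: nearcW => w; rewrite big_ord0.
apply: (@analytic_at_ext _
  (fun w => (\prod_(i < n) F (widen_ord (leqnSn n) i) w) * F ord_max w)).
  by apply: nearcW => w; rewrite big_ord_recr.
by apply: analytic_atM => //; apply: (IH (fun i => F (widen_ord (leqnSn n) i))).
Qed.

(* The constant is explicit so that it does not depend on [w]. *)
Lemma power_series_at_remainder (R : realType) (f : R[i] -> R[i]) (z : R[i])
    (a : nat -> R[i]) (r M : R) (n : nat) :
  power_series_at f z a r M -> (forall k, (k < n)%N -> a k = 0) ->
  forall w, cabs (w - z) <= r / 2 ->
  cabs (f w - a n * (w - z) ^+ n) <= 2 * M * (cabs (w - z) / r) ^+ n.+1.
Proof.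
move=> [r0 aM h] a0 w wr; set u := w - z.
have M0 : 0 <= M by have := aM 0%N; rewrite expr0 mulr1; apply: le_trans (cabs_ge0 _).
set x := cabs u / r.
have x0 : 0 <= x by rewrite divr_ge0 ?cabs_ge0// ltW.
have x2 : x <= 2^-1 by rewrite ler_pdivrMr// mulrC.
have wr' : cabs u < r.
  by apply: (le_lt_trans wr); rewrite ltr_pdivrMr// ltr_pMr// ltr1n.
have /cvgc_cabsP/cvgr0Pnorm_lt fw := h w wr'.
have geo m : \sum_(0 <= k < m) x ^+ k <= 2.
  have -> : \sum_(0 <= k < m) x ^+ k = series (geometric 1 x) m.
    by rewrite /series/=; apply: eq_bigr => i _; rewrite mul1r.
  rewrite geometric_seriesE ?mul1r; last by apply/eqP; lra.
  rewrite ler_pdivrMr; last by lra.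
  by have := exprn_ge0 m x0; lra.
apply/ler_addgt0Pr => e e0.
have [N _ hN] := fw _ e0.
set m := (N + n.+1)%N; have Nm : (N <= m)%N by rewrite leq_addr.
have := hN m Nm; rewrite ger0_norm ?cabs_ge0// cabs_dist => fe.
rewrite -(subrK (series (fun k => a k * u ^+ k) m) (f w)) -addrA addrC.
apply: le_trans (cabsD _ _) _; apply: lerD (ltW fe).
rewrite /series/= (@big_cat_nat _ _ _ n.+1)//= ?leq_addl//.
have -> : \sum_(0 <= k < n.+1) a k * u ^+ k = a n * u ^+ n.
  rewrite big_nat_recr//= big_nat big1 ?add0r// => i /andP[_ ilt].
  by rewrite a0// mul0r.
rewrite addrAC subrr add0r.
apply: le_trans (cabs_sum _ _ _) _.
apply: (@le_trans _ _ (\sum_(n.+1 <= k < m) M * x ^+ k)).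
  apply: ler_sum => k _; rewrite cabsM cabsX.
  have -> : cabs u ^+ k = r ^+ k * x ^+ k.
    by rewrite -exprMn mulrC divfK ?gt_eqF.
  by rewrite mulrA; apply: ler_wpM2r; rewrite ?exprn_ge0.
rewrite -mulr_sumr (mulrC 2) -mulrA; apply: ler_wpM2l => //.
rewrite -[n.+1]add0n big_addn add0n.
under eq_bigr do rewrite exprD.
by rewrite -mulr_suml; apply: ler_wpM2r => //; exact: exprn_ge0.
Qed.

(** * Continuity and the identity theorem along segments *)

Lemma cvgc_eps_deltaP (R : realType) (f : R[i] -> R[i]) (z l : R[i]) :
  (f w @[w --> z] --> l) <->
  forall e : R, 0 < e -> exists2 d : R, 0 < d &
    forall w, cabs (w - z) < d -> cabs (f w - l) < e.
Proof.
split=> [fl e e0|h P /nbhs_cabsP[e e0 eP]].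
  have : nbhs l [set w : R[i] | cabs (w - l) < e] by apply/nbhs_cabsP; exists e.
  by move=> /fl /nbhs_cabsP[d d0 hd]; exists d.
have [d d0 hd] := h e e0; apply/nbhs_cabsP; exists d => // w /hd; exact: eP.
Qed.

Lemma analytic_at_continuous (R : realType) (f : R[i] -> R[i]) (z : R[i]) :
  analytic_at f z -> f w @[w --> z] --> f z.
Proof.
move=> /analytic_power_series_at[a [r [M fa]]].
have [r0 aM _] := fa.
have bnd := @power_series_at_remainder _ _ _ _ _ _ 0 fa.
have {bnd} bnd w : cabs (w - z) <= r / 2 ->
    cabs (f w - a 0%N) <= 2 * M * (cabs (w - z) / r).
  by move=> wz; have := bnd (fun k (h : (k < 0)%N) => False_ind _ (notF h)) w wz;
    rewrite expr0 mulr1 expr1.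
have fz : f z = a 0%N.
  apply/eqP; rewrite -subr_eq0 -cabs_eq0 eq_le cabs_ge0 andbT.
  have := bnd z; rewrite subrr cabs0 mul0r mulr0; apply.
  by rewrite divr_ge0 ?(ltW r0).
have M0 : 0 <= M by have := aM 0%N; rewrite expr0 mulr1; apply: le_trans (cabs_ge0 _).
apply/cvgc_eps_deltaP => e e0.
pose d := Num.min (r / 2) (e * r / (2 * M + 1)).
exists d.
  by rewrite lt_min !divr_gt0//= ?mulr_gt0// ltr_wpDl// mulr_ge0.
move=> w; rewrite lt_min => /andP[w1 w2].
rewrite fz; apply: le_lt_trans (bnd w (ltW w1)) _.
rewrite mulrA ltr_pdivrMr//; apply: (@le_lt_trans _ _ ((2 * M + 1) * cabs (w - z))).
  by apply: ler_wpM2r; rewrite ?cabs_ge0// lerDl.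
by move: w2; rewrite ltr_pdivlMr ?ltr_wpDl ?mulr_ge0// mulrC.
Qed.

(** By strong induction every coefficient vanishes: if all earlier ones do, the remainder bound at a
    zero w other than z gives |a n| <= const |w - z|, and such zeros come arbitrarily close to z. *)
Lemma analytic_at_zero (R : realType) (f : R[i] -> R[i]) (z : R[i]) :
  analytic_at f z ->
  (forall e : R, 0 < e -> exists w, [/\ w != z, cabs (w - z) < e & f w = 0]) ->
  \forall w \near z, f w = 0.
Proof.
move=> /analytic_power_series_at[a [r [M fa]]] acc.
have [r0 aM fw] := fa.
have M0 : 0 <= M by have := aM 0%N; rewrite expr0 mulr1; apply: le_trans (cabs_ge0 _).
have a0 n : a n = 0.
  have [k] := ubnP n; elim: k n => // k IH n /ltnSE nk.
  have aj j : (j < n)%N -> a j = 0 by move=> jn; apply: IH; apply: leq_trans nk.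
  have bnd := power_series_at_remainder fa aj.
  apply/eqP; rewrite -cabs_eq0 eq_le cabs_ge0 andbT.
  apply/ler_addgt0Pr => e e0; rewrite add0r.
  (* At a zero w within d of z, the remainder bound divided by |w - z|^n is at most e; the 1 in 2M +
     1 guards against M = 0. *)
  pose d := Num.min (r / 2) (e * r ^+ n.+1 / (2 * M + 1)).
  have d0 : 0 < d.
    by rewrite lt_min !divr_gt0//= ?mulr_gt0// ?exprn_gt0// ltr_wpDl// mulr_ge0.
  have [w [wz]] := acc d d0; rewrite lt_min => /andP[w1 w2] fw0.
  have u0 : 0 < cabs (w - z) by rewrite lt_def cabs_eq0 subr_eq0 wz cabs_ge0.
  have := bnd w (ltW w1); rewrite fw0 sub0r cabsN cabsM cabsX.
  rewrite exprMn exprS mulrA mulrA (mulrAC _ (cabs _ ^+ n)).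
  rewrite ler_pM2r ?exprn_gt0// => /le_trans; apply.
  rewrite exprVn ler_pdivrMr ?exprn_gt0//.
  apply: (@le_trans _ _ ((2 * M + 1) * cabs (w - z))).
    by apply: ler_wpM2r; rewrite ?cabs_ge0// lerDl.
  by move: w2; rewrite ltr_pdivlMr ?ltr_wpDl ?mulr_ge0// mulrC => /ltW.
apply/nbhs_cabsP; exists r => // w /fw h.
apply/esym; apply: (cvgc_unique _ h); apply/cvgc_cabsP; apply: cvg_near_cst.
apply: nearW => n; rewrite /series/= big1 ?subrr ?cabs0// => i _.
by rewrite a0 mul0r.
Qed.

Lemma near_zero_open (R : realType) (f : R[i] -> R[i]) (z : R[i]) :
  (\forall w \near z, f w = 0) -> exists2 e : R, 0 < e &
    forall w, cabs (w - z) < e -> \forall v \near w, f v = 0.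
Proof.
move=> /nbhs_cabsP[e e0 h]; exists e => // w wz; apply/nbhs_cabsP.
exists (e - cabs (w - z)); first by rewrite subr_gt0.
move=> v vw; apply: h; rewrite -(subrK w v) -addrA.
by apply: le_lt_trans (cabsD _ _) _; rewrite -ltrBrDr.
Qed.

Lemma near_zero_at (R : realType) (f : R[i] -> R[i]) (z : R[i]) :
  (\forall w \near z, f w = 0) -> f z = 0.
Proof. by move=> /nbhs_cabsP[e e0]; apply; rewrite subrr cabs0. Qed.

(** Connectedness of the segment, by a supremum: c is the last parameter up to which f vanishes near
    every point. Accumulation of zeros gives vanishing near c itself, and openness then pushes
    beyond c unless c = 1. *)
Lemma analytic_segment_zero (R : realType) (f : R[i] -> R[i]) (p d : R[i]) :
  (forall x : R, 0 <= x <= 1 -> analytic_at f (p + x%:C * d)) ->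
  (\forall w \near p, f w = 0) -> f (p + d) = 0.
Proof.
move=> fan fp.
have [d0|d0] := eqVneq d 0; first by rewrite d0 addr0; exact: near_zero_at.
have cd0 : 0 < cabs d by rewrite lt_def cabs_eq0 d0 cabs_ge0.
pose Z x := \forall w \near p + x%:C * d, f w = 0.
have Zo x : Z x -> exists2 e : R, 0 < e & forall y, `|y - x| < e -> Z y.
  move=> /near_zero_open[e e0 h]; exists (e / cabs d); first by rewrite divr_gt0.
  move=> y yx; apply: h.
  rewrite opprD addrACA subrr add0r -mulrBl -rmorphB cabsM cabs_real.
  by rewrite -ltr_pdivlMr.
pose S : set R := [set x | 0 <= x <= 1 /\ forall y, 0 <= y <= x -> Z y].
have S0 : S 0.
  split; first by rewrite lexx ler01.
  by move=> y; rewrite -eq_le => /eqP <-; rewrite /Z mul0r addr0.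
have Sub : ubound S 1 by move=> x [/andP[]].
have hS : has_sup S by split; [exists 0|exists 1].
set c := sup S.
have c0 : 0 <= c by apply: ub_le_sup => //; exists 1.
have c1 : c <= 1 by apply: ge_sup => //; exists 0.
have lt_c y : 0 <= y -> y < c -> Z y.
  move=> y0 yc.
  have cy : 0 < c - y by rewrite subr_gt0.
  have [x [x01 Sx] yx] := sup_adherent cy hS.
  by apply: Sx; rewrite y0 ltW//; move: yx; rewrite opprB addrCA subrr addr0.
(* For c > 0 the zeros at parameters just left of c accumulate at c; for c = 0 the vanishing near p
   applies. *)
have Zc : Z c.
  have [/eqP->|cn0] := boolP (c == 0).
    by case: S0 => _; apply; rewrite lexx.
  apply: analytic_at_zero; first by apply: fan; rewrite c0 c1.
  move=> e e0.
  have cgt0 : 0 < c by rewrite lt_def cn0.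
  pose y := Num.max 0 (c - e / 2 / cabs d).
  have yc : y < c by rewrite gt_max cgt0/= ltrBlDr ltrDl !divr_gt0.
  exists (p + y%:C * d).
  have E : p + y%:C * d - (p + c%:C * d) = (y - c)%:C * d.
    by rewrite opprD addrACA subrr add0r -mulrBl -rmorphB.
  split.
  - rewrite -subr_eq0 E mulf_eq0 (negbTE d0) orbF -(rmorph0 (real_complex R)).
    by rewrite (inj_eq (@complexI R)) subr_eq0 lt_eqF.
  - rewrite E cabsM cabs_real ltr0_norm ?subr_lt0// opprB -ltr_pdivlMr//.
    have : c - e / 2 / cabs d <= y by rewrite le_max lexx orbT.
    have : e / 2 / cabs d < e / cabs d.
      by rewrite ltr_pM2r ?invr_gt0// ltr_pdivrMr// ltr_pMr// ltr1n.
    lra.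
  - by apply: near_zero_at; apply: lt_c => //; rewrite le_max lexx.
have [e e0 Ze] := Zo c Zc.
have [c1'|/eqP c1'] := boolP (c == 1).
  by apply: near_zero_at; move: Zc; rewrite /Z (eqP c1') mul1r.
have c1lt : c < 1 by rewrite lt_def c1 eq_sym andbT; apply/eqP.
pose x := Num.min 1 (c + e / 2).
have cx : c < x by rewrite lt_min c1lt ltrDl divr_gt0.
have Sx : S x.
  split; first by rewrite (le_trans c0 (ltW cx)) ge_min lexx.
  move=> y /andP[y0 yx]; have [yc|cy] := ltP y c; first exact: lt_c.
  apply: Ze; rewrite ger0_norm ?subr_ge0//.
  have : x <= c + e / 2 by rewrite ge_min lexx orbT.
  lra.
have : x <= c by apply: ub_le_sup => //; exists 1.
by rewrite leNgt cx.
Qed.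

(** * The complex exponential and its power series *)

Lemma cexpD (R : realType) (z w : R[i]) : cexp (z + w) = cexp z * cexp w.
Proof.
case: z => a b; case: w => c d; rewrite /cexp /= expRD cosD sinD.
by apply/eqP; rewrite eq_complex /=; apply/andP; split; apply/eqP; ring.
Qed.

Lemma cexp0 (R : realType) : cexp (0 : R[i]) = 1.
Proof. by rewrite /cexp /= expR0 cos0 sin0 mulr1 mulr0. Qed.

Lemma cabs_cexp (R : realType) (z : R[i]) : cabs (cexp z) = expR (complex.Re z).
Proof.
rewrite cabs_sqrt /cexp/= !exprMn -mulrDr cos2Dsin2 mulr1 sqrtr_sqr.
by rewrite ger0_norm// expR_ge0.
Qed.

Lemma cexp_neq0 (R : realType) (z : R[i]) : cexp z != 0.
Proof. by rewrite -cabs_eq0 cabs_cexp gt_eqF// expR_gt0. Qed.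

Lemma cexp_real (R : realType) (x : R) : cexp x%:C = (expR x)%:C.
Proof. by rewrite /cexp /= cos0 sin0 mulr1 mulr0. Qed.

Lemma series_exp_coeff_le (R : realType) (x : R) (n : nat) :
  \sum_(0 <= k < n) `|x| ^+ k / k`!%:R <= expR `|x|.
Proof.
have nd : nondecreasing_seq (series (exp_coeff `|x|)).
  by apply/nondecreasing_series => k _ _; exact: exp_coeff_ge0.
exact: nondecreasing_cvgn_le nd (is_cvg_series_exp_coeff `|x|) n.
Qed.

Lemma exp_coeff_le (R : realType) (x : R) (n : nat) :
  `|x| ^+ n / n`!%:R <= expR `|x|.
Proof.
apply: le_trans (series_exp_coeff_le x n.+1).
rewrite big_nat_recr//= lerDr; apply: sumr_ge0 => i _.
by rewrite divr_ge0 ?exprn_ge0.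
Qed.

(** The bound of [exp_coeff_le] at 8 |x|; it puts the exponential series under the ratio 1/8 of
    [cvg_cauchy_product]. *)
Lemma exp_coeff_geometric (R : realType) (x : R) (n : nat) :
  `|x| ^+ n / n`!%:R <= expR (8 * `|x|) * 8^-1 ^+ n.
Proof.
have := exp_coeff_le (8 * `|x|) n; rewrite ger0_norm ?mulr_ge0//.
rewrite exprMn => h; rewrite exprVn ler_pdivlMr ?exprn_gt0//.
by apply: le_trans h; rewrite mulrC mulrA.
Qed.

Lemma ReMi (R : realType) (x : R) n : complex.Re (('i * x%:C) ^+ n / n`!%:R) =
  cos_coeff x n /\ complex.Im (('i * x%:C) ^+ n / n`!%:R) = sin_coeff x n.
Proof.
have E k : ('i * x%:C) ^+ k.*2 = ((-1) ^+ k * x ^+ k.*2)%:C :> R[i].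
  by rewrite exprMn -!mul2n !exprM sqr_i rmorphM/= !rmorphXn/= rmorphN1.
have fE : (n`!%:R : R[i])^-1 = (n`!%:R^-1)%:C.
  by rewrite fmorphV rmorph_nat.
rewrite fE /cos_coeff /sin_coeff/=; set c := (n`!%:R)^-1.
move: c (odd n) n./2 (odd_double_half n) {fE} => c b k <-.
case: b => /=; rewrite ?add0n ?add1n.
  rewrite !exprS E /= doubleK.
  set A := (-1) ^+ k; set B := x ^+ k.*2.
  by split; ring.
rewrite E /= -exprnP; set D := (-1) ^+ _./2.
set A := (-1) ^+ k; set B := x ^+ k.*2.
by split; ring.
Qed.

(** As [cexp] is built from the real exponential, cosine and sine, its series is obtained as the
    Cauchy product of the series of e^x and of e^(iy); the binomial theorem identifies the terms
    with (x + iy)^n / n!. *)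
Lemma cvg_series_cexp (R : realType) (z : R[i]) :
  [series z ^+ n / n`!%:R]_n @ \oo --> cexp z.
Proof.
case: z => x y.
pose a n : R[i] := (x ^+ n / n`!%:R)%:C.
pose b n : R[i] := ('i * y%:C) ^+ n / n`!%:R.
have aM n : cabs (a n) <= (expR (8 * `|x|) + expR (8 * `|y|)) * 8^-1 ^+ n.
  rewrite cabs_real normrM normfV normr_nat normrX.
  apply: le_trans (exp_coeff_geometric _ _) _.
  by apply: ler_wpM2r; rewrite ?exprn_ge0 ?invr_ge0// lerDl expR_ge0.
have bM n : cabs (b n) <= (expR (8 * `|x|) + expR (8 * `|y|)) * 8^-1 ^+ n.
  rewrite /b cabsM cabsX cabsM cabs_real cabs_sqrt/= expr0n add0r expr1n sqrtr1.
  rewrite mul1r -(rmorph_nat (real_complex R)) -fmorphV cabs_real normfV normr_nat.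
  apply: le_trans (exp_coeff_geometric _ _) _.
  by apply: ler_wpM2r; rewrite ?exprn_ge0 ?invr_ge0// lerDr expR_ge0.
have aA : series a @ \oo --> (expR x)%:C.
  apply/cvgc_ReImP; split.
    under eq_cvg do rewrite /series/= Re_sum.
    exact: is_cvg_series_exp_coeff.
  by under eq_cvg do rewrite /series/= Im_sum big1//; exact: cvg_cst.
have bB : series b @ \oo --> (cos y +i* sin y).
  have cb : (fun n => complex.Re (series b n)) @ \oo --> cos y.
    rewrite (_ : (fun _ => _) = series (cos_coeff y)).
      rewrite cos.unlock; exact: is_cvg_series_cos_coeff.
    apply/funext => n; rewrite /series/= Re_sum; apply: eq_bigr => k _.
    by rewrite (ReMi _ _).1.
  have sb : (fun n => complex.Im (series b n)) @ \oo --> sin y.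
    rewrite (_ : (fun _ => _) = series (sin_coeff y)).
      rewrite sin.unlock; exact: is_cvg_series_sin_coeff.
    apply/funext => n; rewrite /series/= Im_sum; apply: eq_bigr => k _.
    by rewrite (ReMi _ _).2.
  by apply/cvgc_ReImP; split.
have -> : cexp (x +i* y) = (expR x)%:C * (cos y +i* sin y).
  by apply/eqP; rewrite eq_complex /cexp /= !mul0r subr0 addr0 !eqxx.
have := cvg_cauchy_product aM bM aA bB.
apply: cvg_trans; apply: near_eq_cvg; apply: nearW => n.
rewrite /series/=; apply: eq_bigr => k _.
have -> : x +i* y = x%:C + 'i * y%:C by rewrite [LHS]complexE.
rewrite exprDn mulr_suml big_mkord.
rewrite (reindex_inj rev_ord_inj)/=; apply: eq_bigr => -[i ik] _ /=.
rewrite /a /b subSS subKn// rmorphM rmorphXn fmorphV rmorph_nat/=.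
have ik' : (i <= k)%N by [].
have kn0 : (k`!%:R : R[i]) != 0 by rewrite pnatr_eq0 -lt0n fact_gt0.
have -> : (k`!%:R : R[i]) = ('C(k, i) * (i`! * (k - i)`!))%:R.
  by rewrite bin_fact.
rewrite -bin_sub// -mulr_natr !natrM.
field.
by rewrite !pnatr_eq0 -!lt0n !fact_gt0 bin_gt0 leq_subr.
Qed.

(** * Complex-valued integrals and their analytic dependence on a parameter *)

Lemma Rintegral_dominated_cvg (R : realType) (D : set R) (f_ : nat -> R -> R)
    (f g : R -> R) :
  measurable D -> (forall n, measurable_fun D (f_ n)) ->
  (forall x, D x -> f_ n x @[n --> \oo] --> f x) ->
  (@lebesgue_measure R).-integrable D (EFin \o g) ->
  (forall n x, D x -> `|f_ n x| <= g x) ->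
  (@lebesgue_measure R).-integrable D (EFin \o f) /\
  \int[@lebesgue_measure R]_(x in D) f_ n x @[n --> \oo] -->
  \int[@lebesgue_measure R]_(x in D) f x.
Proof.
move=> mD mf_ ff ig fg.
have mf : measurable_fun D f := measurable_realfun.measurable_fun_cvg mf_ ff.
have [] := @dominated_convergence _ _ _ (@lebesgue_measure R) D mD
  (fun n => EFin \o f_ n) (EFin \o f) (EFin \o g).
- by move=> n; apply/measurable_EFinP; exact: mf_.
- exact/measurable_EFinP.
- by apply: aeW => x Dx; apply/fine_cvgP; split; [exact: nearW|exact: ff].
- exact: ig.
- by apply: aeW => x n Dx; rewrite /= lee_fin; exact: fg.
move=> intf _ h; split => //.
apply: fine_cvg; rewrite fineK//; exact: integrable_fin_num.
Qed.

Definition cmeasurable (R : realType) (D : set R) (f : R -> R[i]) : Prop :=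
  measurable_fun D (fun x => complex.Re (f x)) /\
  measurable_fun D (fun x => complex.Im (f x)).

Lemma cmeasurableM (R : realType) (D : set R) (f g : R -> R[i]) :
  cmeasurable D f -> cmeasurable D g -> cmeasurable D (fun x => f x * g x).
Proof.
move=> [fr fi] [gr gi]; split.
  rewrite (_ : (fun _ => _) = fun x => complex.Re (f x) * complex.Re (g x) -
     complex.Im (f x) * complex.Im (g x)); last by apply/funext => x; rewrite ReM.
  by apply: measurable_funB; apply: measurable_funM.
rewrite (_ : (fun _ => _) = fun x => complex.Re (f x) * complex.Im (g x) +
   complex.Im (f x) * complex.Re (g x)); last by apply/funext => x; rewrite ImM.
by apply: measurable_funD; apply: measurable_funM.
Qed.

Lemma cmeasurable_cst (R : realType) (D : set R) (c : R[i]) :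
  cmeasurable D (fun=> c).
Proof. by split; exact: measurable_cst. Qed.

Lemma cmeasurable_real (R : realType) (D : set R) (f : R -> R) :
  measurable_fun D f -> cmeasurable D (fun x => (f x)%:C).
Proof. by move=> mf; split => //=; exact: measurable_cst. Qed.

Lemma cmeasurableD (R : realType) (D : set R) (f g : R -> R[i]) :
  cmeasurable D f -> cmeasurable D g -> cmeasurable D (fun x => f x + g x).
Proof.
move=> [fr fi] [gr gi]; split.
  rewrite (_ : (fun _ => _) = fun x => complex.Re (f x) + complex.Re (g x)).
    exact: measurable_funD.
  by apply/funext => x; rewrite ReD.
rewrite (_ : (fun _ => _) = fun x => complex.Im (f x) + complex.Im (g x)).
  exact: measurable_funD.
by apply/funext => x; rewrite ImD.
Qed.

Lemma cmeasurable_sum (R : realType) (D : set R) (f : nat -> R -> R[i]) n :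
  (forall k, cmeasurable D (f k)) ->
  cmeasurable D (fun x => \sum_(0 <= k < n) f k x).
Proof.
move=> mf; elim: n => [|n IH].
  rewrite (_ : (fun _ => _) = fun=> 0); first exact: cmeasurable_cst.
  by apply/funext => x; rewrite big_geq.
rewrite (_ : (fun _ => _) = fun x => \sum_(0 <= k < n) f k x + f n x).
  exact: cmeasurableD.
by apply/funext => x; rewrite big_nat_recr.
Qed.

Lemma cmeasurable_cexp (R : realType) (D : set R) (f : R -> R[i]) :
  cmeasurable D f -> cmeasurable D (fun x => cexp (f x)).
Proof.
move=> [fr fi]; split; rewrite /cexp /=; apply: measurable_funM.
- by apply: measurableT_comp => //; apply: continuous_measurable_fun; exact: continuous_expR.
- by apply: measurableT_comp => //; apply: continuous_measurable_fun; exact: continuous_cos.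
- by apply: measurableT_comp => //; apply: continuous_measurable_fun; exact: continuous_expR.
- by apply: measurableT_comp => //; apply: continuous_measurable_fun; exact: continuous_sin.
Qed.

Lemma le_cintegrable (R : realType) (D : set R) (f : R -> R[i]) (g : R -> R) :
  measurable D -> cmeasurable D f ->
  (@lebesgue_measure R).-integrable D (EFin \o g) ->
  (forall x, D x -> cabs (f x) <= g x) -> cintegrable D f.
Proof.
move=> mD [mr mi] ig fg; split.
  apply: (@le_integrable _ _ _ (@lebesgue_measure R) D mD _ (EFin \o g) _ _ ig); first exact/measurable_EFinP.
  move=> x Dx; rewrite /= lee_fin; apply: (le_trans (normr_Re_le _)).
  by rewrite (le_trans (fg _ Dx))// ler_norm.
apply: (@le_integrable _ _ _ (@lebesgue_measure R) D mD _ (EFin \o g) _ _ ig); first exact/measurable_EFinP.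
move=> x Dx; rewrite /= lee_fin; apply: (le_trans (normr_Im_le _)).
by rewrite (le_trans (fg _ Dx))// ler_norm.
Qed.

Lemma cintegrable_cmeasurable (R : realType) (D : set R) (f : R -> R[i]) :
  cintegrable D f -> cmeasurable D f.
Proof.
by move=> [/measurable_int/measurable_EFinP ? /measurable_int/measurable_EFinP ?].
Qed.

Lemma cintegral_dominated_cvg (R : realType) (D : set R) (f_ : nat -> R -> R[i])
    (f : R -> R[i]) (g : R -> R) :
  measurable D -> (forall n, cmeasurable D (f_ n)) ->
  (forall x, D x -> f_ n x @[n --> \oo] --> f x) ->
  (@lebesgue_measure R).-integrable D (EFin \o g) ->
  (forall n x, D x -> cabs (f_ n x) <= g x) ->
  cintegrable D f /\ cintegral D (f_ n) @[n --> \oo] --> cintegral D f.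
Proof.
move=> mD mf_ ff ig fg.
have [] := @Rintegral_dominated_cvg R D (fun n x => complex.Re (f_ n x))
  (fun x => complex.Re (f x)) g mD.
- by move=> n; case: (mf_ n).
- by move=> x Dx; case: (proj1 (cvgc_ReImP _ _) (ff x Dx)).
- exact: ig.
- by move=> n x Dx; apply: le_trans (normr_Re_le _) (fg n x Dx).
move=> ir cr.
have [] := @Rintegral_dominated_cvg R D (fun n x => complex.Im (f_ n x))
  (fun x => complex.Im (f x)) g mD.
- by move=> n; case: (mf_ n).
- by move=> x Dx; case: (proj1 (cvgc_ReImP _ _) (ff x Dx)).
- exact: ig.
- by move=> n x Dx; apply: le_trans (normr_Im_le _) (fg n x Dx).
move=> ii ci; split => //.
by apply/cvgc_ReImP; split.
Qed.

Lemma cintegrableD (R : realType) (D : set R) (f g : R -> R[i]) :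
  measurable D -> cintegrable D f -> cintegrable D g ->
  cintegrable D (fun x => f x + g x) /\
  cintegral D (fun x => f x + g x) = cintegral D f + cintegral D g.
Proof.
move=> mD [fr fi] [gr gi]; split.
  split.
    under eq_fun do rewrite ReD EFinD; exact: integrableD.
  under eq_fun do rewrite ImD EFinD; exact: integrableD.
rewrite /cintegral; congr (_ +i* _).
  by under eq_Rintegral do rewrite ReD; rewrite RintegralD.
by under eq_Rintegral do rewrite ImD; rewrite RintegralD.
Qed.

Lemma cintegrableZ (R : realType) (D : set R) (f : R -> R[i]) (c : R[i]) :
  measurable D -> cintegrable D f ->
  cintegrable D (fun x => c * f x) /\
  cintegral D (fun x => c * f x) = c * cintegral D f.
Proof.
move=> mD [fr fi]; case: c => a b.
have s (r : R) (h : R -> R) : (@lebesgue_measure R).-integrable D (EFin \o h) ->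
    (@lebesgue_measure R).-integrable D (EFin \o (fun x => r * h x)).
  by move=> ih; rewrite /comp; under eq_fun do rewrite EFinM; exact: integrableZl.
split.
  split.
    under eq_fun do rewrite ReM/= EFinB.
    by apply: integrableB => //; exact: s.
  under eq_fun do rewrite ImM/= EFinD.
  by apply: integrableD => //; exact: s.
rewrite /cintegral; apply/eqP; rewrite eq_complex /=.
under eq_Rintegral do rewrite ReM/=.
under [X in _ && (X == _)]eq_Rintegral do rewrite ImM/=.
rewrite RintegralB//; [|exact: s..].
rewrite RintegralD//; [|exact: s..].
by rewrite !RintegralZl// !eqxx.
Qed.

Lemma cintegrable_sum (R : realType) (D : set R) (f : nat -> R -> R[i]) n :
  measurable D -> (forall k, cintegrable D (f k)) ->
  cintegrable D (fun x => \sum_(0 <= k < n) f k x) /\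
  cintegral D (fun x => \sum_(0 <= k < n) f k x) =
  \sum_(0 <= k < n) cintegral D (f k).
Proof.
move=> mD fi; elim: n => [|n [IH1 IH2]].
  rewrite (_ : (fun _ => _) = fun=> 0); last by apply/funext => x; rewrite big_geq.
  split; first by split; exact: integrable0.
  by rewrite big_geq// /cintegral Rintegral_cst// mul0r.
rewrite (_ : (fun _ => _) = fun x => \sum_(0 <= k < n) f k x + f n x); last first.
  by apply/funext => x; rewrite big_nat_recr.
by have [? ->] := cintegrableD mD IH1 (fi n); split => //; rewrite IH2 big_nat_recr.
Qed.

Lemma eq_cintegral (R : realType) (D : set R) (f g : R -> R[i]) :
  (forall x, D x -> f x = g x) -> cintegral D f = cintegral D g.
Proof.
by move=> fg; rewrite /cintegral; congr (_ +i* _); apply: eq_Rintegral => x;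
  rewrite inE => Dx; rewrite fg.
Qed.

Lemma eq_cintegrable (R : realType) (D : set R) (f g : R -> R[i]) :
  measurable D ->
  (forall x, D x -> f x = g x) -> cintegrable D f -> cintegrable D g.
Proof.
move=> mD fg [fr fi]; split.
  by apply: eq_integrable fr => // x; rewrite inE => Dx; rewrite fg.
by apply: eq_integrable fi => // x; rewrite inE => Dx; rewrite fg.
Qed.

(** Expand e^((z - z0) L) in powers of z - z0 and integrate term by term. For |z - z0| < r all
    partial sums are dominated by e^(Re z0 L + r |L|) |h|, the function assumed integrable, and the
    coefficients are the integrals of L^k / k! e^(z0 L) h. *)
Lemma exp_integral_analytic (R : realType) (D : set R) (L h : R -> R)
    (z0 : R[i]) (r : R) :
  measurable D -> measurable_fun D L -> measurable_fun D h -> 0 < r ->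
  (@lebesgue_measure R).-integrable D
    (EFin \o (fun x => expR (complex.Re z0 * L x + r * `|L x|) * `|h x|)) ->
  analytic_at
    (fun z => cintegral D (fun x => cexp (z * (L x)%:C) * (h x)%:C)) z0.
Proof.
move=> mD mL mh r0 ig.
set g := fun x : R => _ in ig.
pose G x := cexp (z0 * (L x)%:C) * (h x)%:C.
have mG : cmeasurable D G.
  apply: cmeasurableM; last exact: cmeasurable_real.
  apply: cmeasurable_cexp; apply: cmeasurableM; first exact: cmeasurable_cst.
  exact: cmeasurable_real.
pose t k x := (L x ^+ k / k`!%:R)%:C * G x.
have absG x : cabs (G x) = expR (complex.Re z0 * L x) * `|h x|.
  by rewrite cabsM cabs_cexp cabs_real ReM/= mulr0 subr0.
have mt k : cmeasurable D (t k).
  apply: cmeasurableM => //; apply: cmeasurable_real.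
  by apply: measurable_funM => //; exact: measurable_funX.
(* Each moment is dominated because (r |L|)^k / k! <= e^(r |L|). *)
have it k : cintegrable D (t k).
  apply: (@le_cintegrable _ _ _ (fun x => (r ^+ k)^-1 * g x)) => //.
    by rewrite /comp; under eq_fun do rewrite EFinM; exact: integrableZl.
  move=> x Dx; rewrite cabsM cabs_real absG /g expRD.
  rewrite ler_pdivlMl ?exprn_gt0//.
  set e := expR (_ * _); set E := expR (_ * `|_|).
  rewrite (_ : e * E * _ = E * (e * `|h x|)); last by ring.
  rewrite [leLHS]mulrA; apply: ler_wpM2r; first by rewrite mulr_ge0// expR_ge0.
  rewrite normrM normrX normfV normr_nat mulrA -exprMn.
  rewrite -[r * _]ger0_norm ?mulr_ge0 ?(ltW r0)//.
  apply: le_trans (exp_coeff_le _ _) _.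
  by rewrite (@ger0_norm _ (r * _)) ?mulr_ge0 ?(ltW r0)//.
exists (fun k => cintegral D (t k)); apply/nbhs_cabsP; exists r => // w wr.
set u := w - z0.
have [|||| iF cF] := @cintegral_dominated_cvg R D
  (fun n x => \sum_(0 <= k < n) u ^+ k * t k x)
  (fun x => cexp (w * (L x)%:C) * (h x)%:C) g mD.
- by move=> n; apply: (@cmeasurable_sum R D (fun k x => u ^+ k * t k x)) => k; apply: cmeasurableM; first exact: cmeasurable_cst.
- move=> x Dx.
  have -> : cexp (w * (L x)%:C) * (h x)%:C = cexp (u * (L x)%:C) * G x.
    by rewrite /G mulrA -cexpD -mulrDl subrK.
  rewrite (_ : (fun _ => _) = fun n =>
      [series (u * (L x)%:C) ^+ n / n`!%:R]_n n * G x); last first.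
    apply/funext => n; rewrite /series/= mulr_suml; apply: eq_bigr => k _.
    by rewrite /t exprMn rmorphM/= rmorphXn/= fmorphV rmorph_nat !mulrA.
  have h1 : [series (u * (L x)%:C) ^+ n / n`!%:R]_n @ \oo --> cexp (u * (L x)%:C).
    exact: cvg_series_cexp.
  have h2 : (fun=> G x) @ \oo --> G x by exact: cvg_cst.
  pose proof (@cvgcM R nat \oo _ _ _ _ _ h1 h2) as h3; exact: h3.
- exact: ig.
- move=> n x Dx; apply: le_trans (cabs_sum _ _ _) _.
  apply: (@le_trans _ _ (\sum_(0 <= k < n) `|r * `|L x| | ^+ k / k`!%:R * cabs (G x))).
    apply: ler_sum => k _; rewrite /t (cabsM (u ^+ k)) (cabsM _ (G x)) mulrA; apply: ler_wpM2r.
      exact: cabs_ge0.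
    rewrite (@ger0_norm _ (r * _)) ?mulr_ge0 ?(ltW r0)// cabsX cabs_real normrM normrX.
    rewrite normfV normr_nat mulrA -exprMn; apply: ler_wpM2r => //.
    rewrite lerXn2r ?nnegrE ?mulr_ge0 ?cabs_ge0 ?(ltW r0)//.
    by apply: ler_wpM2r => //; exact: ltW.
  rewrite -mulr_suml absG mulrA /g expRD [X in _ <= X * _]mulrC.
  apply: ler_wpM2r => //; apply: ler_wpM2r; first exact: expR_ge0.
  apply: le_trans (series_exp_coeff_le _ _) _.
  by rewrite ger0_norm// mulr_ge0// ltW.
move: cF; apply: cvg_trans; apply: near_eq_cvg; apply: nearW => n.
rewrite /series/=.
have it' k : cintegrable D (fun x => u ^+ k * t k x).
  by have [] := cintegrableZ (u ^+ k) mD (it k).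
rewrite (cintegrable_sum n mD it').2; apply: eq_bigr => k _.
by rewrite (cintegrableZ (u ^+ k) mD (it k)).2 mulrC.
Qed.

(** * Rules of differentiation on the real line *)

Lemma drv_eq (R : realType) (f : R -> R) (x a b : R) :
  is_derive x 1 f a -> a = b -> is_derive x 1 f b.
Proof. by move=> h <-. Qed.

Lemma drv_cst (R : realType) (c x : R) : is_derive x 1 (fun=> c) 0.
Proof. exact: is_derive_cst. Qed.

Lemma drv_id (R : realType) (x : R) : is_derive x 1 (fun y : R => y) 1.
Proof. exact: is_derive_id. Qed.

Lemma drvD (R : realType) (f g : R -> R) (x a b : R) :
  is_derive x 1 f a -> is_derive x 1 g b ->
  is_derive x 1 (fun y => f y + g y) (a + b).
Proof. by move=> fa gb; exact: is_deriveD. Qed.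

Lemma drvN (R : realType) (f : R -> R) (x a : R) :
  is_derive x 1 f a -> is_derive x 1 (fun y => - f y) (- a).
Proof. by move=> fa; exact: is_deriveN. Qed.

Lemma drvB (R : realType) (f g : R -> R) (x a b : R) :
  is_derive x 1 f a -> is_derive x 1 g b ->
  is_derive x 1 (fun y => f y - g y) (a - b).
Proof. by move=> fa gb; exact: is_deriveB. Qed.

Lemma drvM (R : realType) (f g : R -> R) (x a b : R) :
  is_derive x 1 f a -> is_derive x 1 g b ->
  is_derive x 1 (fun y => f y * g y) (a * g x + f x * b).
Proof.
move=> fa gb; apply: (drv_eq (is_deriveM fa gb)).
by rewrite addrC [X in X + _]mulrC.
Qed.

Lemma drvZ (R : realType) (f : R -> R) (c x a : R) :
  is_derive x 1 f a -> is_derive x 1 (fun y => c * f y) (c * a).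
Proof.
move=> fa; apply: (drv_eq (drvM (drv_cst c x) fa)).
by rewrite mul0r add0r.
Qed.

Lemma drvX (R : realType) (f : R -> R) (n : nat) (x a : R) :
  is_derive x 1 f a -> is_derive x 1 (fun y => f y ^+ n) (n%:R * f x ^+ n.-1 * a).
Proof.
move=> fa; elim: n => [|n IH].
  by rewrite mul0r mul0r; under eq_fun do rewrite expr0; exact: drv_cst.
under eq_fun do rewrite exprS; apply: (drv_eq (drvM fa IH)).
case: n {IH} => [|n]; first by rewrite /= !expr0; ring.
by rewrite /= exprS -!natr1; ring.
Qed.

Lemma drvV (R : realType) (f : R -> R) (x a : R) :
  is_derive x 1 f a -> f x != 0 ->
  is_derive x 1 (fun y => (f y)^-1) (- a / f x ^+ 2).
Proof.
move=> fa fx; apply: (drv_eq (is_deriveV fx fa)).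
by rewrite [LHS]mulrC mulrN mulNr.
Qed.

Lemma drv_comp (R : realType) (f g : R -> R) (x a b : R) :
  is_derive x 1 g b -> is_derive (g x) 1 f a ->
  is_derive x 1 (fun y => f (g y)) (a * b).
Proof. by move=> gb fa; exact: is_derive1_comp. Qed.

Lemma drv_expR (R : realType) (f : R -> R) (x a : R) :
  is_derive x 1 f a -> is_derive x 1 (fun y => expR (f y)) (expR (f x) * a).
Proof. by move=> fa; apply: (drv_comp fa); exact: is_derive_expR. Qed.

Lemma drv_cos (R : realType) (f : R -> R) (x a : R) :
  is_derive x 1 f a -> is_derive x 1 (fun y => cos (f y)) (- sin (f x) * a).
Proof. by move=> fa; apply: (drv_comp fa); exact: is_derive_cos. Qed.

Lemma drv_sin (R : realType) (f : R -> R) (x a : R) :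
  is_derive x 1 f a -> is_derive x 1 (fun y => sin (f y)) (cos (f x) * a).
Proof. by move=> fa; apply: (drv_comp fa); exact: is_derive_sin. Qed.

Lemma drv_ln (R : realType) (f : R -> R) (x a : R) :
  is_derive x 1 f a -> 0 < f x -> is_derive x 1 (fun y => ln (f y)) (a / f x).
Proof.
move=> fa f0; rewrite mulrC; apply: (drv_comp fa); exact: is_derive1_ln.
Qed.

Lemma drv_sqrt (R : realType) (f : R -> R) (x a : R) :
  is_derive x 1 f a -> 0 < f x ->
  is_derive x 1 (fun y => Num.sqrt (f y)) (a / (2 * Num.sqrt (f x))).
Proof.
move=> fa f0; rewrite mulrC; apply: (drv_comp fa); exact: is_derive1_sqrt.
Qed.

Lemma drv_continuous (R : realType) (f : R -> R) (x a : R) :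
  is_derive x 1 f a -> {for x, continuous f}.
Proof.
by move=> [df _]; apply: differentiable_continuous; exact/derivable1_diffP.
Qed.

Lemma drv_unique (R : realType) (f : R -> R) (x a b : R) :
  is_derive x 1 f a -> is_derive x 1 f b -> a = b.
Proof. by move=> [_ <-] [_ <-]. Qed.

Lemma drv_near (R : realType) (f g : R -> R) (x a : R) :
  (\forall y \near x, f y = g y) -> is_derive x 1 f a -> is_derive x 1 g a.
Proof.
by move=> fg; apply: near_eq_is_derive.
Qed.

Lemma within_continuous_itv (R : realType) (f : R -> R) (a b : R) :
  (forall x, a <= x <= b -> {for x, continuous f}) ->
  {within `[a, b], continuous f}.
Proof.
move=> cf; apply: continuous_in_subspaceT => x; rewrite inE/= in_itv/=.
exact: cf.
Qed.

Lemma drv_LRcontinuous (R : realType) (F f : R -> R) (a b : R) : a <= b ->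
  (forall x, a <= x <= b -> is_derive x 1 F (f x)) ->
  derivable_oo_LRcontinuous F a b.
Proof.
move=> ab dF; split.
- by move=> x; rewrite in_itv/= => /andP[ax xb]; case: (dF x); rewrite ?ltW.
- by apply: cvg_at_right_filter; apply: drv_continuous (dF a _); rewrite lexx.
- by apply: cvg_at_left_filter; apply: drv_continuous (dF b _); rewrite lexx andbT.
Qed.

Lemma drv_derive1 (R : realType) (F : R -> R) (x a : R) :
  is_derive x 1 F a -> derive1 F x = a.
Proof. by move=> [_ <-]; rewrite derive1E. Qed.

(** * Fundamental theorem, substitution and improper integrals *)

Lemma integral_drv (R : realType) (F f : R -> R) (a b : R) : a <= b ->
  (forall x, a <= x <= b -> is_derive x 1 F (f x)) ->
  (forall x, a <= x <= b -> {for x, continuous f}) ->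
  (\int[@lebesgue_measure R]_(x in `[a, b]) (f x)%:E = (F b - F a)%:E)%E.
Proof.
rewrite le_eqVlt => /predU1P[<- _ _|ab dF cf].
  by rewrite set_itv1 integral_set1 subrr.
rewrite (@continuous_FTC2 _ f F)//.
- exact: within_continuous_itv.
- by apply: (@drv_LRcontinuous _ F f); rewrite ?ltW.
- move=> x; rewrite in_itv/= => /andP[ax xb].
  by apply: drv_derive1; apply: dF; rewrite !ltW.
Qed.

Lemma lt_decreasing_drv (R : realType) (F f : R -> R) (a b : R) :
  (forall x, a <= x <= b -> is_derive x 1 F (f x)) ->
  (forall x, a <= x <= b -> f x < 0) ->
  {in `[a, b] &, {homo F : x y /~ x < y}}.
Proof.
move=> dF f0 x y; rewrite !in_itv/= => /andP[ax xb] /andP[ay yb] yx.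
have [||z zxy e] := @MVT R F f y x yx.
  by move=> z; rewrite in_itv/= => /andP[yz zx]; apply: dF; rewrite (le_trans ay (ltW yz)) (le_trans (ltW zx) xb).
  apply: within_continuous_itv => z /andP[yz zx].
  by apply: drv_continuous (dF z _); rewrite (le_trans ay yz) (le_trans zx xb).
move: zxy; rewrite in_itv/= => /andP[yz zx].
rewrite -subr_lt0 e; rewrite pmulr_llt0 ?subr_gt0//.
by apply: f0; rewrite (le_trans ay (ltW yz)) (le_trans (ltW zx) xb).
Qed.

Lemma integral_subst_decreasing (R : realType) (F f : R -> R) (G : R -> R)
    (a b : R) : a <= b ->
  (forall x, a <= x <= b -> is_derive x 1 F (f x)) ->
  (forall x, a <= x <= b -> {for x, continuous f}) ->
  (forall x, a <= x <= b -> f x < 0) ->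
  (forall u, F b <= u <= F a -> {for u, continuous G}) ->
  (\int[@lebesgue_measure R]_(u in `[F b, F a]) (G u)%:E =
   \int[@lebesgue_measure R]_(x in `[a, b]) (G (F x) * - f x)%:E)%E.
Proof.
rewrite le_eqVlt => /predU1P[<- *|ab dF cf f0 cG].
  by rewrite !set_itv1 !integral_set1.
have F'E x : a <= x <= b -> derive1 F x = f x by move=> /dF /drv_derive1.
rewrite (@integration_by_substitution_decreasing R F G a b)//.
- apply: eq_integral => x; rewrite inE/= in_itv/= => xab.
  by rewrite !fctE; congr ((_ * - _)%:E); exact: F'E.
- exact: ltW.
- exact: (lt_decreasing_drv dF f0).
- move=> x; rewrite in_itv/= => /andP[ax xb].
  have cfx : {for x, continuous f} by apply: cf; rewrite !ltW.
  rewrite /prop_for /continuous_at (F'E x) ?(ltW ax, ltW xb)//.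
  apply: cvg_trans cfx; apply: near_eq_cvg.
  near=> y; apply/esym/F'E; apply/andP; split; apply: ltW; near: y.
  + exact: lt_nbhsr.
  + exact: lt_nbhsl.
- apply/cvg_ex; exists (f a).
  have cfx : {for a, continuous f} by apply: cf; rewrite lexx ltW.
  apply: cvg_trans (cvg_at_right_filter cfx); apply: near_eq_cvg.
  near=> y; apply/esym/F'E; apply/andP; split; apply: ltW; near: y.
  + exact: nbhs_right_gt.
  + exact: nbhs_right_lt.
- apply/cvg_ex; exists (f b).
  have cfx : {for b, continuous f} by apply: cf; rewrite lexx ltW.
  apply: cvg_trans (cvg_at_left_filter cfx); apply: near_eq_cvg.
  near=> y; apply/esym/F'E; apply/andP; split; apply: ltW; near: y.
  + exact: nbhs_left_gt.
  + exact: nbhs_left_lt.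
- by apply: (@drv_LRcontinuous _ F f); rewrite ?ltW.
- exact: within_continuous_itv.
Unshelve. all: end_near. Qed.

(* Convergence along an exhaustion, the form in which improper integrals are
   computed below. *)
Lemma integral_exhaustion (R : realType) (I : nat -> set R) (f : R -> R) :
  (forall n, measurable (I n)) -> nondecreasing_seq I ->
  (@lebesgue_measure R).-integrable (\bigcup_n I n) (EFin \o f) ->
  \int[@lebesgue_measure R]_(x in I n) f x @[n --> \oo] -->
  \int[@lebesgue_measure R]_(x in \bigcup_n I n) f x.
Proof.
move=> mI ndI intf; set D := \bigcup_n I n in intf *.
have mD : measurable D by apply: bigcupT_measurable.
have ID n : I n `<=` D by move=> x Ix; exists n.
have [|||| _ h] := @Rintegral_dominated_cvg R D (fun n => f \_ (I n)) f
  (fun x => `|f x|) mD.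
- move=> n; apply/(measurable_restrict _ (mI n) mD).
  apply: (measurable_funS mD); first by apply: subIset; right.
  by have /measurable_int/measurable_EFinP := intf.
- move=> x [n _ Inx]; apply: cvg_near_cst; near=> k.
  rewrite patchE mem_set//.
  have /ndI : (n <= k)%N by near: k; exact: nbhs_infty_ge.
  by move=> /subsetPset; exact.
- by apply: integrable_abse intf.
- move=> n x _; rewrite patchE; case: ifP => // _; by rewrite normr0.
move: h; apply: cvg_trans; apply: near_eq_cvg; apply: nearW => n.
by rewrite -Rintegral_mkcondr setIidr.
Unshelve. all: end_near. Qed.

Lemma ge0_integral_exhaustion (R : realType) (I : nat -> set R) (f : R -> R) :
  (forall n, measurable (I n)) -> nondecreasing_seq I ->
  measurable_fun (\bigcup_n I n) f -> (forall x, (\bigcup_n I n) x -> 0 <= f x) ->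
  (\int[@lebesgue_measure R]_(x in I n) (f x)%:E @[n --> \oo] -->
  \int[@lebesgue_measure R]_(x in \bigcup_n I n) (f x)%:E)%E.
Proof.
move=> mI ndI mf f0.
apply: ge0_nondecreasing_set_cvg_integral => //.
- move=> n; apply/measurable_EFinP; apply: measurable_funS mf.
    exact: bigcupT_measurable.
  by move=> x Ix; exists n.
- by move=> n x Ix; rewrite lee_fin; apply: f0; exists n.
Qed.

Lemma ge0_integrable_exhaustion (R : realType) (I : nat -> set R) (f : R -> R)
    (M : R) :
  (forall n, measurable (I n)) -> nondecreasing_seq I ->
  measurable_fun (\bigcup_n I n) f -> (forall x, (\bigcup_n I n) x -> 0 <= f x) ->
  (forall n, (\int[@lebesgue_measure R]_(x in I n) (f x)%:E <= M%:E)%E) ->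
  (@lebesgue_measure R).-integrable (\bigcup_n I n) (EFin \o f).
Proof.
move=> mI ndI mf f0 fM; apply/integrableP; split; first exact/measurable_EFinP.
rewrite (@eq_integral _ _ _ (@lebesgue_measure R) _ (fun x => (f x)%:E)); last first.
  by move=> x; rewrite inE => Dx; rewrite /= ger0_norm//; exact: f0.
apply: (@le_lt_trans _ _ M%:E); last exact: ltry.
have h := ge0_integral_exhaustion mI ndI mf f0.
by apply: (cvge_to_le h); apply: nearW.
Qed.

(** The substitution rule is assumed on the compact pieces, for every continuous function. Applied
    to |g| it bounds the transformed integrals uniformly, hence gives integrability; applied to g it
    identifies the two limits along the exhaustions. *)
Lemma Rintegral_subst (R : realType) (I J : nat -> set R) (F w g : R -> R) :
  (forall n, measurable (I n)) -> (forall n, measurable (J n)) ->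
  nondecreasing_seq I -> nondecreasing_seq J ->
  (forall x, (\bigcup_n I n) x -> 0 <= w x) ->
  measurable_fun (\bigcup_n I n) w ->
  measurable_fun (\bigcup_n I n) (fun x => g (F x)) ->
  (forall h : R -> R, (forall u, (\bigcup_n J n) u -> {for u, continuous h}) ->
     forall n, (\int[@lebesgue_measure R]_(u in J n) (h u)%:E =
       \int[@lebesgue_measure R]_(x in I n) (h (F x) * w x)%:E)%E) ->
  (forall u, (\bigcup_n J n) u -> {for u, continuous g}) ->
  (@lebesgue_measure R).-integrable (\bigcup_n J n) (EFin \o g) ->
  (@lebesgue_measure R).-integrable (\bigcup_n I n)
    (EFin \o (fun x => g (F x) * w x)) /\
  \int[@lebesgue_measure R]_(u in \bigcup_n J n) g u =
  \int[@lebesgue_measure R]_(x in \bigcup_n I n) (g (F x) * w x).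
Proof.
move=> mI mJ ndI ndJ w0 mw mgF subst cg ig.
have mD : measurable (\bigcup_n J n) by apply: bigcupT_measurable.
have mD' : measurable (\bigcup_n I n) by apply: bigcupT_measurable.
have ig' : (@lebesgue_measure R).-integrable (\bigcup_n I n)
    (EFin \o (fun x => g (F x) * w x)).
  apply: (@le_integrable _ _ _ (@lebesgue_measure R) _ mD' _
    (EFin \o (fun x => `|g (F x)| * w x))).
  - by apply/measurable_EFinP; exact: measurable_funM.
  - by move=> x Dx; rewrite /= lee_fin !normrM normr_id.
  apply: (@ge0_integrable_exhaustion _ _ _
    (fine (\int[@lebesgue_measure R]_(u in \bigcup_n J n) `|g u|%:E))) => //.
  - by apply: measurable_funM => //; exact: measurableT_comp.
  - by move=> x Dx; rewrite mulr_ge0// w0.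
  move=> n; rewrite -(subst (fun u => `|g u|)); last first.
    by move=> u Du; apply: continuous_comp; [exact: cg|exact: norm_continuous].
  rewrite fineK; last by apply: integrable_fin_num => //; exact: integrable_abse ig.
  apply: ge0_subset_integral => //.
  - exact: mJ.
  - apply/measurable_EFinP; apply: measurableT_comp => //.
    by have /measurable_int/measurable_EFinP := ig.
  - by move=> x Jx; exists n.
split=> //.
have h1 := integral_exhaustion mJ ndJ ig.
have h2 := integral_exhaustion mI ndI ig'.
have e : (fun n => \int[@lebesgue_measure R]_(x in I n) (g (F x) * w x)) =
    (fun n => \int[@lebesgue_measure R]_(u in J n) g u).
  by apply/funext => n; rewrite /Rintegral subst.
by rewrite e in h2; apply: (cvg_unique _ h1 h2).
Qed.

Lemma cintegral_subst (R : realType) (I J : nat -> set R) (F w : R -> R)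
    (G : R -> R[i]) :
  (forall n, measurable (I n)) -> (forall n, measurable (J n)) ->
  nondecreasing_seq I -> nondecreasing_seq J ->
  (forall x, (\bigcup_n I n) x -> 0 <= w x) ->
  measurable_fun (\bigcup_n I n) w ->
  cmeasurable (\bigcup_n I n) (fun x => G (F x)) ->
  (forall h : R -> R, (forall u, (\bigcup_n J n) u -> {for u, continuous h}) ->
     forall n, (\int[@lebesgue_measure R]_(u in J n) (h u)%:E =
       \int[@lebesgue_measure R]_(x in I n) (h (F x) * w x)%:E)%E) ->
  (forall u, (\bigcup_n J n) u -> {for u, continuous (fun u => complex.Re (G u))}) ->
  (forall u, (\bigcup_n J n) u -> {for u, continuous (fun u => complex.Im (G u))}) ->
  cintegrable (\bigcup_n J n) G ->
  cintegrable (\bigcup_n I n) (fun x => G (F x) * (w x)%:C) /\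
  cintegral (\bigcup_n J n) G =
  cintegral (\bigcup_n I n) (fun x => G (F x) * (w x)%:C).
Proof.
move=> mI mJ ndI ndJ w0 mw [mr mi] subst cr ci [ir ii].
have [ir' er] := Rintegral_subst mI mJ ndI ndJ w0 mw mr subst cr ir.
have [ii' ei] := Rintegral_subst mI mJ ndI ndJ w0 mw mi subst ci ii.
have hr x : complex.Re (G (F x) * (w x)%:C) = complex.Re (G (F x)) * w x.
  by rewrite ReM/= mulr0 subr0.
have hi x : complex.Im (G (F x) * (w x)%:C) = complex.Im (G (F x)) * w x.
  by rewrite ImM/= mulr0 add0r.
split; last first.
  rewrite /cintegral er ei; congr (_ +i* _).
    by apply: eq_Rintegral => x _; rewrite hr.
  by apply: eq_Rintegral => x _; rewrite hi.
split.
  by apply: eq_integrable ir' => //; [exact: bigcupT_measurable|move=> x _ /=; rewrite hr].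
by apply: eq_integrable ii' => //; [exact: bigcupT_measurable|move=> x _ /=; rewrite hi].
Qed.

Definition pos_itv (R : realType) (n : nat) : set R := `[n.+1%:R^-1, n.+1%:R]%classic.

Lemma pos_itv_bigcup (R : realType) :
  \bigcup_n (@pos_itv R n) = `]0, +oo[%classic.
Proof.
apply/seteqP; split => x /=.
  move=> [n _]; rewrite /pos_itv/= in_itv/= => /andP[h _].
  by rewrite in_itv/= andbT; apply: lt_le_trans h; rewrite invr_gt0.
rewrite in_itv/= andbT => x0.
pose n := (Num.truncn (x + x^-1)).+1.
have xn : x + x^-1 < n%:R by rewrite truncnS_gt.
have xi0 : 0 < x^-1 by rewrite invr_gt0.
exists n => //; rewrite /pos_itv/= in_itv/=; apply/andP; split.
  rewrite -[x]invrK lef_pV2 ?posrE//.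
  by rewrite -natr1; lra.
by rewrite -natr1; lra.
Qed.

Lemma pos_itv_nondecreasing (R : realType) : nondecreasing_seq (@pos_itv R).
Proof.
apply/nondecreasing_seqP => n; apply/subsetPset => x; rewrite /pos_itv/=.
rewrite !in_itv/= => /andP[h1 h2]; apply/andP; split.
  by apply: le_trans h1; rewrite lef_pV2 ?posrE// ler_nat.
by apply: (le_trans h2); rewrite ler_nat.
Qed.

Lemma measurable_pos_itv (R : realType) n : measurable (@pos_itv R n).
Proof. exact: measurable_itv. Qed.

(** The increasing map x -> c x is factored into the decreasing maps x -> - (c x) and u -> - u, so
    that [integral_subst_decreasing] serves twice. *)
Lemma integral_scale (R : realType) (c a b : R) (g : R -> R) : 0 < c -> a <= b ->
  (forall u, c * a <= u <= c * b -> {for u, continuous g}) ->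
  (\int[@lebesgue_measure R]_(u in `[(c * a)%R, (c * b)%R]) (g u)%:E =
   \int[@lebesgue_measure R]_(x in `[a, b]) (g (c * x)%R * c)%:E)%E.
Proof.
move=> c0 ab cg.
have d1 x : - (c * b) <= x <= - (c * a) -> is_derive x 1 (fun x => - x) (-1).
  by move=> _; exact: (drvN (drv_id x)).
have ab' : - (c * b) <= - (c * a) by rewrite lerN2 ler_pM2l.
have hN := @integral_subst_decreasing R _ (fun=> -1) g _ _ ab' d1.
rewrite /= !opprK in hN; rewrite hN {hN}.
- have d2 x : a <= x <= b -> is_derive x 1 (fun x => - (c * x)) (- c).
    by move=> _; apply: (drv_eq (drvN (drvZ c (drv_id x)))); rewrite mulr1.
  have h2 := @integral_subst_decreasing R _ (fun=> - c)
    (fun u => g (- u) * 1) a b ab d2.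
  rewrite h2.
  + by apply: eq_integral => x _; rewrite !opprK mulr1.
  + by move=> x _; exact: cst_continuous.
  + by move=> x _; rewrite oppr_lt0.
  + move=> u /andP[h1 h3]; apply: continuousM; last exact: cst_continuous.
    apply: continuous_comp; first exact: opp_continuous.
    by apply: cg; rewrite lerNr h3 lerNl h1.
- by move=> x _; exact: cst_continuous.
- by move=> x _; rewrite oppr_lt0.
- exact: cg.
Qed.

(** * Complex powers of a positive base *)

Lemma ReC (R : realType) (x : R) : complex.Re x%:C = x.
Proof. by []. Qed.

Lemma ImC (R : realType) (x : R) : complex.Im x%:C = 0.
Proof. by []. Qed.

Lemma cpowD (R : realType) (a : R) (z w : R[i]) :
  cpow a (z + w) = cpow a z * cpow a w.
Proof. by rewrite /cpow mulrDl cexpD. Qed.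

Lemma cpow0 (R : realType) (a : R) : cpow a 0 = 1.
Proof. by rewrite /cpow mul0r cexp0. Qed.

Lemma cpow_neq0 (R : realType) (a : R) (z : R[i]) : cpow a z != 0.
Proof. exact: cexp_neq0. Qed.

Lemma cpowN (R : realType) (a : R) (z : R[i]) : cpow a (- z) = (cpow a z)^-1.
Proof.
apply: (mulfI (cpow_neq0 a z)).
by rewrite -cpowD subrr cpow0 divff// cpow_neq0.
Qed.

Lemma cpow_mul (R : realType) (a b : R) (z : R[i]) : 0 < a -> 0 < b ->
  cpow (a * b) z = cpow a z * cpow b z.
Proof. by move=> a0 b0; rewrite /cpow lnM ?posrE// rmorphD/= mulrDr cexpD. Qed.

Lemma cpow_real (R : realType) (a x : R) : cpow a x%:C = (expR (x * ln a))%:C.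
Proof. by rewrite /cpow -rmorphM/= cexp_real. Qed.

Lemma cpow1 (R : realType) (a : R) : 0 < a -> cpow a 1 = a%:C.
Proof.
by move=> a0; rewrite -(rmorph1 (real_complex R)) cpow_real mul1r lnK ?posrE.
Qed.

Lemma cpow_nat (R : realType) (a : R) n : 0 < a -> cpow a n%:R = (a ^+ n)%:C.
Proof.
move=> a0; rewrite -(rmorph_nat (real_complex R)) cpow_real.
by rewrite expRM_natl lnK ?posrE.
Qed.

Lemma cpow_one (R : realType) (z : R[i]) : cpow (1 : R) z = 1.
Proof. by rewrite /cpow ln1 rmorph0 mulr0 cexp0. Qed.

Lemma cpow_expR (R : realType) (x : R) (z : R[i]) : cpow (expR x) z = cexp (z * x%:C).
Proof. by rewrite /cpow expRK. Qed.

Lemma cpowX (R : realType) (a : R) (z : R[i]) (n : nat) : 0 < a ->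
  cpow (a ^+ n) z = cpow a (n%:R * z).
Proof.
move=> a0; rewrite /cpow lnXn// rmorphMn/= -[_ *+ n]mulr_natl.
by rewrite mulrCA mulrA.
Qed.

Lemma cabs_cpow (R : realType) (a : R) (z : R[i]) :
  cabs (cpow a z) = expR (complex.Re z * ln a).
Proof. by rewrite /cpow cabs_cexp ReM/= mulr0 subr0. Qed.

Lemma Re_cpow (R : realType) (a : R) (z : R[i]) : complex.Re (cpow a z) =
  expR (complex.Re z * ln a) * cos (complex.Im z * ln a).
Proof. by case: z => x y; rewrite /cpow /cexp /= !mulr0 subr0 add0r. Qed.

Lemma Im_cpow (R : realType) (a : R) (z : R[i]) : complex.Im (cpow a z) =
  expR (complex.Re z * ln a) * sin (complex.Im z * ln a).
Proof. by case: z => x y; rewrite /cpow /cexp /= !mulr0 subr0 add0r. Qed.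

Lemma drv_Re_cpow (R : realType) (t : R) (z : R[i]) : 0 < t ->
  is_derive t 1 (fun t => complex.Re (cpow t z))
    (complex.Re (z * cpow t (z - 1))).
Proof.
move=> t0.
rewrite (_ : (fun _ => _) = fun t => expR (complex.Re z * ln t) *
  cos (complex.Im z * ln t)); last by apply/funext => u; rewrite Re_cpow.
have dl c : is_derive t 1 (fun t => c * ln t) (c * (1 / t)).
  exact: (drvZ c (drv_ln (drv_id t) t0)).
apply: (drv_eq (drvM (drv_expR (dl (complex.Re z))) (drv_cos (dl (complex.Im z))))).
rewrite cpowD cpowN cpow1// ReM -fmorphV ReM ImM Re_cpow Im_cpow /=; field.
by rewrite gt_eqF.
Qed.

Lemma drv_Im_cpow (R : realType) (t : R) (z : R[i]) : 0 < t ->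
  is_derive t 1 (fun t => complex.Im (cpow t z))
    (complex.Im (z * cpow t (z - 1))).
Proof.
move=> t0.
rewrite (_ : (fun _ => _) = fun t => expR (complex.Re z * ln t) *
  sin (complex.Im z * ln t)); last by apply/funext => u; rewrite Im_cpow.
have dl c : is_derive t 1 (fun t => c * ln t) (c * (1 / t)).
  exact: (drvZ c (drv_ln (drv_id t) t0)).
apply: (drv_eq (drvM (drv_expR (dl (complex.Re z))) (drv_sin (dl (complex.Im z))))).
rewrite cpowD cpowN cpow1// ImM -fmorphV ReM ImM Re_cpow Im_cpow /=; field.
by rewrite gt_eqF.
Qed.

Lemma measurable_ln_pos (R : realType) : measurable_fun (`]0, +oo[ : set R) (@ln R).
Proof.
apply: open_continuous_measurable_fun; first exact: interval_open.
by move=> x; rewrite inE/= in_itv/= andbT; exact: continuous_ln.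
Qed.

Lemma cmeasurable_cpow (R : realType) (D : set R) (T : R -> R) (z : R[i]) :
  measurable_fun D (fun x => ln (T x)) -> cmeasurable D (fun t => cpow (T t) z).
Proof.
move=> mT; apply: cmeasurable_cexp; apply: cmeasurableM.
  exact: cmeasurable_cst.
exact: cmeasurable_real.
Qed.

(** * Euler's integral: convergence, functional equation, scaling, analyticity *)

(** This is ln y < y at y = t / (2x), multiplied by x; half of the decay of e^-t absorbs t^x. *)
Lemma gamma_exponent_bound (R : realType) (x t : R) : 0 < x -> 0 < t ->
  expR (x * ln t - t) <= expR (x * ln (2 * x)) * expR (- (t / 2)).
Proof.
move=> x0 t0; rewrite -expRD ler_expR.
have x2 : 0 < 2 * x by rewrite mulr_gt0.
have : ln (t / (2 * x)) < t / (2 * x) by apply: ln_sublinear; rewrite divr_gt0.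
rewrite ln_div ?posrE// => /ltW h.
have : x * (ln t - ln (2 * x)) <= x * (t / (2 * x)) by apply: ler_wpM2l => //; exact: ltW.
rewrite (_ : x * (t / (2 * x)) = t / 2); last by field; rewrite gt_eqF.
lra.
Qed.

(** With C = (2x)^x, the function x t^(x-1) e^-t lies below g, the derivative of G = t^x e^-t - 2C
    e^(-t/2): the term C e^(-t/2) compensates for - t^x e^-t by [gamma_exponent_bound]. Since 0 <=
    t^x e^-t <= C, the increments of G are at most 3C. *)
Lemma integrable_gamma (R : realType) (x : R) : 0 < x ->
  (@lebesgue_measure R).-integrable `]0, +oo[
    (EFin \o (fun t => expR ((x - 1) * ln t) * expR (- t))).
Proof.
move=> x0; set C := expR (x * ln (2 * x)).
pose g t := expR (x * ln t - t) * (x * (1 / t) - 1) + C * expR (- (t / 2)).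
pose G t := expR (x * ln t - t) + (- 2 * C) * expR (- (t / 2)).
have C0 : 0 < C by exact: expR_gt0.
have dG (t : R) : 0 < t -> is_derive t 1 G (g t).
  move=> t0; rewrite /G.
  have d1 := drv_expR (drvB (drvZ x (drv_ln (drv_id t) t0)) (drv_id t)).
  have d2 := drvZ (- 2 * C) (drv_expR (drvN (drvM (drv_id t) (drv_cst 2^-1 t)))).
  by apply: (drv_eq (drvD d1 d2)); rewrite /g; field; rewrite gt_eqF.
have dg (t : R) : 0 < t -> exists a, is_derive t 1 g a.
  move=> t0.
  have d1 := drv_expR (drvB (drvZ x (drv_ln (drv_id t) t0)) (drv_id t)).
  have t0' : t != 0 by rewrite gt_eqF.
  have d3 := drvB (drvZ x (drvM (drv_cst 1 t) (drvV (drv_id t) t0'))) (drv_cst 1 t).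
  have d2 := drvZ C (drv_expR (drvN (drvM (drv_id t) (drv_cst 2^-1 t)))).
  by eexists; exact: (drvD (drvM d1 d3) d2).
have gE (t : R) : 0 < t ->
    x * (expR ((x - 1) * ln t) * expR (- t)) <= g t.
  move=> t0; have := gamma_exponent_bound x0 t0; rewrite -/C => h.
  rewrite /g -expRD (_ : (x - 1) * ln t - t = x * ln t - t - ln t); last by ring.
  rewrite expRB lnK ?posrE//.
  set e := expR (x * ln t - t) in h *.
  have -> : x * (e / t) = e * (x * (1 / t)) by ring.
  by rewrite mulrBr; lra.
have mpow : measurable_fun (`]0, +oo[ : set R)
    (fun t => expR ((x - 1) * ln t) * expR (- t)).
  apply: measurable_funM.
    apply: measurableT_comp; first by apply: continuous_measurable_fun; exact: continuous_expR.
    by apply: measurable_funM => //; exact: measurable_ln_pos.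
  apply: measurableT_comp; first by apply: continuous_measurable_fun; exact: continuous_expR.
  apply: open_continuous_measurable_fun; first exact: interval_open.
  by move=> u _; exact: opp_continuous.
have mI : measurable (`]0, +oo[ : set R) by exact: measurable_itv.
have ig : (@lebesgue_measure R).-integrable `]0, +oo[ (EFin \o g).
  rewrite -pos_itv_bigcup; apply: (@ge0_integrable_exhaustion _ _ _ (3 * C)).
  - exact: measurable_pos_itv.
  - exact: pos_itv_nondecreasing.
  - rewrite pos_itv_bigcup; apply: open_continuous_measurable_fun; first exact: interval_open.
    move=> t; rewrite inE/= in_itv/= andbT => /dg[a da]; exact: drv_continuous da.
  - move=> t; rewrite pos_itv_bigcup/= in_itv/= andbT => t0.
    by apply: le_trans (gE t t0); rewrite !mulr_ge0 ?expR_ge0// ltW.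
  move=> n; rewrite /pos_itv.
  have n0 : (0 : R) < n.+1%:R^-1 by rewrite invr_gt0.
  have nn : (n.+1%:R^-1 : R) <= n.+1%:R.
    by rewrite (@le_trans _ _ 1)// ?ler1n// invf_le1// ler1n.
  have dG' (t : R) : n.+1%:R^-1 <= t <= n.+1%:R -> is_derive t 1 G (g t).
    by move=> /andP[h _]; apply: dG; exact: lt_le_trans h.
  rewrite (integral_drv nn dG').
  - rewrite lee_fin /G.
    have e1 : expR (x * ln n.+1%:R - n.+1%:R) <= C.
      apply: le_trans (gamma_exponent_bound x0 _) _ => //.
      by rewrite ler_piMr ?(ltW C0)// expR_le1 oppr_le0.
    have e2 := expR_ge0 (x * ln (n.+1%:R^-1 : R) - n.+1%:R^-1).
    have e3 := expR_ge0 (- (n.+1%:R / 2) : R).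
    have e4 : expR (- (n.+1%:R^-1 / 2) : R) <= 1 by rewrite expR_le1 oppr_le0 divr_ge0// ltW.
    have e5 : 0 <= C * expR (- (n.+1%:R / 2) : R) by rewrite mulr_ge0// ltW.
    have e6 : C * expR (- (n.+1%:R^-1 / 2) : R) <= C by rewrite ler_piMr// ltW.
    lra.
  - by move=> t /andP[h _]; have [a] := dg t (lt_le_trans n0 h); exact: drv_continuous.
apply: (@le_integrable _ _ _ (@lebesgue_measure R) _ mI _ (EFin \o (fun t => x^-1 * g t))).
- exact/measurable_EFinP.
- move=> t; rewrite /= in_itv/= andbT => t0; rewrite lee_fin.
  rewrite ger0_norm ?mulr_ge0 ?expR_ge0//.
  apply: le_trans (ler_norm _).
  by rewrite ler_pdivlMl//; exact: gE.
- have h : (@lebesgue_measure R).-integrable `]0, +oo[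
      (fun t => (x^-1)%:E * (g t)%:E)%E by exact: integrableZl.
  by apply: eq_integrable h.
Qed.

Lemma analytic_at_affine (R : realType) (f : R[i] -> R[i]) (a b z : R[i]) :
  analytic_at f (a * z + b) -> analytic_at (fun w => f (a * w + b)) z.
Proof.
move=> [c /nbhs_cabsP[e e0 h]]; exists (fun n => c n * a ^+ n).
apply/nbhs_cabsP; exists (e / (cabs a + 1)).
  by rewrite divr_gt0// ltr_wpDl// cabs_ge0.
move=> w; rewrite ltr_pdivlMr ?ltr_wpDl ?cabs_ge0// => wz.
have E : a * w + b - (a * z + b) = a * (w - z).
  by rewrite opprD addrACA subrr addr0 mulrBr.
have := h (a * w + b); rewrite E cabsM => hw.
have : cabs a * cabs (w - z) < e.
  apply: le_lt_trans wz; rewrite mulrC; apply: ler_wpM2l; first exact: cabs_ge0.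
  by rewrite lerDl.
move=> /hw; apply: cvg_trans; apply: near_eq_cvg; apply: nearW => n.
by rewrite /series/=; apply: eq_bigr => k _; rewrite exprMn mulrA.
Qed.

Lemma analytic_at_cexp (R : realType) (z : R[i]) : analytic_at (@cexp R) z.
Proof.
exists (fun n => cexp z / n`!%:R); apply: nearcW => w.
have h1 : (fun=> cexp z) @ \oo --> cexp z by exact: cvg_cst.
pose proof (@cvgcM R nat \oo _ _ _ _ _ h1 (@cvg_series_cexp R (w - z))) as h.
have <- : cexp z * cexp (w - z) = cexp w by rewrite -cexpD addrC subrK.
move: h; apply: cvg_trans; apply: near_eq_cvg; apply: nearW => n.
rewrite /series/= mulr_sumr; apply: eq_bigr => k _.
by rewrite mulrA mulrAC.
Qed.

Lemma analytic_at_cpow (R : realType) (a : R) (z : R[i]) :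
  analytic_at (fun w => cpow a w) z.
Proof.
apply: (@analytic_at_ext _ (fun w => cexp ((ln a)%:C * w + 0))).
  by apply: nearcW => w; rewrite addr0 mulrC.
exact/analytic_at_affine/analytic_at_cexp.
Qed.

Lemma cintegrable_Gamma (R : realType) (z : R[i]) : 0 < complex.Re z ->
  cintegrable `]0, +oo[ (fun t : R => cpow t (z - 1) * (expR (- t))%:C).
Proof.
move=> z0; apply: le_cintegrable (integrable_gamma z0) _.
- exact: measurable_itv.
- apply: cmeasurableM.
    by apply: (@cmeasurable_cpow _ _ id); exact: measurable_ln_pos.
  apply: cmeasurable_real; apply: open_continuous_measurable_fun.
    exact: interval_open.
  move=> t _; apply: continuous_comp; first exact: opp_continuous.
  exact: continuous_expR.
- move=> t _; rewrite cabsM cabs_cpow cabs_real ReD ReN/=.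
  by rewrite [X in _ * X <= _]ger0_norm// expR_ge0.
Qed.

Lemma cvg_expR_scaled (R : realType) (c : R) (u : nat -> R) : 0 < c ->
  (forall M, \forall n \near \oo, M < u n) ->
  expR (- (c * u n)) @[n --> \oo] --> 0.
Proof.
move=> c0 hu; apply/cvgr0Pnorm_lt => e e0.
have := hu (- ln e / c); apply: filterS => n hn.
rewrite ger0_norm ?expR_ge0// -[ltRHS]lnK ?posrE// ltr_expR.
by move: hn; rewrite ltr_pdivrMr// mulrC ltrNl.
Qed.

Lemma near_ltn_natr (R : realType) (M : R) : \forall n \near \oo, M < n.+1%:R.
Proof.
exists (Num.truncn (`|M|)).+1 => // n /= hn.
apply: (le_lt_trans (ler_norm _)); apply: (lt_le_trans (truncnS_gt _)).
by rewrite ler_nat; apply: leqW.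
Qed.

Lemma near_lt_ln_natr (R : realType) (M : R) : \forall n \near \oo, M < ln n.+1%:R.
Proof.
have := near_ltn_natr (expR M); apply: filterS => n hn.
by rewrite -[M]expRK ltr_ln ?posrE// ?expR_gt0.
Qed.

(* [phi] is dominated by [t^x e^-t], which vanishes at both ends. *)
Lemma Rintegral_derivative0 (R : realType) (x : R) (phi psi : R -> R) : 0 < x ->
  (forall t : R, 0 < t -> is_derive t 1 phi (psi t)) ->
  (forall t : R, 0 < t -> {for t, continuous psi}) ->
  (@lebesgue_measure R).-integrable `]0, +oo[ (EFin \o psi) ->
  (forall t : R, 0 < t -> `|phi t| <= expR (x * ln t - t)) ->
  \int[@lebesgue_measure R]_(t in `]0, +oo[) psi t = 0.
Proof.
move=> x0 dphi cpsi ipsi bphi.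
rewrite -pos_itv_bigcup in ipsi *.
have h := integral_exhaustion (@measurable_pos_itv R) (@pos_itv_nondecreasing R) ipsi.
have e n : \int[@lebesgue_measure R]_(t in pos_itv n) psi t =
    phi n.+1%:R - phi n.+1%:R^-1.
  have n0 : (0 : R) < n.+1%:R^-1 by rewrite invr_gt0.
  have nn : (n.+1%:R^-1 : R) <= n.+1%:R.
    by rewrite (@le_trans _ _ 1)// ?ler1n// invf_le1// ler1n.
  have d (t : R) : n.+1%:R^-1 <= t <= n.+1%:R -> is_derive t 1 phi (psi t).
    by move=> /andP[ht _]; apply: dphi; exact: lt_le_trans ht.
  rewrite /Rintegral /pos_itv (integral_drv nn d)// => t /andP[ht _].
  by apply: cpsi; exact: lt_le_trans ht.
have e' : (fun n => \int[@lebesgue_measure R]_(t in pos_itv n) psi t) =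
  (fun n => phi n.+1%:R - phi n.+1%:R^-1) by apply/funext.
suff h0 : (fun n => phi n.+1%:R - phi n.+1%:R^-1) @ \oo --> 0.
  by rewrite e' in h; apply: (cvg_unique _ h h0).
rewrite -[X in _ --> X](subrr 0); apply: cvgB.
  have h2 : expR (x * ln (2 * x)) * expR (- (2^-1 * n.+1%:R)) @[n --> \oo] --> (0 : R).
    rewrite -[X in _ --> X](mulr0 (expR (x * ln (2 * x)))); apply: cvgM.
      exact: cvg_cst.
    apply: cvg_expR_scaled; first by rewrite invr_gt0.
    exact: near_ltn_natr.
  apply/cvgr0Pnorm_lt => eps eps0; move/cvgr0Pnorm_lt : h2 => /(_ eps eps0).
  apply: filterS => n; apply: le_lt_trans; apply: (le_trans _ (ler_norm _)).
  apply: (le_trans (bphi _ _)) => //.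
  by rewrite [2^-1 * _]mulrC; exact: gamma_exponent_bound.
have h2 := cvg_expR_scaled x0 (@near_lt_ln_natr R).
apply/cvgr0Pnorm_lt => eps eps0; move/cvgr0Pnorm_lt : h2 => /(_ eps eps0).
apply: filterS => n; apply: le_lt_trans; apply: (le_trans _ (ler_norm _)).
apply: (le_trans (bphi _ _)); first by rewrite invr_gt0.
rewrite ler_expR lnV ?posrE// mulrN lerBlDr lerDl.
by rewrite invr_ge0.
Qed.

Lemma continuous_Re_cpow (R : realType) (t : R) (z : R[i]) : 0 < t ->
  {for t, continuous (fun t => complex.Re (cpow t z))}.
Proof. by move=> t0; apply: drv_continuous (drv_Re_cpow z t0). Qed.

Lemma continuous_Im_cpow (R : realType) (t : R) (z : R[i]) : 0 < t ->
  {for t, continuous (fun t => complex.Im (cpow t z))}.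
Proof. by move=> t0; apply: drv_continuous (drv_Im_cpow z t0). Qed.

(** Integration by parts: z t^(z-1) e^-t - t^z e^-t is the derivative of t^z e^-t, which vanishes at
    both ends. Real and imaginary parts are treated separately. *)
Lemma Gamma_integralS (R : realType) (z : R[i]) : 0 < complex.Re z ->
  Gamma_integral (z + 1) = z * Gamma_integral z.
Proof.
move=> z0.
have mD : measurable (`]0, +oo[ : set R) by exact: measurable_itv.
have z10 : 0 < complex.Re (z + 1) by rewrite ReD/= addr_gt0.
have i1 := cintegrable_Gamma z0.
have [i2 e2] := cintegrableZ z mD i1.
have i3 := cintegrable_Gamma z10.
have [i4 e4] := cintegrableZ (- 1) mD i3.
have [i5 e5] := cintegrableD mD i2 i4.
apply/esym/eqP; rewrite -subr_eq0 -mulN1r -e2 -e4 -e5.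
pose e (t : R) := expR (- t).
have de (t : R) : is_derive t 1 e (- e t).
  by apply: (drv_eq (drv_expR (drvN (drv_id t)))); rewrite mulrN1.
pose psr t := (complex.Re (z * cpow t (z - 1)) - complex.Re (cpow t z)) * e t.
pose psi t := (complex.Im (z * cpow t (z - 1)) - complex.Im (cpow t z)) * e t.
have E t : z * (cpow t (z - 1) * (expR (- t))%:C) +
    -1 * (cpow t (z + 1 - 1) * (expR (- t))%:C) = psr t +i* psi t.
  rewrite addrK mulN1r mulrA -mulrBl.
  apply/eqP; rewrite eq_complex ReM ImM/= !mulr0 subr0 add0r.
  by rewrite /psr /psi -ReN -ImN -ReD -ImD !eqxx.
have ce t : {for t, continuous e} by exact: drv_continuous (de t).
have bnd t (u : R) : `|u| <= cabs (cpow t z) -> `|u * e t| <= expR (complex.Re z * ln t - t).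
  move=> h; rewrite normrM expRD (@ger0_norm _ (e t)) ?expR_ge0//.
  by apply: ler_wpM2r; rewrite ?expR_ge0// -cabs_cpow.
rewrite /cintegral eq_complex /=; apply/andP; split; apply/eqP.
  under eq_Rintegral do rewrite E /=.
  apply: (@Rintegral_derivative0 _ (complex.Re z) (fun t => complex.Re (cpow t z) * e t)) => //.
  - move=> t t0; apply: (drv_eq (drvM (drv_Re_cpow z t0) (de t))).
    by rewrite /psr mulrN -mulrBl.
  - move=> t t0; apply: continuousM => //.
    apply: continuousB; last exact: continuous_Re_cpow.
    rewrite (_ : (fun _ => _) = fun t => complex.Re z * complex.Re (cpow t (z - 1)) -
      complex.Im z * complex.Im (cpow t (z - 1))); last by apply/funext => v; rewrite ReM.
    apply: continuousB; apply: continuousM; try exact: cst_continuous.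
      exact: continuous_Re_cpow.
    exact: continuous_Im_cpow.
  - by apply: eq_integrable (i5.1) => // t _ /=; rewrite E.
  - by move=> t t0; apply: bnd; exact: normr_Re_le.
under eq_Rintegral do rewrite E /=.
apply: (@Rintegral_derivative0 _ (complex.Re z) (fun t => complex.Im (cpow t z) * e t)) => //.
- move=> t t0; apply: (drv_eq (drvM (drv_Im_cpow z t0) (de t))).
  by rewrite /psi mulrN -mulrBl.
- move=> t t0; apply: continuousM => //.
  apply: continuousB; last exact: continuous_Im_cpow.
  rewrite (_ : (fun _ => _) = fun t => complex.Re z * complex.Im (cpow t (z - 1)) +
    complex.Im z * complex.Re (cpow t (z - 1))); last by apply/funext => v; rewrite ImM.
  apply: continuousD; apply: continuousM; try exact: cst_continuous.
    exact: continuous_Im_cpow.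
  exact: continuous_Re_cpow.
- by apply: eq_integrable (i5.2) => // t _ /=; rewrite E.
- by move=> t t0; apply: bnd; exact: normr_Im_le.
Qed.

Lemma Gamma_integralD (R : realType) (z : R[i]) (n : nat) : 0 < complex.Re z ->
  Gamma_integral (z + n%:R) = (\prod_(k < n) (z + k%:R)) * Gamma_integral z.
Proof.
move=> z0; elim: n => [|n IH]; first by rewrite big_ord0 mul1r addr0.
rewrite -natr1 addrA Gamma_integralS; last first.
  by rewrite ReD -(rmorph_nat (real_complex R))/= ltr_wpDr.
by rewrite IH big_ord_recr/= mulrA [_ * (z + _)]mulrC.
Qed.

Lemma scaled_itv_bigcup (R : realType) (c : R) : 0 < c ->
  \bigcup_n (`[c * n.+1%:R^-1, c * n.+1%:R]%classic : set R) = `]0, +oo[%classic.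
Proof.
move=> c0; rewrite -pos_itv_bigcup; apply/seteqP; split => x.
  move=> [n _] /=; rewrite in_itv/= => /andP[h _].
  rewrite pos_itv_bigcup /= in_itv/= andbT.
  by apply: lt_le_trans h; rewrite mulr_gt0 ?invr_gt0.
rewrite pos_itv_bigcup /= in_itv/= andbT => x0.
have : (`]0, +oo[%classic : set R) (x / c) by rewrite /= in_itv/= andbT divr_gt0.
rewrite -pos_itv_bigcup => -[n _]; rewrite /pos_itv/= in_itv/= => /andP[h1 h2].
exists n => //=; rewrite in_itv/=; apply/andP; split.
  by rewrite mulrC -ler_pdivlMr.
by rewrite mulrC -ler_pdivrMr.
Qed.

Lemma cintegral_Gamma_scaled (R : realType) (c : R) (z : R[i]) :
  0 < c -> 0 < complex.Re z ->
  cintegrable `]0, +oo[ (fun t : R => cpow t (z - 1) * (expR (- (c * t)))%:C) /\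
  cintegral `]0, +oo[ (fun t : R => cpow t (z - 1) * (expR (- (c * t)))%:C) =
  cpow c (- z) * Gamma_integral z.
Proof.
move=> c0 z0.
have mD : measurable (`]0, +oo[ : set R) by exact: measurable_itv.
pose G (t : R) := cpow t (z - 1) * (expR (- t))%:C.
pose J (n : nat) : set R := `[c * n.+1%:R^-1, c * n.+1%:R]%classic.
have JD : \bigcup_n J n = `]0, +oo[%classic by exact: scaled_itv_bigcup.
have GE x : 0 < x -> G (c * x) * c%:C =
    cpow c z * (cpow x (z - 1) * (expR (- (c * x)))%:C).
  move=> x0; rewrite /G cpow_mul//.
  have -> : cpow c (z - 1) = cpow c z * (c%:C)^-1 by rewrite cpowD cpowN cpow1.
  have cc : c%:C != 0 :> R[i] by rewrite fmorph_eq0 gt_eqF.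
  by field.
have cre (u : R) : {for u, continuous (fun t : R => expR (- t))}.
  apply: continuous_comp; first exact: opp_continuous.
  exact: continuous_expR.
have [||||||||||ir er] := @cintegral_subst R (@pos_itv R) J (fun x => c * x) (fun=> c) G
  (@measurable_pos_itv R).
- by move=> n; exact: measurable_itv.
- exact: pos_itv_nondecreasing.
- apply/nondecreasing_seqP => n; apply/subsetPset => x; rewrite /J/=.
  rewrite !in_itv/= => /andP[h1 h2]; apply/andP; split.
    by apply: le_trans h1; rewrite ler_pM2l// lef_pV2 ?posrE// ler_nat.
  by apply: (le_trans h2); rewrite ler_pM2l// ler_nat.
- by move=> x _; exact: ltW.
- exact: measurable_cst.
- rewrite pos_itv_bigcup; apply: cmeasurableM.
    apply: (@cmeasurable_cpow _ _ (fun x => c * x)).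
    apply: open_continuous_measurable_fun; first exact: interval_open.
    move=> x; rewrite inE/= in_itv/= andbT => x0.
    have cx : 0 < c * x by rewrite mulr_gt0.
    by apply: drv_continuous (drv_ln (drvZ c (drv_id x)) cx).
  apply: cmeasurable_real; apply: open_continuous_measurable_fun.
    exact: interval_open.
  move=> x _; have d := drvZ c (drv_id x).
  by apply: drv_continuous (drv_expR (drvN d)).
- rewrite JD => h ch n; rewrite /J /pos_itv.
  apply: integral_scale => //.
    by rewrite (@le_trans _ _ 1)// ?ler1n// invf_le1// ler1n.
  move=> u /andP[h1 _]; apply: ch; rewrite /= in_itv/= andbT.
  by apply: lt_le_trans h1; rewrite mulr_gt0 ?invr_gt0.
- rewrite JD => u Du; have {Du} u0 : 0 < u by move: Du; rewrite /= in_itv/= andbT.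
  rewrite (_ : (fun _ => _) = fun u => complex.Re (cpow u (z - 1)) * expR (- u)).
    by apply: continuousM; [exact: continuous_Re_cpow|exact: cre].
  by apply/funext => v; rewrite /G ReM ImC mulr0 subr0.
- rewrite JD => u Du; have {Du} u0 : 0 < u by move: Du; rewrite /= in_itv/= andbT.
  rewrite (_ : (fun _ => _) = fun u => complex.Im (cpow u (z - 1)) * expR (- u)).
    by apply: continuousM; [exact: continuous_Im_cpow|exact: cre].
  by apply/funext => v; rewrite /G ImM ImC mulr0 add0r.
- by rewrite JD; exact: cintegrable_Gamma.
rewrite JD pos_itv_bigcup in ir er.
have [iz ez] := cintegrableZ (cpow c (- z)) mD ir.
have E x : (`]0, +oo[%classic : set R) x -> cpow c (- z) * (G (c * x) * c%:C) =
    cpow x (z - 1) * (expR (- (c * x)))%:C.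
  rewrite /= in_itv/= andbT => x0.
  by rewrite GE// mulrA cpowN mulVf ?cpow_neq0// mul1r.
split; first exact: eq_cintegrable E iz.
by rewrite -(eq_cintegral E) ez -er.
Qed.

(** An instance of [exp_integral_analytic] with L = ln t and h = t^-1 e^-t. With r = Re z / 2, both
    exponents Re z + r and Re z - r are positive. *)
Lemma analytic_at_Gamma_integral (R : realType) (z : R[i]) : 0 < complex.Re z ->
  analytic_at (@Gamma_integral R) z.
Proof.
move=> z0.
have mD : measurable (`]0, +oo[ : set R) by exact: measurable_itv.
pose h (t : R) := expR (- ln t) * expR (- t).
have mexp : measurable_fun (`]0, +oo[ : set R) (fun t => expR (- t)).
  apply: open_continuous_measurable_fun; first exact: interval_open.
  move=> t _; apply: continuous_comp; first exact: opp_continuous.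
  exact: continuous_expR.
have E w (t : R) : cpow t (w - 1) * (expR (- t))%:C = cexp (w * (ln t)%:C) * (h t)%:C.
  rewrite cpowD -[- 1](rmorphN1 (real_complex R)) cpow_real mulN1r.
  by rewrite /h rmorphM/= mulrA.
apply: (@analytic_at_ext _ (fun w => cintegral `]0, +oo[
    (fun t => cexp (w * (ln t)%:C) * (h t)%:C))).
  apply: nearcW => w; rewrite /Gamma_integral; apply: eq_cintegral => t _.
  exact/esym/E.
set x := complex.Re z in z0 *; pose r := x / 2.
have r0 : 0 < r by rewrite divr_gt0.
apply: (@exp_integral_analytic _ _ _ _ _ r) => //.
- exact: measurable_ln_pos.
- apply: measurable_funM => //.
  apply: measurableT_comp; first by apply: continuous_measurable_fun; exact: continuous_expR.
  by apply: measurableT_comp => //; exact: measurable_ln_pos.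
(* The majorant t^x e^(r |ln t|) is at most t^(x+r) + t^(x-r), two convergent Gamma integrands. *)
have i1 := @integrable_gamma R (x + r) (addr_gt0 z0 r0).
have xr0 : 0 < x - r by rewrite /r; lra.
have i2 := integrable_gamma xr0.
have i12 : (@lebesgue_measure R).-integrable `]0, +oo[ (fun t =>
  (expR ((x + r - 1) * ln t) * expR (- t))%:E +
  (expR ((x - r - 1) * ln t) * expR (- t))%:E)%E by exact: integrableD.
apply: (@le_integrable _ _ _ (@lebesgue_measure R) _ mD _ _ _ _ i12).
- apply/measurable_EFinP.
  have mexpR : measurable_fun [set: R] (@expR R).
    by apply: continuous_measurable_fun; exact: continuous_expR.
  apply: measurable_funM.
    apply: measurableT_comp => //; apply: measurable_funD.
      by apply: measurable_funM => //; exact: measurable_ln_pos.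
    apply: measurable_funM => //; apply: measurableT_comp => //.
    exact: measurable_ln_pos.
  apply: measurableT_comp => //; apply: measurable_funM => //.
  by apply: measurableT_comp => //; apply: measurableT_comp => //; exact: measurable_ln_pos.
move=> t _; rewrite /= lee_fin [leRHS]ger0_norm; last first.
  by rewrite addr_ge0// mulr_ge0// expR_ge0.
rewrite ger0_norm ?mulr_ge0 ?expR_ge0// /h (@ger0_norm _ (_ * expR (- t))).
  rewrite mulrA -expRD -mulrDl; apply: ler_wpM2r; first exact: expR_ge0.
  case: (ger0P (ln t)) => l0.
    apply: (@le_trans _ _ (expR ((x + r - 1) * ln t))); last by rewrite lerDl expR_ge0.
    by rewrite ler_expR; lra.
  apply: (@le_trans _ _ (expR ((x - r - 1) * ln t))); last by rewrite lerDr expR_ge0.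
  by rewrite ler_expR; lra.
by rewrite mulr_ge0// expR_ge0.
Qed.

(** * Derivatives of the complete elliptic integrals *)

Lemma pi2_gt0 (R : realType) : 0 < pi / 2 :> R.
Proof. by rewrite divr_gt0// pi_gt0. Qed.

Lemma continuous_itv_integrable (R : realType) (f : R -> R) (a b : R) :
  (forall x, a <= x <= b -> {for x, continuous f}) ->
  (@lebesgue_measure R).-integrable `[a, b] (EFin \o f).
Proof.
move=> cf; apply: continuous_compact_integrable; first exact: segment_compact.
exact: within_continuous_itv.
Qed.

Lemma drv_Rintegral (R : realType) (f f' : R -> R -> R) (a b u v m0 C : R) :
  u < m0 < v ->
  (forall m x, u < m < v -> a <= x <= b -> {for x, continuous (f m)}) ->
  (forall m x, u < m < v -> a <= x <= b ->
    is_derive m 1 (fun m => f m x) (f' m x)) ->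
  (forall m x, u < m < v -> a <= x <= b -> `|f' m x| <= C) ->
  is_derive m0 1 (fun m => \int[@lebesgue_measure R]_(x in `[a, b]) f m x)
    (\int[@lebesgue_measure R]_(x in `[a, b]) f' m0 x).
Proof.
move=> m0uv cf df bf.
have mB : measurable (`[a, b] : set R) by exact: measurable_itv.
have Im0 : (`]u, v[%classic : set R) m0 by rewrite /= in_itv.
have intf m : (`]u, v[%classic : set R) m ->
    (@lebesgue_measure R).-integrable `[a, b] (EFin \o f m).
  rewrite /= in_itv/= => mI; apply: continuous_itv_integrable => x; exact: cf.
have dfI m x : (`]u, v[%classic : set R) m -> (`[a, b]%classic : set R) x ->
    is_derive m 1 (fun m => f m x) (f' m x).
  by rewrite /= !in_itv/=; exact: df.
have derf m x : (`]u, v[%classic : set R) m -> (`[a, b]%classic : set R) x ->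
    derivable (f ^~ x) m 1.
  by move=> mI xI; case: (dfI m x mI xI).
have intC : (@lebesgue_measure R).-integrable `[a, b] (EFin \o (fun=> `|C|)).
  by apply: continuous_itv_integrable => x _; exact: cst_continuous.
have ub m x : (`]u, v[%classic : set R) m -> (`[a, b]%classic : set R) x ->
    `|partial1of2 f m x| <= `|C|.
  move=> mI xI; rewrite /partial1of2 (drv_derive1 (dfI m x mI xI)).
  apply: (le_trans _ (ler_norm _)); move: mI xI; rewrite /= !in_itv/=.
  exact: bf.
have C0 (y : R) : 0 <= `|C| by [].
apply: DeriveDef.
  exact: (@derivable_under_integral _ _ _ (@lebesgue_measure R) f _ mB _ _ _ Im0
    intf derf _ C0 intC ub).
rewrite -derive1E.
rewrite (@differentiation_under_integral _ _ _ (@lebesgue_measure R) f _ mB _ _ _ Im0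
    intf derf _ C0 intC ub).
apply: eq_Rintegral => x; rewrite inE => xI.
by rewrite /partial1of2 (drv_derive1 (dfI m0 x Im0 xI)).
Qed.

Lemma lt0_elliptic_radicand (R : realType) (m x : R) : m < 1 ->
  0 < 1 - m * sin x ^+ 2.
Proof.
move=> m1; have s0 : 0 <= sin x ^+ 2 by exact: sqr_ge0.
have s1 : sin x ^+ 2 <= 1.
  by rewrite -(cos2Dsin2 x) lerDr sqr_ge0.
by case: (ltrP 0 m) => m0; nra.
Qed.

Lemma elliptic_radicand_ge (R : realType) (m v x : R) : m < v ->
  Num.min 1 (1 - v) <= 1 - m * sin x ^+ 2.
Proof.
move=> mv; have s0 : 0 <= sin x ^+ 2 by exact: sqr_ge0.
have s1 : sin x ^+ 2 <= 1 by rewrite -(cos2Dsin2 x) lerDr sqr_ge0.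
rewrite ge_min; case: (ltrP 0 m) => m0; apply/orP; [right|left]; nra.
Qed.

(** The integral that appears when K is differentiated under the integral sign; [ellipticE_K3]
    reduces it to E. *)
Definition ellipticK3 (R : realType) (m : R) : R :=
  \int[@lebesgue_measure R]_(x in `[0, pi / 2])
    (Num.sqrt (1 - m * sin x ^+ 2) ^+ 3)^-1.

Lemma drv_elliptic_radicand (R : realType) (m x : R) :
  is_derive x 1 (fun x => 1 - m * sin x ^+ 2) (- (m * (2 * sin x * cos x))).
Proof.
have ds := drv_sin (drv_id x).
apply: (drv_eq (drvB (drv_cst 1 x) (drvZ m (drvX 2 ds)))).
by rewrite /= expr1; ring.
Qed.

Lemma drv_elliptic_delta (R : realType) (m x : R) : m < 1 ->
  is_derive x 1 (fun x => Num.sqrt (1 - m * sin x ^+ 2))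
    (- (m * (2 * sin x * cos x)) / (2 * Num.sqrt (1 - m * sin x ^+ 2))).
Proof.
by move=> m1; exact: (drv_sqrt (drv_elliptic_radicand m x) (lt0_elliptic_radicand x m1)).
Qed.

Lemma continuous_elliptic_delta (R : realType) (m x : R) : m < 1 ->
  {for x, continuous (fun x => Num.sqrt (1 - m * sin x ^+ 2))}.
Proof. by move=> m1; apply: drv_continuous (drv_elliptic_delta x m1). Qed.

Lemma elliptic_delta_gt0 (R : realType) (m x : R) : m < 1 ->
  0 < Num.sqrt (1 - m * sin x ^+ 2).
Proof. by move=> m1; rewrite sqrtr_gt0 lt0_elliptic_radicand. Qed.

Lemma continuous_elliptic_deltaV (R : realType) (m x : R) (n : nat) : m < 1 ->
  {for x, continuous (fun x => (Num.sqrt (1 - m * sin x ^+ 2) ^+ n)^-1)}.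
Proof.
move=> m1; have d := drvX n (drv_elliptic_delta x m1).
have h : Num.sqrt (1 - m * sin x ^+ 2) ^+ n != 0.
  by rewrite expf_neq0// gt_eqF// elliptic_delta_gt0.
exact: drv_continuous (drvV d h).
Qed.

Lemma drv_ellipticE_integral (R : realType) (m : R) : m < 1 ->
  is_derive m 1 (@ellipticE R) (\int[@lebesgue_measure R]_(x in `[0, pi / 2])
    (- (sin x ^+ 2) / (2 * Num.sqrt (1 - m * sin x ^+ 2)))).
Proof.
(* The point v lies strictly between m and 1: for parameters below v the radicand stays above d,
   which bounds the derivative of the integrand uniformly. *)
move=> m1; pose v := (m + 1) / 2; have v1 : v < 1 by rewrite /v; lra.
have mv : m < v by rewrite /v; lra.
pose d := Num.min 1 (1 - v).
have d0 : 0 < d by rewrite lt_min ltr01 subr_gt0.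
rewrite /ellipticE; apply: (@drv_Rintegral _
  (fun m x => Num.sqrt (1 - m * sin x ^+ 2))
  (fun m x => - (sin x ^+ 2) / (2 * Num.sqrt (1 - m * sin x ^+ 2)))
  0 (pi / 2) (m - 1) v m (Num.sqrt d)^-1).
- by rewrite mv andbT; lra.
- by move=> n x /andP[_ nv] _; apply: continuous_elliptic_delta; lra.
- move=> n x /andP[_ nv] _; have n1 : n < 1 by lra.
  have h := drvB (drv_cst 1 n) (drvM (drv_id n) (drv_cst (sin x ^+ 2) n)).
  have := drv_sqrt h (lt0_elliptic_radicand x n1).
  by move=> h'; apply: (drv_eq h'); rewrite mulr0 addr0 mul1r sub0r.
- move=> n x /andP[_ nv] _; have n1 : n < 1 by lra.
  have s1 : sin x ^+ 2 <= 1 by rewrite -(cos2Dsin2 x) lerDr sqr_ge0.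
  have D0 := elliptic_delta_gt0 x n1.
  have dD : Num.sqrt d <= Num.sqrt (1 - n * sin x ^+ 2).
    by rewrite ler_sqrt ?elliptic_radicand_ge ?(ltW (lt0_elliptic_radicand x n1)).
  rewrite normrM normrN normfV !ger0_norm ?sqr_ge0 ?mulr_ge0 ?(ltW D0)//.
  apply: (@le_trans _ _ (1 / (2 * Num.sqrt (1 - n * sin x ^+ 2)))).
    by apply: ler_wpM2r => //; rewrite invr_ge0 mulr_ge0// ltW.
  rewrite mul1r lef_pV2 ?posrE ?mulr_gt0 ?sqrtr_gt0 ?lt0_elliptic_radicand//.
  by apply: le_trans dD _; rewrite ler_peMl ?ler1n// ltW.
Qed.

Lemma drv_ellipticK_integral (R : realType) (m : R) : m < 1 ->
  is_derive m 1 (@ellipticK R) (\int[@lebesgue_measure R]_(x in `[0, pi / 2])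
    (sin x ^+ 2 / 2 * (Num.sqrt (1 - m * sin x ^+ 2) ^+ 3)^-1)).
Proof.
move=> m1; pose v := (m + 1) / 2; have v1 : v < 1 by rewrite /v; lra.
have mv : m < v by rewrite /v; lra.
pose d := Num.min 1 (1 - v).
have d0 : 0 < d by rewrite lt_min ltr01 subr_gt0.
rewrite /ellipticK; apply: (@drv_Rintegral _
  (fun m x => (Num.sqrt (1 - m * sin x ^+ 2))^-1)
  (fun m x => sin x ^+ 2 / 2 * (Num.sqrt (1 - m * sin x ^+ 2) ^+ 3)^-1)
  0 (pi / 2) (m - 1) v m (Num.sqrt d ^+ 3)^-1).
- by rewrite mv andbT; lra.
- move=> n x /andP[_ nv] _; have n1 : n < 1 by lra.
  exact: (@continuous_elliptic_deltaV R n x 1 n1).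
- move=> n x /andP[_ nv] _; have n1 : n < 1 by lra.
  have h := drvB (drv_cst 1 n) (drvM (drv_id n) (drv_cst (sin x ^+ 2) n)).
  have D0 := elliptic_delta_gt0 x n1.
  have Dn0 : Num.sqrt (1 - n * sin x ^+ 2) != 0 by rewrite gt_eqF.
  have h' := drvV (drv_sqrt h (lt0_elliptic_radicand x n1)) Dn0.
  by apply: (drv_eq h'); field.
- move=> n x /andP[_ nv] _; have n1 : n < 1 by lra.
  have s1 : sin x ^+ 2 <= 1 by rewrite -(cos2Dsin2 x) lerDr sqr_ge0.
  have D0 := elliptic_delta_gt0 x n1.
  have dD : Num.sqrt d <= Num.sqrt (1 - n * sin x ^+ 2).
    by rewrite ler_sqrt ?elliptic_radicand_ge ?(ltW (lt0_elliptic_radicand x n1)).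
  have sd0 : 0 < Num.sqrt d by rewrite sqrtr_gt0.
  have s0 : 0 <= sin x ^+ 2 / 2 by rewrite divr_ge0// sqr_ge0.
  have D3 : 0 <= (Num.sqrt (1 - n * sin x ^+ 2) ^+ 3)^-1.
    by rewrite invr_ge0 exprn_ge0// ltW.
  rewrite ger0_norm; last exact: mulr_ge0.
  rewrite -[leRHS]mul1r; apply: ler_pM.
  + exact: s0.
  + exact: D3.
  + by lra.
  + rewrite lef_pV2 ?posrE; [|exact: exprn_gt0..].
    by rewrite lerXn2r// nnegrE ltW.
Qed.

(** Writing Δ for the square root, Δ - (1-m)/Δ³ is the derivative of m sin x cos x / Δ, which
    vanishes at 0 and at π/2. *)
Lemma ellipticE_K3 (R : realType) (m : R) : m < 1 ->
  ellipticE m = (1 - m) * ellipticK3 m.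
Proof.
move=> m1.
have mB : measurable (`[0, pi / 2] : set R) by exact: measurable_itv.
have iE : (@lebesgue_measure R).-integrable `[0, pi / 2]
    (EFin \o (fun x => Num.sqrt (1 - m * sin x ^+ 2))).
  by apply: continuous_itv_integrable => x _; exact: continuous_elliptic_delta.
have i3 : (@lebesgue_measure R).-integrable `[0, pi / 2]
    (EFin \o (fun x => (1 - m) * (Num.sqrt (1 - m * sin x ^+ 2) ^+ 3)^-1)).
  apply: continuous_itv_integrable => x _; apply: continuousM.
    exact: cst_continuous.
  exact: continuous_elliptic_deltaV.
have i3' : (@lebesgue_measure R).-integrable `[0, pi / 2]
    (EFin \o (fun x => (Num.sqrt (1 - m * sin x ^+ 2) ^+ 3)^-1)).
  by apply: continuous_itv_integrable => x _; exact: continuous_elliptic_deltaV.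
apply/eqP; rewrite -subr_eq0 /ellipticK3 -RintegralZl// /ellipticE -RintegralB//.
pose F x := m * (sin x * cos x * (Num.sqrt (1 - m * sin x ^+ 2))^-1).
pose f x := Num.sqrt (1 - m * sin x ^+ 2) -
  (1 - m) * (Num.sqrt (1 - m * sin x ^+ 2) ^+ 3)^-1.
have dF x : 0 <= x <= pi / 2 -> is_derive x 1 F (f x).
  move=> _; have D0 : Num.sqrt (1 - m * sin x ^+ 2) != 0.
    by rewrite gt_eqF// elliptic_delta_gt0.
  have h := drvZ m (drvM (drvM (drv_sin (drv_id x)) (drv_cos (drv_id x)))
    (drvV (drv_elliptic_delta x m1) D0)).
  apply: (drv_eq h); rewrite /f.
  have e1 : Num.sqrt (1 - m * sin x ^+ 2) ^+ 2 = 1 - m * sin x ^+ 2.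
    by rewrite sqr_sqrtr// ltW// lt0_elliptic_radicand.
  have e2 : cos x ^+ 2 = 1 - sin x ^+ 2 by rewrite -(cos2Dsin2 x) addrK.
  move: e1 D0; set D := Num.sqrt _ => e1 D0.
  (* After multiplication by Δ³ the claim is polynomial in Δ² = 1 - m sin² x and cos² x = 1 - sin²
     x. *)
  apply: (mulIf (expf_neq0 3 D0)).
  rewrite (_ : (D - _) * _ = (D ^+ 2) ^+ 2 - (1 - m)); last by field.
  rewrite (_ : _ * D ^+ 3 = m * ((cos x ^+ 2 - sin x ^+ 2) * D ^+ 2 +
    m * sin x ^+ 2 * cos x ^+ 2)); last by field.
  by rewrite e1 e2; ring.
have cf x : 0 <= x <= pi / 2 -> {for x, continuous f}.
  move=> _; apply: continuousB; first exact: continuous_elliptic_delta.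
  by apply: continuousM; [exact: cst_continuous|exact: continuous_elliptic_deltaV].
rewrite /Rintegral (integral_drv (ltW (pi2_gt0 R)) dF cf)/= /F.
by rewrite sin0 cos_pihalf !(mul0r, mulr0) subrr.
Qed.

Lemma integrable_elliptic_delta (R : realType) (m : R) : m < 1 ->
  (@lebesgue_measure R).-integrable `[0, pi / 2]
    (EFin \o (fun x => Num.sqrt (1 - m * sin x ^+ 2))).
Proof.
by move=> m1; apply: continuous_itv_integrable => x _; exact: continuous_elliptic_delta.
Qed.

Lemma integrable_elliptic_deltaV (R : realType) (m : R) (n : nat) : m < 1 ->
  (@lebesgue_measure R).-integrable `[0, pi / 2]
    (EFin \o (fun x => (Num.sqrt (1 - m * sin x ^+ 2) ^+ n)^-1)).
Proof.
by move=> m1; apply: continuous_itv_integrable => x _; exact: continuous_elliptic_deltaV.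
Qed.

(** The differentiated integrand sin² x / (2Δ³) equals (Δ^-3 - Δ^-1) / (2m), so the derivative is
    ([ellipticK3] - K) / (2m), and [ellipticE_K3] removes [ellipticK3]. *)
Lemma drv_ellipticK (R : realType) (m : R) : m < 1 -> m != 0 ->
  is_derive m 1 (@ellipticK R)
    ((ellipticE m - (1 - m) * ellipticK m) / (2 * m * (1 - m))).
Proof.
move=> m1 m0; apply: (drv_eq (drv_ellipticK_integral m1)).
have mB : measurable (`[0, pi / 2] : set R) by exact: measurable_itv.
have i1 := @integrable_elliptic_deltaV R m 1 m1.
have i3 := @integrable_elliptic_deltaV R m 3 m1.
have -> : \int[@lebesgue_measure R]_(x in `[0, pi / 2])
    (sin x ^+ 2 / 2 * (Num.sqrt (1 - m * sin x ^+ 2) ^+ 3)^-1) =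
  \int[@lebesgue_measure R]_(x in `[0, pi / 2])
    ((2 * m)^-1 * ((Num.sqrt (1 - m * sin x ^+ 2) ^+ 3)^-1 -
      (Num.sqrt (1 - m * sin x ^+ 2))^-1)).
  apply: eq_Rintegral => x _.
  have e1 : Num.sqrt (1 - m * sin x ^+ 2) ^+ 2 = 1 - m * sin x ^+ 2.
    by rewrite sqr_sqrtr// ltW// lt0_elliptic_radicand.
  have D0 : Num.sqrt (1 - m * sin x ^+ 2) != 0.
    by rewrite gt_eqF// elliptic_delta_gt0.
  move: e1 D0; set D := Num.sqrt _ => e1 D0.
  have -> : D^-1 = D ^+ 2 * (D ^+ 3)^-1 by field.
  by rewrite e1; field; rewrite D0.
rewrite RintegralZl//; last first.
  apply: continuous_itv_integrable => x _; apply: continuousB.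
    exact: continuous_elliptic_deltaV.
  exact: (@continuous_elliptic_deltaV R m x 1 m1).
rewrite RintegralB// -/(ellipticK3 m) -/(ellipticK m).
rewrite (ellipticE_K3 m1); field.
by rewrite m0 subr_eq0 eq_sym lt_eqF.
Qed.

Lemma drv_ellipticE (R : realType) (m : R) : m < 1 -> m != 0 ->
  is_derive m 1 (@ellipticE R) ((ellipticE m - ellipticK m) / (2 * m)).
Proof.
move=> m1 m0; apply: (drv_eq (drv_ellipticE_integral m1)).
have mB : measurable (`[0, pi / 2] : set R) by exact: measurable_itv.
have i1 := @integrable_elliptic_deltaV R m 1 m1.
have i0 := integrable_elliptic_delta m1.
have -> : \int[@lebesgue_measure R]_(x in `[0, pi / 2])
    (- (sin x ^+ 2) / (2 * Num.sqrt (1 - m * sin x ^+ 2))) =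
  \int[@lebesgue_measure R]_(x in `[0, pi / 2])
    ((2 * m)^-1 * (Num.sqrt (1 - m * sin x ^+ 2) -
      (Num.sqrt (1 - m * sin x ^+ 2))^-1)).
  apply: eq_Rintegral => x _.
  have e1 : Num.sqrt (1 - m * sin x ^+ 2) ^+ 2 = 1 - m * sin x ^+ 2.
    by rewrite sqr_sqrtr// ltW// lt0_elliptic_radicand.
  have D0 : Num.sqrt (1 - m * sin x ^+ 2) != 0.
    by rewrite gt_eqF// elliptic_delta_gt0.
  move: e1 D0; set D := Num.sqrt _ => e1 D0.
  have -> : D - D^-1 = (D ^+ 2 - 1) / D by field.
  by rewrite e1; field; rewrite D0.
rewrite RintegralZl//; last first.
  apply: continuous_itv_integrable => x _; apply: continuousB.
    exact: continuous_elliptic_delta.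
  exact: (@continuous_elliptic_deltaV R m x 1 m1).
rewrite RintegralB// -/(ellipticE m) -/(ellipticK m).
by rewrite mulrC.
Qed.

(** * Bounds for K and E, and Legendre's relation *)

Lemma continuous_ellipticK (R : realType) (m : R) : m < 1 ->
  {for m, continuous (@ellipticK R)}.
Proof. by move=> m1; apply: drv_continuous (drv_ellipticK_integral m1). Qed.

Lemma continuous_ellipticE (R : realType) (m : R) : m < 1 ->
  {for m, continuous (@ellipticE R)}.
Proof. by move=> m1; apply: drv_continuous (drv_ellipticE_integral m1). Qed.

Lemma Rintegral_itv_cst (R : realType) (a b c : R) : a <= b ->
  \int[@lebesgue_measure R]_(x in `[a, b]) c = c * (b - a).
Proof.
move=> ab; rewrite Rintegral_cst//=.
rewrite lebesgue_measure_itv/= lte_fin; case: ltP => h.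
  by rewrite -EFinB.
have -> : b = a by apply/eqP; rewrite eq_le h ab.
by rewrite subrr.
Qed.

Lemma ellipticK0 (R : realType) : ellipticK (0 : R) = pi / 2.
Proof.
rewrite /ellipticK; under eq_Rintegral do rewrite mul0r subr0 sqrtr1 invr1.
by rewrite Rintegral_itv_cst ?(ltW (pi2_gt0 R))// mul1r subr0.
Qed.

Lemma ellipticE0 (R : realType) : ellipticE (0 : R) = pi / 2.
Proof.
rewrite /ellipticE; under eq_Rintegral do rewrite mul0r subr0 sqrtr1.
by rewrite Rintegral_itv_cst ?(ltW (pi2_gt0 R))// mul1r subr0.
Qed.

Lemma elliptic_delta_le1 (R : realType) (m x : R) : 0 <= m ->
  Num.sqrt (1 - m * sin x ^+ 2) <= 1.
Proof.
move=> m0; rewrite -[leRHS]sqrtr1; apply: ler_wsqrtr; rewrite gerBl.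
by apply: mulr_ge0 => //; exact: sqr_ge0.
Qed.

Lemma ellipticK_ge (R : realType) (m : R) : 0 <= m < 1 -> pi / 2 <= ellipticK m.
Proof.
move=> /andP[m0 m1].
have -> : pi / 2 = \int[@lebesgue_measure R]_(x in `[0, pi / 2]) 1.
  by rewrite Rintegral_itv_cst ?(ltW (pi2_gt0 R))// mul1r subr0.
apply: le_Rintegral.
- exact: measurable_itv.
- by apply: continuous_itv_integrable => x _; exact: cst_continuous.
- exact: (@integrable_elliptic_deltaV R m 1 m1).
- move=> x _; rewrite -[leLHS]invr1 lef_pV2 ?posrE//.
    exact: elliptic_delta_le1.
  exact: elliptic_delta_gt0.
Qed.

Lemma ellipticK_gt0 (R : realType) (m : R) : 0 <= m < 1 -> 0 < ellipticK m.
Proof. by move=> m01; apply: lt_le_trans (ellipticK_ge m01); exact: pi2_gt0. Qed.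

Lemma sqrt_le_elliptic_delta (R : realType) (m x : R) : 0 <= m < 1 ->
  Num.sqrt (1 - m) <= Num.sqrt (1 - m * sin x ^+ 2).
Proof.
move=> /andP[m0 m1]; rewrite ler_sqrt; last by rewrite ltW// lt0_elliptic_radicand.
have s1 : sin x ^+ 2 <= 1 by rewrite -(cos2Dsin2 x) lerDr sqr_ge0.
by rewrite lerD2l lerN2 ler_piMr.
Qed.

Lemma ellipticK_le (R : realType) (m : R) : 0 <= m < 1 ->
  ellipticK m <= pi / 2 / Num.sqrt (1 - m).
Proof.
move=> /andP[m0 m1].
have -> : pi / 2 / Num.sqrt (1 - m) =
    \int[@lebesgue_measure R]_(x in `[0, pi / 2]) (Num.sqrt (1 - m))^-1.
  by rewrite Rintegral_itv_cst ?(ltW (pi2_gt0 R))// subr0 mulrC.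
apply: le_Rintegral.
- exact: measurable_itv.
- exact: (@integrable_elliptic_deltaV R m 1 m1).
- by apply: continuous_itv_integrable => x _; exact: cst_continuous.
- move=> x _; rewrite lef_pV2 ?posrE; last 2 first.
  + exact: elliptic_delta_gt0.
  + by rewrite sqrtr_gt0 subr_gt0.
  by apply: sqrt_le_elliptic_delta; rewrite m0.
Qed.

(** The difference of the integrands is 1/Δ - Δ = m sin² x / Δ. *)
Lemma ellipticK_sub_E (R : realType) (m : R) : 0 <= m < 1 ->
  0 <= ellipticK m - ellipticE m <= m * ellipticK m.
Proof.
move=> /andP[m0 m1].
have mB : measurable (`[0, pi / 2] : set R) by exact: measurable_itv.
have i1 := @integrable_elliptic_deltaV R m 1 m1.
have i0 := integrable_elliptic_delta m1.
have i1' : (@lebesgue_measure R).-integrable `[0, pi / 2]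
    (EFin \o (fun x => m * (Num.sqrt (1 - m * sin x ^+ 2))^-1)).
  apply: continuous_itv_integrable => x _; apply: continuousM.
    exact: cst_continuous.
  exact: (@continuous_elliptic_deltaV R m x 1 m1).
have iB : (@lebesgue_measure R).-integrable `[0, pi / 2]
    (EFin \o (fun x => (Num.sqrt (1 - m * sin x ^+ 2))^-1 -
       Num.sqrt (1 - m * sin x ^+ 2))).
  apply: continuous_itv_integrable => x _; apply: continuousB.
    exact: (@continuous_elliptic_deltaV R m x 1 m1).
  exact: continuous_elliptic_delta.
have E (x : R) : (Num.sqrt (1 - m * sin x ^+ 2))^-1 - Num.sqrt (1 - m * sin x ^+ 2)
    = m * sin x ^+ 2 * (Num.sqrt (1 - m * sin x ^+ 2))^-1.
  have e1 : Num.sqrt (1 - m * sin x ^+ 2) ^+ 2 = 1 - m * sin x ^+ 2.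
    by rewrite sqr_sqrtr// ltW// lt0_elliptic_radicand.
  have D0 : Num.sqrt (1 - m * sin x ^+ 2) != 0.
    by rewrite gt_eqF// elliptic_delta_gt0.
  move: e1 D0; set D := Num.sqrt _ => e1 D0.
  have -> : m * sin x ^+ 2 = 1 - D ^+ 2 by rewrite e1; ring.
  by field.
have V0 (x : R) : 0 <= (Num.sqrt (1 - m * sin x ^+ 2))^-1.
  by rewrite invr_ge0 sqrtr_ge0.
rewrite /ellipticK /ellipticE -RintegralB//; apply/andP; split.
  apply: Rintegral_ge0 => x _; rewrite E; apply: mulr_ge0 => //.
  by rewrite mulr_ge0// sqr_ge0.
rewrite -RintegralZl//; apply: le_Rintegral => // x _; rewrite E.
have s1 : sin x ^+ 2 <= 1 by rewrite -(cos2Dsin2 x) lerDr sqr_ge0.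
by apply: ler_wpM2r => //; rewrite ler_piMr.
Qed.

(** For m = 1 - e² the radicand is cos² x + e² sin² x, which lies between cos² x and (cos x +
    e)². *)
Lemma ellipticE_near1 (R : realType) (e : R) : 0 < e < 1 ->
  1 <= ellipticE (1 - e ^+ 2) <= 1 + e * (pi / 2).
Proof.
move=> /andP[e0 e1].
have m1 : 1 - e ^+ 2 < 1 by rewrite gtrBl exprn_gt0.
have mB : measurable (`[0, pi / 2] : set R) by exact: measurable_itv.
have dsin (x : R) : 0 <= x <= pi / 2 -> is_derive x 1 (@sin R) (cos x).
  by move=> _; exact: is_derive_sin.
have icos : \int[@lebesgue_measure R]_(x in `[0, pi / 2]) cos x = 1.
  rewrite /Rintegral (integral_drv (ltW (pi2_gt0 R)) dsin)/=.
    by rewrite sin_pihalf sin0 subr0.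
  by move=> x _; exact: continuous_cos.
have ic : (@lebesgue_measure R).-integrable `[0, pi / 2] (EFin \o @cos R).
  by apply: continuous_itv_integrable => x _; exact: continuous_cos.
have ie : (@lebesgue_measure R).-integrable `[0, pi / 2] (EFin \o (fun=> e)).
  by apply: continuous_itv_integrable => x _; exact: cst_continuous.
have ice : (@lebesgue_measure R).-integrable `[0, pi / 2] (EFin \o (fun x => cos x + e)).
  apply: continuous_itv_integrable => x _; apply: continuousD.
    exact: continuous_cos.
  exact: cst_continuous.
have E (x : R) : 1 - (1 - e ^+ 2) * sin x ^+ 2 = cos x ^+ 2 + e ^+ 2 * sin x ^+ 2.
  have -> : cos x ^+ 2 = 1 - sin x ^+ 2 by rewrite -(cos2Dsin2 x) addrK.
  by ring.
have c0 (x : R) : (`[0, pi / 2]%classic : set R) x -> 0 <= cos x.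
  rewrite /= in_itv/= => /andP[x0 xp]; apply: cos_ge0_pihalf.
  by rewrite xp andbT; apply: le_trans x0; rewrite oppr_le0 ltW// pi2_gt0.
rewrite /ellipticE; apply/andP; split.
  rewrite -[leLHS]icos; apply: le_Rintegral => //.
    exact: integrable_elliptic_delta.
  move=> x Dx; rewrite E -[leLHS]ger0_norm ?c0// -sqrtr_sqr.
  by rewrite ler_wsqrtr// lerDl mulr_ge0 ?sqr_ge0.
have -> : 1 + e * (pi / 2) = \int[@lebesgue_measure R]_(x in `[0, pi / 2]) (cos x + e).
  by rewrite RintegralD// icos Rintegral_itv_cst ?(ltW (pi2_gt0 R))// subr0.
apply: le_Rintegral => //; first exact: integrable_elliptic_delta.
move=> x Dx; have cx := c0 x Dx.
have ce0 : 0 <= cos x + e by rewrite addr_ge0// ltW.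
rewrite E -[leRHS]ger0_norm// -sqrtr_sqr ler_wsqrtr//.
have s1 : sin x ^+ 2 <= 1 by rewrite -(cos2Dsin2 x) lerDr sqr_ge0.
have : e ^+ 2 * sin x ^+ 2 <= e ^+ 2 by rewrite ler_piMr ?sqr_ge0.
have : 0 <= 2 * cos x * e by rewrite !mulr_ge0// ltW.
rewrite sqrrD; lra.
Qed.

Lemma drv0_constant (R : realType) (f : R -> R) (a b x y : R) :
  (forall z, a < z < b -> is_derive z 1 f 0) ->
  a < x < b -> a < y < b -> f x = f y.
Proof.
move=> df.
wlog xy : x y / x < y.
  move=> h xab yab; have [xy|yx|->//] := ltgtP x y; first exact: h.
  by apply/esym; exact: h.
move=> /andP[ax xb] /andP[ay yb].
have [||z _] := @MVT R f (fun=> 0) x y xy.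
- move=> z; rewrite in_itv/= => /andP[xz zy]; apply: df.
  by rewrite (lt_trans ax xz) (lt_trans zy yb).
- apply: within_continuous_itv => z /andP[xz zy].
  by apply: drv_continuous (df z _); rewrite (lt_le_trans ax xz) (le_lt_trans zy yb).
by rewrite mul0r => /eqP; rewrite subr_eq0 => /eqP.
Qed.

(** The form in which constants are evaluated by a limit below: in Legendre's relation and along the
    sequence q^(2^n). *)
Lemma small_linear_eq0 (R : realType) (y C : R) :
  (forall e : R, 0 < e <= 1 / 2 -> `|y| <= e * C) -> y = 0.
Proof.
move=> h; apply/eqP; rewrite -normr_le0.
have C0 : 0 <= C.
  have := h (1 / 2); rewrite divr_gt0// lexx => /(_ isT) h2.
  have := le_trans (normr_ge0 y) h2; lra.
apply/ler_addgt0Pr => e e0; rewrite add0r.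
pose d := Num.min (1 / 2) (e / (C + 1)).
have C1 : 0 < C + 1 by rewrite ltr_wpDl.
have d0 : 0 < d by rewrite lt_min !divr_gt0.
have d12 : d <= 1 / 2 by rewrite ge_min lexx.
apply: (le_trans (h d _)); first by rewrite d0.
have : d <= e / (C + 1) by rewrite ge_min lexx orbT.
rewrite ler_pdivlMr//; nra.
Qed.

Lemma drv0_constant_le (R : realType) (f : R -> R) (x y : R) : x < y ->
  (forall z, x < z < y -> is_derive z 1 f 0) ->
  (forall z, x <= z <= y -> {for z, continuous f}) -> f x = f y.
Proof.
move=> xy df cf.
have d z : z \in `]x, y[ -> is_derive z 1 f 0 by rewrite in_itv/=; exact: df.
have [|z _] := @MVT R f (fun=> 0) x y xy d; first exact: within_continuous_itv.
by rewrite mul0r => /eqP; rewrite subr_eq0 => /eqP.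
Qed.

Lemma drv_ellipticK_compl (R : realType) (m : R) : 0 < m < 1 ->
  is_derive m 1 (fun m => ellipticK (1 - m))
    (- (ellipticE (1 - m) - m * ellipticK (1 - m)) / (2 * m * (1 - m))).
Proof.
move=> /andP[m0 m1].
have m1' : 1 - m < 1 by lra.
have m0' : 1 - m != 0 by rewrite subr_eq0 eq_sym lt_eqF.
have d := drv_comp (drvB (drv_cst 1 m) (drv_id m)) (drv_ellipticK m1' m0').
by apply: (drv_eq d); field; rewrite m0' gt_eqF.
Qed.

Lemma drv_ellipticE_compl (R : realType) (m : R) : 0 < m < 1 ->
  is_derive m 1 (fun m => ellipticE (1 - m))
    (- (ellipticE (1 - m) - ellipticK (1 - m)) / (2 * (1 - m))).
Proof.
move=> /andP[m0 m1].
have m1' : 1 - m < 1 by lra.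
have m0' : 1 - m != 0 by rewrite subr_eq0 eq_sym lt_eqF.
have d := drv_comp (drvB (drv_cst 1 m) (drv_id m)) (drv_ellipticE m1' m0').
by apply: (drv_eq d); field.
Qed.

(** By the differential equations of K and E the left side has derivative zero. Its constant value
    is found at m = e² with e tending to 0, where K and E tend to π/2, E(1-m) tends to 1, and K(1-m)
    grows at most like 1/e. *)
Lemma legendre_relation (R : realType) (m : R) : 0 < m < 1 ->
  ellipticE m * ellipticK (1 - m) + ellipticE (1 - m) * ellipticK m -
  ellipticK m * ellipticK (1 - m) = pi / 2.
Proof.
move=> m01; pose W (m : R) := ellipticE m * ellipticK (1 - m) +
  ellipticE (1 - m) * ellipticK m - ellipticK m * ellipticK (1 - m).
have dW (z : R) : 0 < z < 1 -> is_derive z 1 W 0.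
  move=> z01; have /andP[z0 z1] := z01.
  have zn0 : z != 0 by rewrite gt_eqF.
  have dK := drv_ellipticK z1 zn0; have dE := drv_ellipticE z1 zn0.
  have dK' := drv_ellipticK_compl z01; have dE' := drv_ellipticE_compl z01.
  apply: (drv_eq (drvB (drvD (drvM dE dK') (drvM dE' dK)) (drvM dK dK'))).
  by field; rewrite zn0 subr_eq0 gt_eqF.
rewrite -/(W m); apply/eqP; rewrite -subr_eq0; apply/eqP.
have p20 := pi2_gt0 R.
apply: (@small_linear_eq0 _ _ (2 * (pi / 2) * (1 + pi / 2))) => e /andP[e0 e12].
have e1 : e < 1 by lra.
have e201 : 0 < e ^+ 2 < 1 by rewrite exprn_gt0//= exprn_ilt1// ltW.
have -> : W m = W (e ^+ 2) by exact: (drv0_constant dW).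
have e2c : 0 <= e ^+ 2 < 1 by case/andP: e201 => /ltW -> ->.
have e2c' : 0 <= 1 - e ^+ 2 < 1.
  by case/andP: e201 => h1 h2; rewrite subr_ge0 ltW//= gtrBl.
have /andP[KE0 KE1] := ellipticK_sub_E e2c.
have /andP[E'1 E'2] := ellipticE_near1 (e := e) ltac:(by rewrite e0 e1).
have K0 := ellipticK_ge e2c.
have K'0 := ellipticK_gt0 e2c'.
have K'1 := ellipticK_le e2c'.
rewrite subKr sqrtr_sqr (ger0_norm (ltW e0)) in K'1.
have K1 : ellipticK (e ^+ 2) * (1 - e) <= pi / 2.
  have := ellipticK_le e2c; rewrite ler_pdivlMr; last first.
    by rewrite sqrtr_gt0 subr_gt0; case/andP: e201.
  apply: le_trans; apply: ler_wpM2l; first by lra.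
  have -> : 1 - e = Num.sqrt ((1 - e) ^+ 2) by rewrite sqrtr_sqr ger0_norm; lra.
  by apply: ler_wsqrtr; nra.
rewrite /W.
set K := ellipticK _ in KE0 KE1 K0 K1 *; set E := ellipticE _ in KE0 KE1 *.
set K' := ellipticK _ in K'0 K'1 *; set E' := ellipticE _ in E'1 E'2 *.
set P := pi / 2 in p20 E'2 K0 K'1 K1 *.
(* Both parts are O(e): E' K tends to π/2, while K - E is O(e²) against K' = O(1/e). *)
have -> : E * K' + E' * K - K * K' - P = (E' * K - P) - (K - E) * K' by ring.
have h1 : 0 <= (K - E) * K' <= e * (K * P).
  apply/andP; split; first by rewrite mulr_ge0// ltW.
  apply: (@le_trans _ _ (e ^+ 2 * K * (P / e))).
    by apply: ler_pM => //; exact: ltW.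
  by rewrite le_eqVlt; apply/orP; left; apply/eqP; field; rewrite gt_eqF.
have K2P : K <= 2 * P by nra.
have h2 : 0 <= E' * K - P.
  rewrite subr_ge0; apply: (le_trans K0).
  by rewrite ler_peMl// (le_trans _ K0)// ltW.
have h3 : E' * K - P <= e * (K * (1 + P)).
  have : E' * K <= (1 + e * P) * K by apply: ler_wpM2r => //; lra.
  lra.
have h4 : e * (K * (1 + P)) <= e * (2 * P * (1 + P)).
  by apply: ler_wpM2l; [exact: ltW|apply: ler_wpM2r => //; lra].
have h5 : e * (K * P) <= e * (K * (1 + P)).
  by apply: ler_wpM2l; [exact: ltW|apply: ler_wpM2l; lra].
by rewrite ler_norml; case/andP: h1 => h6 h7; apply/andP; split; lra.
Qed.

(** * The ratio K'/K and Landen's transformation *)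

(** The parameter of the nome: q = e^(-π K'/K) is e^(-π [K_ratio] m). *)
Definition K_ratio (R : realType) (m : R) : R := ellipticK (1 - m) / ellipticK m.

(** The quotient rule leaves the combination of Legendre's relation in the numerator. *)
Lemma drv_K_ratio (R : realType) (m : R) : 0 < m < 1 ->
  is_derive m 1 (@K_ratio R) (- pi / (4 * m * (1 - m) * ellipticK m ^+ 2)).
Proof.
move=> m01; have /andP[m0 m1] := m01.
have mn0 : m != 0 by rewrite gt_eqF.
have K0 : ellipticK m != 0 by rewrite gt_eqF// ellipticK_gt0// ltW.
have dK := drv_ellipticK m1 mn0; have dK' := drv_ellipticK_compl m01.
apply: (drv_eq (drvM dK' (drvV dK K0))).
have -> : pi = 2 * (ellipticE m * ellipticK (1 - m) + ellipticE (1 - m) * ellipticK m -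
  ellipticK m * ellipticK (1 - m)) by rewrite legendre_relation//; field.
by field; rewrite mn0 K0 subr_eq0 gt_eqF.
Qed.

Lemma K_ratio_gt0 (R : realType) (m : R) : 0 < m < 1 -> 0 < K_ratio m.
Proof.
move=> /andP[m0 m1]; rewrite divr_gt0 ?ellipticK_gt0 ?m1 ?(ltW m0)//.
by rewrite subr_ge0 (ltW m1)/= gtrBl.
Qed.

Lemma K_ratio_compl (R : realType) (m : R) : 0 < m < 1 ->
  K_ratio (1 - m) = (K_ratio m)^-1.
Proof. by move=> m01; rewrite /K_ratio subKr invf_div. Qed.

Lemma K_ratio_decreasing (R : realType) (m n : R) :
  0 < m -> n < 1 -> m < n -> K_ratio n < K_ratio m.
Proof.
move=> m0 n1 mn.
have d z : m <= z <= n -> is_derive z 1 (@K_ratio R)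
    (- pi / (4 * z * (1 - z) * ellipticK z ^+ 2)).
  move=> /andP[mz zn]; apply: drv_K_ratio.
  by rewrite (lt_le_trans m0 mz) (le_lt_trans zn n1).
apply: (lt_decreasing_drv d) => //; rewrite ?in_itv/= ?lexx ?(ltW mn)//.
move=> z /andP[mz zn]; have z0 := lt_le_trans m0 mz; have z1 := le_lt_trans zn n1.
have K0 : 0 < ellipticK z by rewrite ellipticK_gt0// z1 ltW.
by rewrite mulNr oppr_lt0 divr_gt0 ?pi_gt0// !mulr_gt0 ?subr_gt0 ?exprn_gt0.
Qed.

Lemma K_ratio_inj (R : realType) (m n : R) :
  0 < m < 1 -> 0 < n < 1 -> K_ratio m = K_ratio n -> m = n.
Proof.
move=> /andP[m0 m1] /andP[n0 n1] e; have [mn|nm|//] := ltgtP m n.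
  by have := K_ratio_decreasing m0 n1 mn; rewrite e ltxx.
by have := K_ratio_decreasing n0 m1 nm; rewrite e ltxx.
Qed.

(* The two sides solve the same first-order linear system in [p], whose
   Wronskian is constant because its trace vanishes. *)
Lemma landen_transformation (R : realType) (p : R) : 0 < p < 1 ->
  ellipticK (1 - p ^+ 2) =
  2 / (1 + p) * ellipticK (((1 - p) / (1 + p)) ^+ 2).
Proof.
pose l (p : R) := ((1 - p) / (1 + p)) ^+ 2.
pose f (p : R) := ellipticK (1 - p ^+ 2).
pose e (p : R) := ellipticE (1 - p ^+ 2).
pose g (p : R) := 2 / (1 + p) * ellipticK (l p).
(* This is the Landen expression of E(1 - p²): with it (g, h) satisfies the same system as (f,
   e). *)
pose h (p : R) := (1 + p) * ellipticE (l p) - 2 * p / (1 + p) * ellipticK (l p).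
have cm (q : R) : 0 < q < 1 -> 0 < 1 - q ^+ 2 < 1.
  by move=> /andP[q0 q1]; apply/andP; split; nra.
have dl (q : R) : 0 < q -> is_derive q 1 l (- 4 * (1 - q) / (1 + q) ^+ 3).
  move=> q0; have q10 : 1 + q != 0 by rewrite gt_eqF// addr_gt0.
  have d1 := drvD (drv_cst 1 q) (drv_id q).
  have d2 := drvB (drv_cst 1 q) (drv_id q).
  by apply: (drv_eq (drvX 2 (drvM d2 (drvV d1 q10)))); rewrite /= expr1; field.
have l1 (q : R) : 0 < q -> 1 - l q = 4 * q / (1 + q) ^+ 2.
  by move=> q0; rewrite /l; field; rewrite gt_eqF// addr_gt0.
have l01 (q : R) : 0 < q -> l q < 1.
  by move=> q0; rewrite -subr_gt0 l1// divr_gt0 ?exprn_gt0 ?mulr_gt0 ?addr_gt0.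
have l0 (q : R) : 0 < q < 1 -> 0 < l q.
  by move=> /andP[q0 q1]; rewrite exprn_gt0// divr_gt0 ?subr_gt0 ?addr_gt0.
have dc (q : R) : is_derive q 1 (fun p => 1 - p ^+ 2) (- (2 * q)).
  apply: (drv_eq (drvB (drv_cst 1 q) (drvX 2 (drv_id q)))).
  by rewrite /= expr1; ring.
have df (q : R) : 0 < q < 1 -> is_derive q 1 f
    (- (e q - q ^+ 2 * f q) / ((1 - q ^+ 2) * q)).
  move=> q01; have /andP[q0 q1] := q01; have /andP[c0 c1] := cm q q01.
  have c0' : 1 - q ^+ 2 != 0 by rewrite gt_eqF.
  apply: (drv_eq (drv_comp (dc q) (drv_ellipticK c1 c0'))); rewrite /e /f.
  have qn : q != 0 by rewrite gt_eqF.
  by field; rewrite qn c0' subKr expf_neq0.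
have de (q : R) : 0 < q < 1 -> is_derive q 1 e (- q * (e q - f q) / (1 - q ^+ 2)).
  move=> q01; have /andP[q0 q1] := q01; have /andP[c0 c1] := cm q q01.
  have c0' : 1 - q ^+ 2 != 0 by rewrite gt_eqF.
  apply: (drv_eq (drv_comp (dc q) (drv_ellipticE c1 c0'))); rewrite /e /f.
  by field.
have dg (q : R) : 0 < q < 1 -> is_derive q 1 g
    (- (h q - q ^+ 2 * g q) / ((1 - q ^+ 2) * q)).
  move=> q01; have /andP[q0 q1] := q01; have lq0 := l0 q q01; have lq1 := l01 q q0.
  have q10 : 1 + q != 0 by rewrite gt_eqF// addr_gt0.
  have q1' : 1 - q != 0 by rewrite gt_eqF// subr_gt0.
  have lqn : l q != 0 by rewrite gt_eqF.
  have d1 := drvM (drv_cst 2 q) (drvV (drvD (drv_cst 1 q) (drv_id q)) q10).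
  apply: (drv_eq (drvM d1 (drv_comp (dl q q0) (drv_ellipticK lq1 lqn)))).
  rewrite /h /g l1//.
  move: (ellipticK (l q)) (ellipticE (l q)) => K E; rewrite /l.
  have qn : q != 0 by rewrite gt_eqF.
  have cn : 1 - q ^+ 2 != 0 by rewrite gt_eqF//; case/andP: (cm q q01).
  by field; rewrite qn cn q10 q1'.
have dh (q : R) : 0 < q < 1 -> is_derive q 1 h (- q * (h q - g q) / (1 - q ^+ 2)).
  move=> q01; have /andP[q0 q1] := q01; have lq0 := l0 q q01; have lq1 := l01 q q0.
  have q10 : 1 + q != 0 by rewrite gt_eqF// addr_gt0.
  have q1' : 1 - q != 0 by rewrite gt_eqF// subr_gt0.
  have lqn : l q != 0 by rewrite gt_eqF.
  have d1 := drvD (drv_cst 1 q) (drv_id q).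
  have d2 := drvM (drvM (drv_cst 2 q) (drv_id q)) (drvV d1 q10).
  have dK := drv_comp (dl q q0) (drv_ellipticK lq1 lqn).
  have dE := drv_comp (dl q q0) (drv_ellipticE lq1 lqn).
  apply: (drv_eq (drvB (drvM d1 dE) (drvM d2 dK))).
  rewrite /h /g l1//.
  move: (ellipticK (l q)) (ellipticE (l q)) => K E; rewrite /l.
  have qn : q != 0 by rewrite gt_eqF.
  have cn : 1 - q ^+ 2 != 0 by rewrite gt_eqF//; case/andP: (cm q q01).
  by field; rewrite qn cn q10 q1'.
have cl (q : R) : 0 < q -> {for q, continuous l} by move=> /dl; exact: drv_continuous.
have cc (q : R) : {for q, continuous (fun p : R => 1 - p ^+ 2)} by exact: drv_continuous (dc q).
have cf (q : R) : 0 < q -> {for q, continuous f}.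
  move=> q0; apply: continuous_comp; first exact: cc.
  by apply: continuous_ellipticK; rewrite gtrBl exprn_gt0.
have ce (q : R) : 0 < q -> {for q, continuous e}.
  move=> q0; apply: continuous_comp; first exact: cc.
  by apply: continuous_ellipticE; rewrite gtrBl exprn_gt0.
have cKl (q : R) : 0 < q -> {for q, continuous (fun p => ellipticK (l p))}.
  move=> q0; apply: continuous_comp; first exact: cl.
  by apply: continuous_ellipticK; exact: l01.
have cEl (q : R) : 0 < q -> {for q, continuous (fun p => ellipticE (l p))}.
  move=> q0; apply: continuous_comp; first exact: cl.
  by apply: continuous_ellipticE; exact: l01.
have c2 (q : R) : 0 < q -> {for q, continuous (fun p : R => 2 / (1 + p))}.
  move=> q0; have q10 : 1 + q != 0 by rewrite gt_eqF// addr_gt0.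
  apply: drv_continuous (drvM (drv_cst 2 q) (drvV (drvD (drv_cst 1 q) (drv_id q)) q10)).
have c2p (q : R) : 0 < q -> {for q, continuous (fun p : R => 2 * p / (1 + p))}.
  move=> q0; have q10 : 1 + q != 0 by rewrite gt_eqF// addr_gt0.
  apply: drv_continuous (drvM (drvM (drv_cst 2 q) (drv_id q))
    (drvV (drvD (drv_cst 1 q) (drv_id q)) q10)).
have cg (q : R) : 0 < q -> {for q, continuous g}.
  by move=> q0; apply: continuousM; [exact: c2|exact: cKl].
have ch (q : R) : 0 < q -> {for q, continuous h}.
  move=> q0; apply: continuousB; apply: continuousM.
  - exact: drv_continuous (drvD (drv_cst 1 q) (drv_id q)).
  - exact: cEl.
  - exact: c2p.
  - exact: cKl.
have f1 : f 1 = pi / 2 by rewrite /f expr1n subrr ellipticK0.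
have e1 : e 1 = pi / 2 by rewrite /e expr1n subrr ellipticE0.
have l10 : l 1 = 0 by rewrite /l subrr mul0r expr0n.
have g1 : g 1 = pi / 2 by rewrite /g l10 ellipticK0 divff ?mul1r.
have h1 : h 1 = pi / 2 by rewrite /h l10 ellipticK0 ellipticE0; field.
have fn0 (q : R) : 0 < q <= 1 -> f q != 0.
  move=> /andP[q0 q1]; rewrite gt_eqF// ellipticK_gt0//.
  by apply/andP; split; nra.
(* The system is singular at 1, so the derivative is computed on an open interval and the value 0 at
   the endpoint, where f, e, g and h all equal π/2, is carried over by continuity. *)
have W0 (q : R) : 0 < q < 1 -> f q * h q = e q * g q.
  move=> q01; have /andP[q0 q1] := q01.
  have dW (z : R) : q < z < 1 -> is_derive z 1 (fun q => f q * h q - e q * g q) 0.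
    move=> /andP[qz z1]; have z01 : 0 < z < 1 by rewrite (lt_trans q0 qz) z1.
    apply: (drv_eq (drvB (drvM (df z z01) (dh z z01)) (drvM (de z z01) (dg z z01)))).
    have zn : z != 0 by rewrite gt_eqF//; case/andP: z01.
    have cn : 1 - z ^+ 2 != 0 by rewrite gt_eqF//; case/andP: (cm z z01).
    move: (f z) (e z) (g z) (h z) => F E G H.
    by field; rewrite zn cn.
  have := drv0_constant_le q1 dW; rewrite f1 e1 g1 h1 subrr => E.
  apply/eqP; rewrite -subr_eq0; apply/eqP; apply: E => z /andP[qz _].
  have z0 := lt_le_trans q0 qz.
  by apply: continuousB; apply: continuousM; [exact: cf|exact: ch|exact: ce|exact: cg].
move=> p01; have /andP[p0 p1] := p01.
(* Since h/g = e/f, the logarithmic derivatives of f and g agree; hence g/f is constant, with value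
   1 at the endpoint 1. *)
have dr (z : R) : p < z < 1 -> is_derive z 1 (fun q => g q * (f q)^-1) 0.
  move=> /andP[qz z1]; have z0 := lt_trans p0 qz.
  have z01 : 0 < z < 1 by rewrite z0 z1.
  have fz : f z != 0 by apply: fn0; rewrite z0 ltW.
  apply: (drv_eq (drvM (dg z z01) (drvV (df z z01) fz))).
  have zn : z != 0 by rewrite gt_eqF.
  have cn : 1 - z ^+ 2 != 0 by rewrite gt_eqF//; case/andP: (cm z z01).
  have := W0 z z01; move: fz; move: (f z) (e z) (g z) (h z) => F E G H Fn W.
  have -> : H = E * G / F by rewrite -W mulrC mulKf.
  by field; rewrite zn cn Fn.
have fp : f p != 0 by apply: fn0; rewrite p0 ltW.
have := drv0_constant_le p1 dr; rewrite f1 g1 divff; last by rewrite gt_eqF// pi2_gt0.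
move=> E; have {}E : g p / f p = 1.
  apply: E => z /andP[pz z1]; have z0 := lt_le_trans p0 pz.
  apply: continuousM; first exact: cg.
  by apply: continuousV; [apply: fn0; rewrite z0|exact: cf].
by rewrite -/(f p) -/(l p) -/(g p) -[f p]mul1r -E divfK.
Qed.

(** * Lattice sums and the duplication of theta series *)

Local Open Scope ereal_scope.

(** The inequality [H] for the factor c gives one direction, and for the factor c^-1 the other. *)
Lemma esumZ (R : realType) (T : choiceType) (I : set T) (a : T -> \bar R) (c : R) :
  (0 <= c)%R -> (forall i, 0 <= a i) ->
  \esum_(i in I) (c%:E * a i) = c%:E * \esum_(i in I) a i.
Proof.
have H (d : R) (b : T -> \bar R) : (0 <= d)%R -> (forall i, 0 <= b i) ->
    \esum_(i in I) (d%:E * b i) <= d%:E * \esum_(i in I) b i.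
  move=> d0 b0; rewrite ge_ereal_sup//= => _ [X [finX XI]] <-.
  rewrite fsbig_finite//= -ge0_sume_distrr//.
  apply: lee_wpmul2l; rewrite ?lee_fin//.
  by apply: esum_ge; exists X => //; rewrite fsbig_finite.
move=> c0 a0; apply/eqP; rewrite eq_le H//=.
have [->|cn0] := eqVneq c 0%R.
  by rewrite mul0e; apply: esum_ge0 => i Ii; rewrite mul0e.
have {cn0} c0 : (0 < c)%R by rewrite lt_def cn0.
have p0 i : 0 <= c%:E * a i by rewrite mule_ge0 ?lee_fin ?(ltW c0) ?a0.
have ci0 : (0 <= c^-1)%R by rewrite invr_ge0 ltW.
have := H c^-1%R (fun i => c%:E * a i) ci0 p0.
under eq_esum => i Ii do rewrite muleA -EFinM mulVf ?gt_eqF// mul1e.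
move=> h.
have c0' : 0 <= c%:E by rewrite lee_fin ltW.
have := lee_wpmul2l c0' h.
by rewrite muleA -EFinM mulfV ?gt_eqF// mul1e.
Qed.

Definition square_weight (R : realType) (q : R) (n : int) : \bar R :=
  (q ^+ (`|n| ^ 2))%:E.

(** An unordered sum in the extended reals, so that lattice sums can be rearranged without
    convergence arguments. *)
Definition theta_part (R : realType) (A : set int) (q : R) : \bar R :=
  \esum_(n in A) square_weight q n.

Definition even_ints : set int := [set n | exists k, n = (2 * k)%R].
Definition odd_ints : set int := [set n | exists k, n = (2 * k + 1)%R].

Lemma square_weight_ge0 (R : realType) (q : R) n : (0 <= q)%R ->
  0 <= square_weight q n.
Proof. by move=> q0; rewrite lee_fin exprn_ge0. Qed.

Lemma theta_part_ge0 (R : realType) (A : set int) (q : R) : (0 <= q)%R ->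
  0 <= theta_part A q.
Proof. by move=> q0; apply: esum_ge0 => n _; exact: square_weight_ge0. Qed.

Lemma theta_part_mul (R : realType) (A B : set int) (q : R) : (0 <= q)%R ->
  theta_part B q \is a fin_num ->
  theta_part A q * theta_part B q =
  \esum_(p in A `*` B) (q ^+ (`|p.1| ^ 2 + `|p.2| ^ 2))%:E.
Proof.
move=> q0 finB.
rewrite (_ : A `*` B = A `*`` (fun=> B)); last by apply/seteqP; split.
rewrite -(@esum_esum _ _ _ A (fun=> B)
  (fun i j => (q ^+ (`|i| ^ 2 + `|j| ^ 2))%:E)); last first.
  by move=> i j _ _; rewrite lee_fin exprn_ge0.
under eq_esum => i _.
  under eq_esum => j _ do rewrite exprD EFinM.
  rewrite esumZ ?exprn_ge0//; last by move=> j; exact: square_weight_ge0.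
  rewrite -/(theta_part B q) muleC -(fineK finB).
  over.
rewrite esumZ; [|by rewrite fine_ge0// theta_part_ge0|by move=> i; exact: square_weight_ge0].
by rewrite fineK// muleC.
Qed.

Lemma even_oddU : even_ints `|` odd_ints = setT.
Proof.
apply/seteqP; split => // n _.
have h := divz_eq n 2.
have h1 : (0 <= n %% 2)%Z%R by apply: modz_ge0.
have h2 : (n %% 2 < 2)%Z%R by apply: ltz_pmod.
have [e|e] : (n %% 2)%Z = 0%R \/ (n %% 2)%Z = 1%R by lia.
  by left; exists (n %/ 2)%Z; lia.
by right; exists (n %/ 2)%Z; lia.
Qed.

Lemma even_oddI n : even_ints n -> odd_ints n -> False.
Proof. by move=> [k ->] [l]; lia. Qed.

Lemma sqr_absz_rotate (u v : int) :
  (`|(u + v)%R| ^ 2 + `|(u - v)%R| ^ 2 = 2 * (`|u| ^ 2 + `|v| ^ 2))%N.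
Proof.
have E (n : int) : (`|n| ^ 2)%N = (n ^+ 2)%R :> int.
  by rewrite -[LHS]natz natrX natz abszE real_normK// num_real.
by apply/eqP; rewrite -eqz_nat PoszM !PoszD !E; apply/eqP; ring.
Qed.

Definition pair_weight (R : realType) (q : R) (p : int * int) : \bar R :=
  (q ^+ (`|p.1| ^ 2 + `|p.2| ^ 2))%:E.

Lemma pair_weight_rotate (R : realType) (q : R) (p : int * int) :
  pair_weight q (p.1 + p.2, p.1 - p.2)%R = pair_weight (q ^+ 2) p.
Proof. by rewrite /pair_weight/= sqr_absz_rotate exprM. Qed.

Lemma pair_weight_ge0 (R : realType) (q : R) p : (0 <= q)%R -> 0 <= pair_weight q p.
Proof. by move=> q0; rewrite lee_fin exprn_ge0. Qed.

(** The rotation (u, v) -> (u + v, u - v) maps the pairs of equal parity bijectively onto the pairs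
    of even integers and doubles u² + v², which turns q into q². *)
Lemma esum_even_even (R : realType) (q : R) : (0 <= q)%R ->
  \esum_(p in even_ints `*` even_ints) pair_weight q p =
  \esum_(p in even_ints `*` even_ints) pair_weight (q ^+ 2) p +
  \esum_(p in odd_ints `*` odd_ints) pair_weight (q ^+ 2) p.
Proof.
move=> q0; have q20 : (0 <= q ^+ 2)%R by exact: sqr_ge0.
pose P := (even_ints `*` even_ints) `|` (odd_ints `*` odd_ints).
rewrite (@reindex_esum _ _ _ P _ (fun p => (p.1 + p.2, p.1 - p.2)%R)); last first.
  split.
  - move=> [u v] /= [[[k /= ->] [l /= ->]]|[[k /= ->] [l /= ->]]]; split => /=.
    + by exists (k + l)%R; ring.
    + by exists (k - l)%R; ring.
    + by exists (k + l + 1)%R; ring.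
    + by exists (k - l)%R; ring.
  - by move=> [u v] [u' v'] _ _ /= [e1 e2]; congr (_, _); lia.
  - move=> [a b] [[k /= ->] [l /= ->]]; exists (k + l, k - l)%R; last first.
      by congr (_, _) => /=; ring.
    have : (even_ints `|` odd_ints) (k + l)%R by rewrite even_oddU.
    move=> [[j hj]|[j hj]]; [left|right]; split => /=.
    + by exists j.
    + by exists (j - l)%R; lia.
    + by exists j.
    + by exists (j - l)%R; lia.
under eq_esum do rewrite pair_weight_rotate.
rewrite (esumID (even_ints `*` even_ints)); last by move=> *; exact: pair_weight_ge0.
congr (_ + _); congr (esum _ _); apply/seteqP; split.
- by move=> p [].
- by move=> p h; split => //; left.
- by move=> [u v] [[]].
- move=> [u v] [/= ho1 ho2]; split; first by right.
  by move=> -[/= he1 _]; exact: even_oddI he1 ho1.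
Qed.

(** The same rotation maps the pairs of opposite parity bijectively onto the pairs of odd
    integers. *)
Lemma esum_odd_odd (R : realType) (q : R) : (0 <= q)%R ->
  \esum_(p in odd_ints `*` odd_ints) pair_weight q p =
  \esum_(p in even_ints `*` odd_ints) pair_weight (q ^+ 2) p +
  \esum_(p in odd_ints `*` even_ints) pair_weight (q ^+ 2) p.
Proof.
move=> q0; have q20 : (0 <= q ^+ 2)%R by exact: sqr_ge0.
pose P := (even_ints `*` odd_ints) `|` (odd_ints `*` even_ints).
rewrite (@reindex_esum _ _ _ P _ (fun p => (p.1 + p.2, p.1 - p.2)%R)); last first.
  split.
  - move=> [u v] /= [[[k /= ->] [l /= ->]]|[[k /= ->] [l /= ->]]]; split => /=.
    + by exists (k + l)%R; ring.
    + by exists (k - l - 1)%R; ring.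
    + by exists (k + l)%R; ring.
    + by exists (k - l)%R; ring.
  - by move=> [u v] [u' v'] _ _ /= [e1 e2]; congr (_, _); lia.
  - move=> [a b] [[k /= ->] [l /= ->]]; exists (k + l + 1, k - l)%R; last first.
      by congr (_, _) => /=; ring.
    have : (even_ints `|` odd_ints) (k + l + 1)%R by rewrite even_oddU.
    move=> [[j hj]|[j hj]]; [left|right]; split => /=.
    + by exists j.
    + by exists (j - l - 1)%R; lia.
    + by exists j.
    + by exists (j - l)%R; lia.
under eq_esum do rewrite pair_weight_rotate.
rewrite (esumID (even_ints `*` odd_ints)); last by move=> *; exact: pair_weight_ge0.
congr (_ + _); congr (esum _ _); apply/seteqP; split.
- by move=> p [].
- by move=> p h; split => //; left.
- by move=> [u v] [[]].
- move=> [u v] [/= ho1 he2]; split; first by right.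
  by move=> -[/= he1 _]; exact: even_oddI he1 ho1.
Qed.

Lemma theta_part_setT (R : realType) (q : R) : (0 <= q)%R ->
  theta_part setT q = theta_part even_ints q + theta_part odd_ints q.
Proof.
move=> q0; rewrite /theta_part (esumID even_ints); last first.
  by move=> *; exact: square_weight_ge0.
congr (_ + _); congr (esum _ _); apply/seteqP; split.
- by move=> p [].
- by move=> p h.
- move=> n [_ ne]; have : (even_ints `|` odd_ints) n by rewrite even_oddU.
  by case.
- by move=> n ho; split => // he; exact: even_oddI he ho.
Qed.

Lemma theta_part_nat (R : realType) (q : R) : (0 <= q)%R ->
  theta_part setT q = \sum_(n <oo) (q ^+ (n ^ 2))%:E + \sum_(n <oo) (q ^+ (n.+1 ^ 2))%:E.
Proof.
move=> q0; rewrite /theta_part (esumID (range Posz)); last first.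
  by move=> *; exact: square_weight_ge0.
congr (_ + _).
  rewrite setTI (@esum_set_image R _ (square_weight q) _ setT); first last.
  - by move=> x y _ _ [].
  - by move=> *; exact: square_weight_ge0.
  by apply: eq_eseriesl => i; rewrite in_setT.
rewrite (_ : _ `&` _ = range Negz); last first.
  apply/seteqP; split => [[n|n] []|n [k _ <-]].
  - by move=> _; case; exists n.
  - by exists n.
  - by split => // -[].
rewrite (@esum_set_image R _ (square_weight q) _ setT); first last.
- by move=> x y _ _ [].
- by move=> *; exact: square_weight_ge0.
by apply: eq_eseriesl => i; rewrite in_setT.
Qed.

Local Close Scope ereal_scope.

(** * Theta values as real numbers *)

Lemma eseries_EFin_lim (R : realType) (u : nat -> R) :
  cvgn (series u) -> (\sum_(n <oo) (u n)%:E = (limn (series u))%:E)%E.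
Proof.
move=> cu; apply/cvg_lim => //.
have -> : (fun n => \sum_(0 <= i < n) (u i)%:E)%E = EFin \o series u.
  by apply/funext => n; rewrite /= /series/= sumEFin.
by apply/cvg_EFin; [exact: nearW|].
Qed.

Lemma cvg_series_square_power (R : realType) (q : R) : 0 <= q < 1 ->
  cvgn (series (fun n => q ^+ (n.+1 ^ 2))).
Proof.
move=> /andP[q0 q1]; apply: (@series_le_cvg _ _ (geometric 1 q)).
- by move=> n; rewrite exprn_ge0.
- by move=> n; rewrite /= mul1r exprn_ge0.
- move=> n; rewrite /= mul1r; apply: ler_wiXn2l => //; first exact: ltW.
  by rewrite -mulnn; apply: (leq_trans (leqnSn n)); exact: leq_pmulr.
- by apply: is_cvg_geometric_series; rewrite ger0_norm.
Qed.

Definition square_series (R : realType) (q : R) : R :=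
  limn (series (fun n => q ^+ (n.+1 ^ 2))).

(** Jacobi's θ_3 at the nome q. *)
Definition theta_real (R : realType) (q : R) : R := 1 + 2 * square_series q.

Lemma theta_part_real (R : realType) (q : R) : 0 <= q < 1 ->
  theta_part setT q = (theta_real q)%:E.
Proof.
move=> q01; have /andP[q0 q1] := q01.
have cS := cvg_series_square_power q01.
have c0 : series (fun n => q ^+ (n ^ 2)) @ \oo --> 1 + square_series q.
  rewrite -cvg_shiftS.
  rewrite (_ : (fun n => _) = fun n => 1 + series (fun n => q ^+ (n.+1 ^ 2)) n).
    by apply: cvgD; [exact: cvg_cst|exact: cS].
  by apply/funext => n; rewrite /series/= big_nat_recl// expr0.
rewrite theta_part_nat// (eseries_EFin_lim cS).
rewrite eseries_EFin_lim; last by apply/cvg_ex; eexists; exact: c0.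
rewrite (cvg_lim _ c0)// -/(square_series q) /theta_real -EFinD.
by congr (_%:E); ring.
Qed.

Lemma square_series_ge0 (R : realType) (q : R) : 0 <= q < 1 -> 0 <= square_series q.
Proof.
move=> q01; have /andP[q0 _] := q01.
apply: limr_ge; first exact: cvg_series_square_power.
by apply: nearW => n; apply: sumr_ge0 => i _; rewrite exprn_ge0.
Qed.

(** In each term one factor q is split off and the remaining power is compared with the power of
    1/2; this gives θ_3(q) = 1 + O(q) with an explicit constant. *)
Lemma square_series_le (R : realType) (q : R) : 0 <= q <= 1 / 2 ->
  square_series q <= 2 * q * square_series (1 / 2).
Proof.
move=> /andP[q0 q1].
have h1 : cvgn (series (fun n => q ^+ (n.+1 ^ 2))).
  by apply: cvg_series_square_power; rewrite q0; lra.
have h2 : cvgn (series (fun n => (1 / 2 : R) ^+ (n.+1 ^ 2))).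
  by apply: cvg_series_square_power; lra.
have h3 : (2 * q * series (fun n => (1 / 2 : R) ^+ (n.+1 ^ 2)) n) @[n --> \oo] -->
    2 * q * square_series (1 / 2) by apply: cvgM; [exact: cvg_cst|exact: h2].
rewrite -(cvg_lim _ h3)//; apply: ler_lim => //.
  by apply/cvg_ex; eexists; exact: h3.
apply: nearW => n; rewrite /series/= mulr_sumr; apply: ler_sum => k _.
rewrite -(prednK (n := k.+1 ^ 2)) ?expn_gt0// !exprS.
rewrite (_ : 2 * q * _ = q * (1 / 2) ^+ (k.+1 ^ 2).-1); last by field.
by apply: ler_wpM2l => //; rewrite lerXn2r// nnegrE; lra.
Qed.

(** In classical notation [theta_even] is θ_3(q⁴) and [theta_odd] is θ_2(q⁴); their sum is θ_3(q)
    and their difference θ_4(q). *)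
Definition theta_even (R : realType) (q : R) : R := fine (theta_part even_ints q).
Definition theta_odd (R : realType) (q : R) : R := fine (theta_part odd_ints q).

Lemma theta_part_fin (R : realType) (A : set int) (q : R) : 0 <= q < 1 ->
  theta_part A q \is a fin_num.
Proof.
move=> q01; have /andP[q0 q1] := q01.
rewrite ge0_fin_numE ?theta_part_ge0//.
apply: (@le_lt_trans _ _ (theta_part setT q)); last by rewrite theta_part_real ?ltry.
rewrite /theta_part esum_mkcond; apply: le_esum => n _.
by case: ifP => // _; exact: square_weight_ge0.
Qed.

Lemma theta_realE (R : realType) (q : R) : 0 <= q < 1 ->
  theta_real q = theta_even q + theta_odd q.
Proof.
move=> q01; have /andP[q0 q1] := q01.
have := theta_part_setT q0; rewrite theta_part_real// /theta_even /theta_odd.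
by rewrite -fineD ?theta_part_fin// => <-.
Qed.

Lemma fine_theta_part_mul (R : realType) (A B : set int) (q : R) : 0 <= q < 1 ->
  (\esum_(p in A `*` B) pair_weight q p =
  (fine (theta_part A q) * fine (theta_part B q))%:E)%E.
Proof.
move=> q01; have /andP[q0 q1] := q01.
by rewrite EFinM !fineK ?theta_part_fin// theta_part_mul// theta_part_fin.
Qed.

(** Together with [theta_odd_square] this is one step of Gauss's arithmetic-geometric mean: θ_3(q²)²
    is the arithmetic mean of θ_3(q)² and θ_4(q)², and θ_4(q²)² their geometric mean. *)
Lemma theta_even_square (R : realType) (q : R) : 0 <= q < 1 ->
  theta_even q ^+ 2 = theta_even (q ^+ 2) ^+ 2 + theta_odd (q ^+ 2) ^+ 2.
Proof.
move=> q01; have /andP[q0 q1] := q01.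
have q2 : 0 <= q ^+ 2 < 1 by rewrite sqr_ge0 exprn_ilt1.
have := esum_even_even q0; rewrite !fine_theta_part_mul// -EFinD => -[].
by rewrite -!expr2.
Qed.

Lemma theta_odd_square (R : realType) (q : R) : 0 <= q < 1 ->
  theta_odd q ^+ 2 = 2 * theta_even (q ^+ 2) * theta_odd (q ^+ 2).
Proof.
move=> q01; have /andP[q0 q1] := q01.
have q2 : 0 <= q ^+ 2 < 1 by rewrite sqr_ge0 exprn_ilt1.
have := esum_odd_odd q0; rewrite !fine_theta_part_mul// -EFinD => -[].
by rewrite -!expr2 => ->; rewrite /theta_even /theta_odd; ring.
Qed.

Lemma theta_even_ge1 (R : realType) (q : R) : 0 <= q < 1 -> 1 <= theta_even q.
Proof.
move=> q01; have /andP[q0 q1] := q01.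
rewrite -lee_fin fineK ?theta_part_fin//.
apply: esum_ge; exists [set 0]; first by split => //; move=> n ->; exists 0.
by rewrite fsbig_set1 /square_weight absz0 expr0.
Qed.

Lemma theta_odd_ge (R : realType) (q : R) : 0 <= q < 1 -> 2 * q <= theta_odd q.
Proof.
move=> q01; have /andP[q0 q1] := q01.
rewrite -lee_fin fineK ?theta_part_fin//.
apply: esum_ge; exists ([set 1] `|` [set -1]).
  split; first by rewrite finite_setU; split.
  by move=> n [->|->]; [exists 0|exists (-1)].
rewrite fsbigU//=; last by move=> n [-> ].
rewrite !fsbig_set1 /square_weight /= expr1 -EFinD lee_fin; lra.
Qed.

Lemma theta_real_ge1 (R : realType) (q : R) : 0 <= q < 1 -> 1 <= theta_real q.
Proof. by move=> q01; rewrite lerDl mulr_ge0// square_series_ge0. Qed.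

Lemma theta_real_le (R : realType) (q : R) : 0 <= q <= 1 / 2 ->
  theta_real q <= 1 + 4 * square_series (1 / 2) * q.
Proof. by move=> /square_series_le h; rewrite /theta_real; lra. Qed.

Lemma theta_odd_le (R : realType) (q : R) : 0 <= q <= 1 / 2 ->
  theta_odd q <= 4 * square_series (1 / 2) * q.
Proof.
move=> q01; have := theta_real_le q01.
have q01' : 0 <= q < 1 by case/andP: q01 => -> ?; lra.
by rewrite (theta_realE q01'); have := theta_even_ge1 q01'; lra.
Qed.

Lemma square_series_half_ge (R : realType) : 1 / 2 <= square_series (1 / 2 : R).
Proof.
have h : 0 <= (1 / 2 : R) < 1 by lra.
have := @theta_odd_ge R (1 / 2) h; have := @theta_even_ge1 R (1 / 2) h.
by have := theta_realE h; rewrite /theta_real; lra.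
Qed.

Lemma near_iterated_square (R : realType) (q d : R) : 0 < q < 1 -> 0 < d ->
  exists N, forall n, (N <= n)%N -> 0 < q ^+ (2 ^ n) < d.
Proof.
move=> /andP[q0 q1] d0.
have : geometric 1 q @ \oo --> (0 : R) by apply: cvg_geometric; rewrite ger0_norm ?ltW.
move=> /cvgr0Pnorm_lt /(_ d d0)[N _ hN]; exists N => n Nn.
rewrite exprn_gt0//=; have := hN n Nn.
rewrite /= mul1r ger0_norm ?exprn_ge0 ?(ltW q0)//; apply: le_lt_trans.
by apply: ler_wiXn2l; rewrite ?(ltW q0) ?(ltW q1)// ltnW// ltn_expl.
Qed.

Lemma iterated_square01 (R : realType) (q : R) n : 0 < q < 1 -> 0 < q ^+ (2 ^ n) < 1.
Proof.
by move=> /andP[q0 q1]; rewrite exprn_gt0//= exprn_ilt1 ?(ltW q0)// -lt0n expn_gt0.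
Qed.

Lemma iterated_squareS (R : realType) (q : R) n :
  q ^+ (2 ^ n.+1) = (q ^+ (2 ^ n)) ^+ 2.
Proof. by rewrite -exprM expnSr. Qed.

(** For small arguments the even part is at least 1 and the odd part is O(q). The inequality then
    descends from q² to q, because the difference of the squares at q is the square of the
    difference at q². *)
Lemma theta_odd_lt_even (R : realType) (q : R) : 0 < q < 1 ->
  theta_odd q < theta_even q.
Proof.
move=> q01.
pose C : R := 4 * square_series (1 / 2).
have C0 : 0 < C by rewrite mulr_gt0//; have := square_series_half_ge R; lra.
have d0 : 0 < Num.min (1 / 2) C^-1 by rewrite lt_min divr_gt0// invr_gt0.
have [N hN] := near_iterated_square q01 d0.
have {hN} : theta_odd (q ^+ (2 ^ N)) < theta_even (q ^+ (2 ^ N)).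
  have /andP[x0] := hN N (leqnn N); set x := q ^+ _ in x0 *.
  rewrite lt_min => /andP[x1 x2].
  have x01 : 0 <= x < 1 by rewrite ltW//=; lra.
  have x12 : 0 <= x <= 1 / 2 by rewrite !ltW.
  apply: lt_le_trans (theta_even_ge1 x01); apply: le_lt_trans (theta_odd_le x12) _.
  by rewrite -/C mulrC -ltr_pdivlMr// mul1r.
elim: N => [|N IH]; first by rewrite expn0 expr1.
rewrite iterated_squareS => h; apply: IH; move: h.
have := iterated_square01 N q01; move: (q ^+ (2 ^ N)) => x /andP[x0 x1] h.
have x01 : 0 <= x < 1 by rewrite ltW.
have e1 := theta_even_ge1 x01.
have o0 : 0 <= theta_odd x by apply: le_trans (theta_odd_ge x01); rewrite mulr_ge0// ltW.
have es := theta_even_square x01; have os := theta_odd_square x01.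
rewrite -(@ltr_pXn2r _ 2) ?nnegrE//; last by rewrite (le_trans _ e1).
rewrite es os -subr_gt0.
have -> : forall E O : R, E ^+ 2 + O ^+ 2 - 2 * E * O = (E - O) ^+ 2 by move=> *; ring.
by rewrite exprn_gt0// subr_gt0.
Qed.

(** * The modulus as a function of the nome, and Jacobi's identity *)

(** The complementary modulus k' = (θ_4/θ_3)² at the nome q. *)
Definition compl_modulus (R : realType) (q : R) : R :=
  ((theta_even q - theta_odd q) / (theta_even q + theta_odd q)) ^+ 2.

(** The elliptic parameter m = k² = 1 - k'² at the nome q, rather than k itself. *)
Definition modulus (R : realType) (q : R) : R := 1 - compl_modulus q ^+ 2.

Lemma theta_parts (R : realType) (q : R) : 0 < q < 1 ->
  [/\ 0 < theta_odd q, theta_odd q < theta_even q & 0 <= q < 1].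
Proof.
move=> q01; have /andP[q0 q1] := q01.
have q01' : 0 <= q < 1 by rewrite ltW.
split=> //; last exact: theta_odd_lt_even.
by apply: lt_le_trans (theta_odd_ge q01'); rewrite mulr_gt0.
Qed.

Lemma compl_modulus01 (R : realType) (q : R) : 0 < q < 1 -> 0 < compl_modulus q < 1.
Proof.
move=> /theta_parts[ o0 oe _]; rewrite /compl_modulus.
have s0 : 0 < theta_even q + theta_odd q by rewrite addr_gt0// (lt_trans o0).
have x0 : 0 < (theta_even q - theta_odd q) / (theta_even q + theta_odd q).
  by rewrite divr_gt0// subr_gt0.
have x1 : (theta_even q - theta_odd q) / (theta_even q + theta_odd q) < 1.
  by rewrite ltr_pdivrMr// mul1r; lra.
by rewrite exprn_gt0//= exprn_ilt1// ltW.
Qed.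

Lemma modulus01 (R : realType) (q : R) : 0 < q < 1 -> 0 < modulus q < 1.
Proof.
by move=> /compl_modulus01/andP[p0 p1]; rewrite /modulus; apply/andP; split; nra.
Qed.

(** Under the duplication formulas, squaring the nome is Landen's map: the new k is (1 - k') / (1 +
    k'). *)
Lemma modulus_square (R : realType) (q : R) : 0 < q < 1 ->
  modulus (q ^+ 2) = ((1 - compl_modulus q) / (1 + compl_modulus q)) ^+ 2.
Proof.
move=> q01; have [ o0 oe q01'] := theta_parts q01.
have q2 : 0 < q ^+ 2 < 1 by have := iterated_square01 1 q01.
have [ o20 oe2 _] := theta_parts q2.
have := theta_even_square q01'; have := theta_odd_square q01'.
rewrite /modulus /compl_modulus.
move: (theta_even q) (theta_odd q) (theta_even (q ^+ 2)) (theta_odd (q ^+ 2)) o0 oe o20 oe2.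
move=> e o e2 o2 o0 oe o20 oe2 ho he.
have e0 : 0 < e := lt_trans o0 oe.
have n1 : e + o != 0 by rewrite gt_eqF// addr_gt0.
have e20 : 0 < e2 := lt_trans o20 oe2.
have n2 : e2 + o2 != 0 by rewrite gt_eqF// addr_gt0.
have h1 : ((e2 - o2) / (e2 + o2)) ^+ 2 = (e ^+ 2 - o ^+ 2) / (e ^+ 2 + o ^+ 2).
  have n3 : e2 ^+ 2 + o2 ^+ 2 + 2 * e2 * o2 != 0.
    by rewrite (_ : _ + _ = (e2 + o2) ^+ 2) ?expf_neq0//; ring.
  by rewrite he ho; field; rewrite n2 n3.
have s0 : 0 < e ^+ 2 + o ^+ 2 by rewrite addr_gt0// exprn_gt0.
have n4 : (e + o) ^+ 2 + (e - o) ^+ 2 != 0.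
  by rewrite gt_eqF// ltr_wpDr ?sqr_ge0// exprn_gt0// addr_gt0.
by rewrite h1; field; rewrite n1 n4 gt_eqF.
Qed.

(** Landen's factor 2 / (1 + k') is θ_3(q)² / θ_3(q²)², so K/θ_3² takes the same value at q and
    q². *)
Lemma ellipticK_theta_step (R : realType) (q : R) : 0 < q < 1 ->
  ellipticK (modulus q) / theta_real q ^+ 2 =
  ellipticK (modulus (q ^+ 2)) / theta_real (q ^+ 2) ^+ 2.
Proof.
move=> q01; have [ o0 oe q01'] := theta_parts q01.
have q2 : 0 < q ^+ 2 < 1 by have := iterated_square01 1 q01.
have [ o20 oe2 q2'] := theta_parts q2.
rewrite modulus_square// {1}/modulus landen_transformation ?compl_modulus01//.
rewrite !theta_realE//.
have := theta_even_square q01'; have := theta_odd_square q01'.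
move: (ellipticK _) => K.
rewrite /compl_modulus.
move: (theta_even q) (theta_odd q) (theta_even (q ^+ 2)) (theta_odd (q ^+ 2)) o0 oe o20 oe2.
move=> e o e2 o2 o0 oe o20 oe2 ho he.
have e0 : 0 < e := lt_trans o0 oe.
have n1 : e + o != 0 by rewrite gt_eqF// addr_gt0.
have e20 : 0 < e2 := lt_trans o20 oe2.
have n2 : e2 + o2 != 0 by rewrite gt_eqF// addr_gt0.
have s0 : 0 < e ^+ 2 + o ^+ 2 by rewrite addr_gt0// exprn_gt0.
have -> : (e2 + o2) ^+ 2 = e ^+ 2 + o ^+ 2 by rewrite he ho; ring.
have n4 : (e + o) ^+ 2 + (e - o) ^+ 2 != 0.
  by rewrite gt_eqF// ltr_wpDr ?sqr_ge0// exprn_gt0// addr_gt0.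
by field; rewrite n1 n4 gt_eqF.
Qed.

(** Landen's transformation is used at p = k' and at k = (1 - p) / (1 + p). The map p -> (1 - p) /
    (1 + p) is an involution, so one use transforms the numerator of the ratio and the other its
    denominator; the factors combine to 2. *)
Lemma K_ratio_modulus_square (R : realType) (q : R) : 0 < q < 1 ->
  K_ratio (modulus (q ^+ 2)) = 2 * K_ratio (modulus q).
Proof.
move=> q01; have /andP[p0 p1] := compl_modulus01 q01.
rewrite /K_ratio modulus_square// /modulus.
set p := compl_modulus q in p0 p1 *; set k := (1 - p) / (1 + p).
have p10 : 1 + p != 0 by rewrite gt_eqF// addr_gt0.
have k01 : 0 < k < 1.
  rewrite divr_gt0 ?subr_gt0 ?addr_gt0//= ltr_pdivrMr ?addr_gt0// mul1r.
  by lra.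
have kp : (1 - k) / (1 + k) = p.
  by rewrite /k; field; rewrite p10 (_ : _ + _ = 2) ?pnatr_eq0//; ring.
have Kn : ellipticK (k ^+ 2) != 0.
  rewrite gt_eqF// ellipticK_gt0// sqr_ge0/=.
  by case/andP: k01 => k0 k1; rewrite exprn_ilt1// ltW.
rewrite (@landen_transformation _ k)// kp subKr.
rewrite (@landen_transformation _ p) ?p0// -/k.
have k1n : 1 + k != 0 by rewrite gt_eqF// addr_gt0//; case/andP: k01.
have -> : 2 / (1 + k) = 1 + p.
  by rewrite /k; field; rewrite p10 (_ : _ + _ = 2) ?pnatr_eq0//; ring.
by field; rewrite p10 Kn.
Qed.

Lemma ellipticK_theta_iter (R : realType) (q : R) n : 0 < q < 1 ->
  ellipticK (modulus q) / theta_real q ^+ 2 =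
  ellipticK (modulus (q ^+ (2 ^ n))) / theta_real (q ^+ (2 ^ n)) ^+ 2.
Proof.
move=> q01; elim: n => [|n IH]; first by rewrite expn0 expr1.
by rewrite IH ellipticK_theta_step ?iterated_square01// iterated_squareS.
Qed.

Lemma K_ratio_iter (R : realType) (q : R) n : 0 < q < 1 ->
  K_ratio (modulus (q ^+ (2 ^ n))) = 2 ^+ n * K_ratio (modulus q).
Proof.
move=> q01; elim: n => [|n IH]; first by rewrite expn0 expr1 expr0 mul1r.
by rewrite iterated_squareS K_ratio_modulus_square ?iterated_square01// IH mulrA exprS.
Qed.

Lemma le_drv_ge0 (R : realType) (F f : R -> R) (x y : R) : x <= y ->
  (forall z, x <= z <= y -> is_derive z 1 F (f z)) ->
  (forall z, x <= z <= y -> 0 <= f z) -> F x <= F y.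
Proof.
rewrite le_eqVlt => /predU1P[->//|xy] dF f0.
have d z : z \in `]x, y[ -> is_derive z 1 F (f z).
  by rewrite in_itv/= => /andP[xz zy]; apply: dF; rewrite !ltW.
have [|z] := @MVT R F f x y xy d.
  by apply: within_continuous_itv => z hz; exact: drv_continuous (dF z hz).
rewrite in_itv/= => /andP[xz zy] e.
rewrite -subr_ge0 e mulr_ge0 ?subr_ge0 ?(ltW xy)//.
by apply: f0; rewrite !ltW.
Qed.

Lemma K_ratio_half (R : realType) : K_ratio (1 / 2 : R) = 1.
Proof.
rewrite /K_ratio (_ : 1 - 1 / 2 = 1 / 2 :> R); last by field.
by rewrite divff// gt_eqF// ellipticK_gt0//; lra.
Qed.

(** This says π K'/K = - ln m + O(1) as m tends to 0. Since (1-z) K² <= (π/2)², the function π K'/K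
    + ln z is nonincreasing; since K >= π/2, adding - ln (1-z) makes it nondecreasing. Both are
    compared with m = 1/2, where K'/K = 1. *)
Lemma K_ratio_log (R : realType) (m : R) : 0 < m <= 1 / 2 ->
  - ln 2 <= pi * (K_ratio m - 1) + ln m <= 0.
Proof.
move=> /andP[m0 m12].
have p0 : 0 < pi :> R := pi_gt0 R.
have l2 : ln (1 / 2 : R) = - ln 2 by rewrite mul1r lnV// posrE.
have z0 (z : R) : m <= z <= 1 / 2 -> [/\ 0 < z, z < 1 & 0 < z < 1].
  by move=> /andP[mz z1]; rewrite (lt_le_trans m0 mz); split => //; lra.
apply/andP; split.
  pose F (z : R) := - (pi * (K_ratio z - 1) + ln z).
  pose f (z : R) := - (pi * (- pi / (4 * z * (1 - z) * ellipticK z ^+ 2)) + 1 / z).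
  have dF z : m <= z <= 1 / 2 -> is_derive z 1 F (f z).
    move=> /z0[zz z1 z01]; apply: (drv_eq (drvN (drvD
      (drvZ pi (drvB (drv_K_ratio z01) (drv_cst 1 z))) (drv_ln (drv_id z) zz)))).
    by rewrite subr0.
  have := le_drv_ge0 m12 dF; rewrite {2}/F K_ratio_half subrr mulr0 add0r l2 opprK.
  rewrite {1}/F lerNl; apply => z /z0[zz z1 z01].
  have zc : 0 <= z < 1 by rewrite ltW.
  have K0 := ellipticK_gt0 zc; have K1 := ellipticK_le zc.
  have s0 : 0 < Num.sqrt (1 - z) by rewrite sqrtr_gt0 subr_gt0.
  have s2 : Num.sqrt (1 - z) ^+ 2 = 1 - z by rewrite sqr_sqrtr// subr_ge0 ltW.
  rewrite ler_pdivlMr// in K1.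
  have K2 : ellipticK z ^+ 2 * (1 - z) <= (pi / 2) ^+ 2.
    rewrite -s2 -exprMn lerXn2r// nnegrE.
      by rewrite mulr_ge0// ltW.
    by rewrite ltW// pi2_gt0.
  have z1' : 0 < 1 - z by rewrite subr_gt0.
  have -> : f z = pi ^+ 2 / (4 * z * (1 - z) * ellipticK z ^+ 2) - 1 / z.
    by rewrite /f; field; rewrite !gt_eqF.
  rewrite subr_ge0 ler_pdivlMr; last first.
    by rewrite !mulr_gt0 ?exprn_gt0// subr_gt0.
  rewrite (_ : _ * _ = 4 * (ellipticK z ^+ 2 * (1 - z))); last by field; rewrite gt_eqF.
  by rewrite (_ : pi ^+ 2 = 4 * (pi / 2) ^+ 2); [rewrite ler_pM2l|field].
pose F (z : R) := pi * (K_ratio z - 1) + ln z - ln (1 - z).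
pose f (z : R) := pi * (- pi / (4 * z * (1 - z) * ellipticK z ^+ 2)) + 1 / z + 1 / (1 - z).
have dF z : m <= z <= 1 / 2 -> is_derive z 1 F (f z).
  move=> /z0[zz z1 z01]; have z1' : 0 < 1 - z by rewrite subr_gt0.
  apply: (drv_eq (drvB (drvD (drvZ pi (drvB (drv_K_ratio z01) (drv_cst 1 z)))
    (drv_ln (drv_id z) zz)) (drv_ln (drvB (drv_cst 1 z) (drv_id z)) z1'))).
  by rewrite /f subr0 sub0r (mulNr 1) opprK.
have := le_drv_ge0 m12 dF; rewrite {2}/F K_ratio_half subrr mulr0 add0r.
rewrite (_ : 1 - 1 / 2 = 1 / 2 :> R); last by field.
rewrite subrr /F => h.
have : pi * (K_ratio m - 1) + ln m - ln (1 - m) <= 0.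
  apply: h => z /z0[zz z1 z01].
  have zc : 0 <= z < 1 by rewrite ltW.
  have K0 := ellipticK_gt0 zc; have K1 := ellipticK_ge zc.
  have K2 : (pi / 2) ^+ 2 <= ellipticK z ^+ 2.
    by rewrite lerXn2r// nnegrE ltW// pi2_gt0.
  have z1' : 0 < 1 - z by rewrite subr_gt0.
  rewrite /f (_ : _ + _ = (ellipticK z ^+ 2 - (pi / 2) ^+ 2) / (z * (1 - z) * ellipticK z ^+ 2)).
    by rewrite divr_ge0 ?subr_ge0// !mulr_ge0 ?exprn_ge0// ltW.
  by field; rewrite !gt_eqF.
have : ln (1 - m) <= 0 by apply: ln_le0; rewrite gerBl ltW.
lra.
Qed.

(** With e and o the even and odd parts, the parameter is 8 e o (e² + o²) / (e + o)⁴. Here o is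
    comparable to q, and e and e + o stay between positive constants. *)
Lemma modulus_log_bound (R : realType) : exists2 C : R, 1 <= C &
  forall q : R, 0 < q <= 1 / 2 -> q / C <= modulus q <= C * q.
Proof.
pose S : R := square_series (1 / 2).
have S1 : 1 / 2 <= S := square_series_half_ge R.
pose A := 1 + 2 * S; have A1 : 1 <= A by rewrite /A; lra.
have A4 : 1 <= A ^+ 4 by rewrite exprn_ege1.
exists (16 * A ^+ 4); first by lra.
move=> q /andP[q0 q12].
have q01 : 0 < q < 1 by rewrite q0; lra.
have [ o0 oe q01'] := theta_parts q01.
have q12' : 0 <= q <= 1 / 2 by rewrite ltW.
have e1 := theta_even_ge1 q01'.
have o1 := theta_odd_ge q01'.
have o2 := theta_odd_le q12'.
have t1 := theta_real_le q12'; rewrite (theta_realE q01') -/S in t1 o2.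
have t2 : theta_even q + theta_odd q <= A by rewrite /A; nra.
have o3 : theta_odd q <= 2 * A * q by rewrite /A; nra.
rewrite /modulus /compl_modulus.
move: (theta_even q) (theta_odd q) o0 oe e1 o1 t2 o3 {t1 o2} => e o o0 oe e1 o1 t2 o3.
have e0 : 0 < e by lra.
have s0 : 0 < e + o by lra.
have -> : 1 - (((e - o) / (e + o)) ^+ 2) ^+ 2 =
    8 * e * o * (e ^+ 2 + o ^+ 2) / (e + o) ^+ 4 by field; rewrite gt_eqF.
have s4 : 0 < (e + o) ^+ 4 by rewrite exprn_gt0.
have s41 : 1 <= (e + o) ^+ 4 by rewrite exprn_ege1//; lra.
have s4A : (e + o) ^+ 4 <= A ^+ 4 by rewrite lerXn2r// nnegrE; lra.
have eo0 : 0 <= e * o by rewrite mulr_ge0 ?ltW.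
have sq1 : 1 <= e ^+ 2 + o ^+ 2 by nra.
have sqA : e ^+ 2 + o ^+ 2 <= A ^+ 2 by nra.
have q0' : 0 <= q by exact: ltW.
apply/andP; split.
  rewrite ler_pdivrMr; last by lra.
  rewrite mulrAC ler_pdivlMr//.
  apply: (@le_trans _ _ (q * A ^+ 4)); first by apply: ler_wpM2l.
  rewrite [leRHS]mulrA; apply: ler_wpM2r; first by lra.
  have h1 : 2 * q <= e * o by nra.
  have h2 : 2 * q <= e * o * (e ^+ 2 + o ^+ 2) by nra.
  lra.
rewrite ler_pdivrMr//.
have h1 : e * o <= A * (2 * A * q) by apply: ler_pM; lra.
have h2 : e * o * (e ^+ 2 + o ^+ 2) <= A * (2 * A * q) * A ^+ 2.
  by apply: ler_pM => //; lra.
have h3 : 8 * e * o * (e ^+ 2 + o ^+ 2) <= 16 * A ^+ 4 * q.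
  rewrite (_ : 16 * A ^+ 4 * q = 8 * (A * (2 * A * q) * A ^+ 2)); last by ring.
  by rewrite -!mulrA in h2 *; lra.
apply: (le_trans h3); rewrite ler_peMr// mulr_ge0//; lra.
Qed.

(** The quantity π K'/K + ln q doubles when q is squared, yet by [K_ratio_log] and
    [modulus_log_bound] it stays bounded as q^(2^n) tends to 0; hence it is 0. *)
Lemma K_ratio_modulus (R : realType) (q : R) : 0 < q < 1 ->
  pi * K_ratio (modulus q) = - ln q.
Proof.
move=> q01; have /andP[q0 q1] := q01.
have [C C1 hC] := modulus_log_bound R.
have C0 : 0 < C by lra.
pose B := ln 2 + pi + ln C : R.
have p0 : 0 < pi :> R := pi_gt0 R.
have l2 : 0 <= ln 2 :> R by rewrite ln_ge0// ler1n.
have lC : 0 <= ln C by rewrite ln_ge0.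
have B0 : 0 <= B by rewrite /B; lra.
have bnd (x : R) : 0 < x < Num.min (1 / 2) (1 / (2 * C)) ->
    `|pi * K_ratio (modulus x) + ln x| <= B.
  move=> /andP[x0]; rewrite lt_min => /andP[x12 xC].
  have x01 : 0 < x <= 1 / 2 by rewrite x0 ltW.
  have /andP[m1 m2] := hC x x01.
  have x1 : 0 < x < 1 by rewrite x0; lra.
  have /andP[m0 _] := modulus01 x1.
  have mh : modulus x <= 1 / 2.
    apply: (le_trans m2); rewrite mulrC; apply: ltW.
    by move: xC; rewrite ltr_pdivlMr ?mulr_gt0//; lra.
  have := @K_ratio_log R (modulus x); rewrite m0 mh => /(_ isT)/andP[h1 h2].
  have l1 : ln (modulus x) <= ln C + ln x.
    by rewrite -lnM ?posrE// ler_ln ?posrE// mulr_gt0.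
  have l3 : ln x - ln C <= ln (modulus x).
    by rewrite -ln_div ?posrE// ler_ln ?posrE// divr_gt0.
  by rewrite ler_norml /B; apply/andP; split; lra.
have d0 : 0 < Num.min (1 / 2) (1 / (2 * C)) :> R.
  by rewrite lt_min !divr_gt0// mulr_gt0.
have [N hN] := near_iterated_square q01 d0.
suff : pi * K_ratio (modulus q) + ln q = 0 by move/eqP; rewrite addr_eq0 => /eqP.
apply: (@small_linear_eq0 _ _ B) => e /andP[e0 e12].
have : geometric 1 (2^-1) @ \oo --> (0 : R).
  by apply: cvg_geometric; rewrite ger0_norm ?invr_ge0// invf_lt1// ltr1n.
move=> /cvgr0Pnorm_lt /(_ e e0)[M _ hM].
set n := maxn N M.
have /bnd := hN n (leq_maxl _ _).
rewrite K_ratio_iter// lnXn// -[ln q *+ _]mulr_natl natrX.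
have -> : pi * (2 ^+ n * K_ratio (modulus q)) + 2 ^+ n * ln q =
  2 ^+ n * (pi * K_ratio (modulus q) + ln q) :> R by ring.
have p2 : 0 < 2 ^+ n :> R by rewrite exprn_gt0.
rewrite normrM (ger0_norm (ltW p2)) -ler_pdivlMl// => h.
apply: (le_trans h); rewrite ler_wpM2r//.
have := hM n (leq_maxr _ _); rewrite /= mul1r exprVn ger0_norm ?invr_ge0 ?(ltW p2)//.
exact: ltW.
Qed.

(** K/θ_3² is constant along q^(2^n), and as the nome tends to 0, K tends to π/2 and θ_3 to 1. *)
Lemma ellipticK_modulus (R : realType) (q : R) : 0 < q < 1 ->
  ellipticK (modulus q) = pi / 2 * theta_real q ^+ 2.
Proof.
move=> q01; have /andP[q0 q1] := q01.
have q01' : 0 <= q < 1 by rewrite ltW.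
have t1 := theta_real_ge1 q01'.
suff h : ellipticK (modulus q) / theta_real q ^+ 2 = pi / 2.
  by rewrite -h divfK// expf_neq0// gt_eqF//; lra.
apply/eqP; rewrite -subr_eq0; apply/eqP.
have [C C1 hC] := modulus_log_bound R.
pose S : R := square_series (1 / 2).
have S1 : 1 / 2 <= S := square_series_half_ge R.
pose P : R := pi / 2; have P0 : 0 < P := pi2_gt0 R.
(* The part 2C bounds the excess of K over π/2, as the parameter is at most C x; the part 8S bounds
   the loss from dividing by θ_3², as θ_3 is at most 1 + 4 S x. *)
apply: (@small_linear_eq0 _ _ (P * (2 * C + 8 * S))) => e /andP[e0 e12].
have d0 : 0 < Num.min e (1 / (2 * C)) :> R.
  by rewrite lt_min e0 divr_gt0// mulr_gt0//; lra.
have [N hN] := near_iterated_square q01 d0.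
have := hN N (leqnn N).
rewrite (ellipticK_theta_iter N q01); move: (q ^+ (2 ^ N)) => x /andP[x0].
rewrite lt_min => /andP[xe xC].
have x01 : 0 < x <= 1 / 2 by rewrite x0; lra.
have /andP[m1 m2] := hC x x01.
have x1 : 0 < x < 1 by rewrite x0; lra.
have /andP[m0 _] := modulus01 x1.
have mh : modulus x <= 1 / 2.
  apply: (le_trans m2); rewrite mulrC; apply: ltW.
  by move: xC; rewrite ltr_pdivlMr ?mulr_gt0//; lra.
have mc : 0 <= modulus x < 1 by rewrite ltW//; lra.
have K1 := ellipticK_ge mc.
have K2 : ellipticK (modulus x) <= P * (1 + 2 * modulus x).
  apply: le_trans (ellipticK_le mc) _; rewrite -/P ler_pdivrMr; last first.
    by rewrite sqrtr_gt0; lra.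
  rewrite -mulrA ler_peMr ?(ltW P0)//.
  have s1 : 1 - modulus x <= Num.sqrt (1 - modulus x).
    rewrite -[leLHS]ger0_norm; last by lra.
    by rewrite -sqrtr_sqr ler_wsqrtr//; nra.
  by apply: (@le_trans _ _ ((1 + 2 * modulus x) * (1 - modulus x))); [nra|apply: ler_wpM2l; lra].
have x01'' : 0 <= x <= 1 / 2 by case/andP: x01 => /ltW -> ->.
have x01' : 0 <= x < 1 by rewrite ltW//; lra.
have t3 := theta_real_le x01''; have t2 := theta_real_ge1 x01'.
rewrite -/S in t3; rewrite -/P in K1 *.
move: (ellipticK (modulus x)) K1 K2 => K K1 K2.
move: (theta_real x) (modulus x) m0 mh m1 m2 K2 t2 t3 {mc}.
move=> t m m0 mh m1 m2 K2 t2 t3.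
have t0 : 0 < t ^+ 2 by rewrite exprn_gt0//; lra.
have t21 : 1 <= t ^+ 2 by rewrite exprn_ege1.
have PC : 0 <= P * (2 * C) * e.
  by apply: mulr_ge0; [apply: mulr_ge0; [exact: ltW|lra]|exact: ltW].
have PS : 0 <= P * (8 * S) * e.
  by apply: mulr_ge0; [apply: mulr_ge0; [exact: ltW|lra]|exact: ltW].
have h1 : K / t ^+ 2 - P <= P * (2 * C) * e.
  rewrite lerBlDr ler_pdivrMr//.
  have a1 : K <= P * (2 * C) * e + P.
    apply: (le_trans K2); rewrite mulrDr mulr1 addrC lerD2r -[P * _ * e]mulrA.
    have Cx : C * x <= C * e by apply: ler_wpM2l; lra.
    by apply: ler_wpM2l; [exact: ltW|lra].
  apply: (le_trans a1); rewrite ler_peMr//.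
  by rewrite addr_ge0 ?(ltW P0).
have h2 : - (P * (8 * S) * e) <= K / t ^+ 2 - P.
  rewrite lerBrDr ler_pdivlMr//; apply: le_trans K1.
  have Sx : 4 * S * x <= 4 * S * e by apply: ler_wpM2l; lra.
  set y := 4 * S * e in Sx.
  have y0 : 0 <= y by rewrite /y; nra.
  have ty : t <= 1 + y by lra.
  have -> : - (P * (8 * S) * e) + P = P * (1 - 2 * y) by rewrite /y; ring.
  rewrite -mulrA ler_piMr ?(ltW P0)//.
  have [y1|y1] := lerP (1 - 2 * y) 0.
    by apply: (@le_trans _ _ 0) => //; rewrite mulr_le0_ge0// ltW.
  apply: (@le_trans _ _ ((1 - 2 * y) * (1 + y) ^+ 2)).
    by apply: ler_wpM2l; [exact: ltW|rewrite lerXn2r// nnegrE; lra].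
  nra.
rewrite (_ : e * _ = P * (2 * C) * e + P * (8 * S) * e); last by ring.
by rewrite ler_norml; apply/andP; split; lra.
Qed.

(** Both parameters have the same K'/K by [K_ratio_modulus], and K'/K is strictly decreasing, hence
    injective. *)
Lemma modulus_nome (R : realType) (m : R) : 0 < m < 1 ->
  modulus (expR (- (pi * K_ratio m))) = m.
Proof.
move=> m01; have T0 := K_ratio_gt0 m01.
have p0 : 0 < pi :> R := pi_gt0 R.
have q01 : 0 < expR (- (pi * K_ratio m)) < 1.
  by rewrite expR_gt0 expR_lt1 oppr_lt0 mulr_gt0.
have h := K_ratio_modulus q01; rewrite expRK opprK in h.
apply: (K_ratio_inj (modulus01 q01) m01).
by apply: mulfI h; rewrite gt_eqF.
Qed.

Lemma ellipticK_theta (R : realType) (m : R) : 0 < m < 1 ->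
  ellipticK m = pi / 2 * theta_real (expR (- (pi * K_ratio m))) ^+ 2.
Proof.
move=> m01; have T0 := K_ratio_gt0 m01.
have q01 : 0 < expR (- (pi * K_ratio m)) < 1.
  by rewrite expR_gt0 expR_lt1 oppr_lt0 mulr_gt0// pi_gt0.
by have := ellipticK_modulus q01; rewrite (modulus_nome m01).
Qed.

(** * Gaussian series and their derivatives *)

(** A criterion that passes to limits of series: a quadratic remainder estimate with a common
    constant can be summed term by term. *)
Lemma drv_quadratic_bound (R : realType) (f : R -> R) (t g C d : R) : 0 < d ->
  (forall h, `|h| < d -> `|f (h + t) - f t - h * g| <= C * h ^+ 2) ->
  is_derive t 1 f g.
Proof.
move=> d0 hf.
have C1 : 0 < `|C| + 1 by rewrite ltr_wpDl.
have cv : h^-1 *: (f (h *: 1 + t) - f t) @[h --> 0^'] --> g.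
  apply/cvgrPdist_lt => e e0; apply/nbhs_ballP.
  exists (Num.min d (e / (`|C| + 1))) => /=.
    by rewrite lt_min d0 divr_gt0.
  move=> h; rewrite /ball/= sub0r normrN lt_min => /andP[hd he] h0.
  have hn : 0 < `|h| by rewrite normr_gt0.
  rewrite [h *: 1]mulr1.
  have -> : g - h^-1 *: (f (h + t) - f t) = - (h^-1 * (f (h + t) - f t - h * g)).
    by rewrite /GRing.scale/=; field.
  rewrite normrN normrM normfV mulrC ltr_pdivrMr//.
  apply: le_lt_trans (hf h hd) _; rewrite ltr_pdivlMr// in he.
  rewrite -[h ^+ 2]ger0_norm ?sqr_ge0// normrX expr2 mulrA ltr_pM2r//.
  apply: le_lt_trans he; rewrite mulrC; apply: ler_wpM2l => //.
  by apply: (le_trans (ler_norm C)); rewrite lerDl.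
apply: DeriveDef; first by apply/cvg_ex; exists g.
by apply/cvg_lim.
Qed.

(** Both estimates come from e^y >= 1 + y, used at y and at - y. *)
Lemma expR_second_order (R : realType) (y : R) :
  `|expR y - 1 - y| <= y ^+ 2 * expR `|y|.
Proof.
have h1 := expR_ge1Dx y; have h2 := expR_ge1Dx (- y).
have E0 := expR_gt0 y.
rewrite expRN in h2.
have h3 : expR y - 1 <= y * expR y.
  have : (1 - y) * expR y <= (expR y)^-1 * expR y by apply: ler_wpM2r h2; exact: ltW.
  by rewrite mulVf ?gt_eqF//; lra.
rewrite ger0_norm; last by lra.
have [y0|y0] := lerP 0 y.
  rewrite (ger0_norm y0).
  have : y * (expR y - 1) <= y * (y * expR y) by apply: ler_wpM2l.
  lra.
rewrite (ltr0_norm y0).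
have e1 : 1 <= expR (- y) by rewrite -expR0 ler_expR; lra.
have : y ^+ 2 * 1 <= y ^+ 2 * expR (- y) by apply: ler_wpM2l => //; exact: sqr_ge0.
nra.
Qed.

Lemma cvg_norm_le (R : realType) (u : nat -> R) (l B : R) :
  u @ \oo --> l -> (forall n, `|u n| <= B) -> `|l| <= B.
Proof.
move=> ul uB; apply/ler_addgt0Pr => e e0.
move/cvgrPdist_lt : ul => /(_ e e0)[N _ /(_ N (leqnn N))/= h].
rewrite -(subrK (u N) l) addrC; apply: le_trans (ler_normD _ _) _.
by apply: lerD => //; exact: ltW.
Qed.

Definition gauss_rate (R : realType) (n : nat) : R := pi * (n.+1 ^ 2)%:R.

Lemma gauss_rate_gt0 (R : realType) n : 0 < gauss_rate R n.
Proof. by rewrite mulr_gt0 ?pi_gt0// ltr0n expn_gt0. Qed.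

Definition gauss_term (R : realType) (k : nat) (t : R) (n : nat) : R :=
  gauss_rate R n ^+ k * expR (- (gauss_rate R n * t)).

(** Equal to (-1)^k times the k-th derivative of the sum of e^(-π n² t) over n >= 1; the index is
    shifted by one in [gauss_rate]. *)
Definition gauss_series (R : realType) (k : nat) (t : R) : R :=
  limn (series (gauss_term k t)).

Lemma gauss_term_ge0 (R : realType) k (t : R) n : 0 <= gauss_term k t n.
Proof. by rewrite mulr_ge0 ?expR_ge0// exprn_ge0// ltW// gauss_rate_gt0. Qed.

Lemma gauss_term0 (R : realType) (t : R) n :
  gauss_term 0 t n = expR (- (pi * t)) ^+ (n.+1 ^ 2).
Proof.
rewrite /gauss_term expr0 mul1r -expRM_natl; congr expR; rewrite /gauss_rate; ring.
Qed.

Lemma expR_nome01 (R : realType) (t : R) : 0 < t -> 0 <= expR (- (pi * t)) < 1.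
Proof. by move=> t0; rewrite expR_ge0 expR_lt1 oppr_lt0 mulr_gt0// pi_gt0. Qed.

(** Half of the exponential absorbs the power of the rate L, as (L t / 2)^k / k! <= e^(L t / 2). *)
Lemma gauss_term_le (R : realType) k (t : R) n : 0 < t ->
  gauss_term k t n <= (k`!%:R * (2 / t) ^+ k) * gauss_term 0 (t / 2) n.
Proof.
move=> t0; rewrite /gauss_term expr0 mul1r.
move: (gauss_rate R n) (gauss_rate_gt0 R n) => L L0.
have Lt : 0 <= L * t / 2 by rewrite divr_ge0// mulr_ge0// ltW.
have := exp_coeff_le (L * t / 2) k; rewrite ger0_norm// ler_pdivrMr ?ltr0n ?fact_gt0// => h.
have -> : L ^+ k = (2 / t) ^+ k * (L * t / 2) ^+ k.
  by rewrite -exprMn; congr (_ ^+ k); field; rewrite gt_eqF.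
have -> : expR (- (L * t)) = expR (- (L * t / 2)) * expR (- (L * (t / 2))).
  by rewrite -expRD; congr expR; field.
rewrite [k`!%:R * _]mulrC -!mulrA; apply: ler_wpM2l.
  by rewrite exprn_ge0// divr_ge0// ltW.
rewrite mulrA; apply: ler_wpM2r; first exact: expR_ge0.
rewrite expRN ler_pdivrMr ?expR_gt0//.
by apply: (le_trans _ (le_trans h _)); rewrite ?mulrA// mulrC.
Qed.

Lemma cvg_gauss_series (R : realType) k (t : R) : 0 < t ->
  cvgn (series (gauss_term k t)).
Proof.
move=> t0; have t20 : 0 < t / 2 by rewrite divr_gt0.
apply: (@series_le_cvg _ _ (fun n => (k`!%:R * (2 / t) ^+ k) * gauss_term 0 (t / 2) n)).
- by move=> n; exact: gauss_term_ge0.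
- move=> n; apply: mulr_ge0; last exact: gauss_term_ge0.
  by rewrite mulr_ge0// exprn_ge0// divr_ge0// ltW.
- by move=> n; exact: gauss_term_le.
- apply: is_cvg_seriesZ.
  have -> : gauss_term 0 (t / 2) = fun n => expR (- (pi * (t / 2))) ^+ (n.+1 ^ 2).
    by apply/funext => n; rewrite gauss_term0.
  exact/cvg_series_square_power/expR_nome01.
Qed.

Lemma gauss_series_cvg (R : realType) k (t : R) : 0 < t ->
  series (gauss_term k t) @ \oo --> gauss_series k t.
Proof. exact: cvg_gauss_series. Qed.

Lemma theta_real_gauss (R : realType) (t : R) :
  theta_real (expR (- (pi * t))) = 1 + 2 * gauss_series 0 t.
Proof.
rewrite /theta_real /square_series /gauss_series.
have -> : gauss_term 0 t = fun n => expR (- (pi * t)) ^+ (n.+1 ^ 2).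
  by apply/funext => n; rewrite gauss_term0.
by [].
Qed.

(** For |h| < t/2 the second-order remainder of the n-th term is at most h² times the n-th term of
    [gauss_series k.+2] at t/2: the factor e^(L |h|) costs at most half of the decay. Summation
    gives the quadratic bound. *)
Lemma drv_gauss_series (R : realType) k (t : R) : 0 < t ->
  is_derive t 1 (gauss_series k) (- gauss_series k.+1 t).
Proof.
move=> t0; have t20 : 0 < t / 2 by rewrite divr_gt0.
apply: (@drv_quadratic_bound _ _ _ _ (gauss_series k.+2 (t / 2)) _ t20) => h ht.
have ht0 : 0 < h + t.
  by move: ht; rewrite ltr_norml => /andP[h1 h2]; lra.
have c1 := @gauss_series_cvg R k _ ht0.
have c2 := @gauss_series_cvg R k _ t0.
have c3 := @gauss_series_cvg R k.+1 _ t0.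
have c3' : h * series (gauss_term k.+1 t) n @[n --> \oo] --> h * gauss_series k.+1 t.
  by apply: cvgM; [exact: cvg_cst|exact: c3].
pose proof (cvgD (cvgB c1 c2) c3') as c4.
rewrite mulrN opprK; apply: (cvg_norm_le c4) => n.
rewrite [X in `|X|](_ : _ = series (fun n => gauss_term k (h + t) n - gauss_term k t n +
    h * gauss_term k.+1 t n) n); last first.
  by rewrite /series/= big_split/= sumrB -mulr_sumr.
rewrite /series/=; apply: le_trans (ler_norm_sum _ _ _) _.
apply: (@le_trans _ _ (h ^+ 2 * series (gauss_term k.+2 (t / 2)) n)); last first.
  rewrite mulrC; apply: ler_wpM2r; first exact: sqr_ge0.
  apply: nondecreasing_cvgn_le; last exact: cvg_gauss_series.
  by apply/nondecreasing_series => i _ _; exact: gauss_term_ge0.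
rewrite /series/= mulr_sumr; apply: ler_sum => i _.
rewrite /gauss_term; move: (gauss_rate R i) (gauss_rate_gt0 R i) => L L0.
have -> : L ^+ k * expR (- (L * (h + t))) - L ^+ k * expR (- (L * t)) +
    h * (L ^+ k.+1 * expR (- (L * t))) =
  L ^+ k * expR (- (L * t)) * (expR (- (L * h)) - 1 - - (L * h)).
  by rewrite mulrDr opprD expRD exprS; ring.
rewrite normrM ger0_norm; last by rewrite mulr_ge0 ?expR_ge0// exprn_ge0// ltW.
apply: (@le_trans _ _ (L ^+ k * expR (- (L * t)) * ((- (L * h)) ^+ 2 * expR `|- (L * h)|))).
  apply: ler_wpM2l (expR_second_order _).
  by rewrite mulr_ge0 ?expR_ge0// exprn_ge0// ltW.
rewrite normrN normrM (ger0_norm (ltW L0)) sqrrN.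
have -> : L ^+ k * expR (- (L * t)) * ((L * h) ^+ 2 * expR (L * `|h|)) =
    h ^+ 2 * (L ^+ k.+2 * expR (- (L * t) + L * `|h|)).
  by rewrite expRD !exprS expr0; ring.
apply: ler_wpM2l; first exact: sqr_ge0.
apply: ler_wpM2l; first by rewrite exprn_ge0// ltW.
by rewrite ler_expR; nra.
Qed.

(** * Derivatives of theta through K and E, and the formula for U *)

Definition jacobi_theta (R : realType) (t : R) : R := 1 + 2 * gauss_series 0 t.

(** This is 2tθ'' + 3θ' for θ = [jacobi_theta], since θ' = -2 [gauss_series 1] and θ'' = 2
    [gauss_series 2]. The coefficients are those that yield s(s-1) in [Gamma_integral_xi]. *)
Definition xi_density (R : realType) (t : R) : R :=
  4 * t * gauss_series 2 t - 6 * gauss_series 1 t.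

Lemma drv_jacobi_theta (R : realType) (t : R) : 0 < t ->
  is_derive t 1 (@jacobi_theta R) (- 2 * gauss_series 1 t).
Proof.
move=> t0; apply: (drv_eq (drvD (drv_cst 1 t) (drvZ 2 (drv_gauss_series 0 t0)))).
by ring.
Qed.

Lemma jacobi_theta_ge1 (R : realType) (t : R) : 0 < t -> 1 <= jacobi_theta t.
Proof.
by move=> t0; rewrite /jacobi_theta -theta_real_gauss theta_real_ge1// expR_nome01.
Qed.

Lemma ellipticK_jacobi_theta (R : realType) (m : R) : 0 < m < 1 ->
  ellipticK m = pi / 2 * jacobi_theta (K_ratio m) ^+ 2.
Proof. by move=> m01; rewrite ellipticK_theta// theta_real_gauss. Qed.

Lemma near01 (R : realType) (m : R) : 0 < m < 1 -> \forall y \near m, 0 < y < 1.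
Proof.
move=> /andP[m0 m1]; near=> y; apply/andP; split; near: y.
  exact: lt_nbhsr.
exact: lt_nbhsl.
Unshelve. all: end_near. Qed.

(** The product θ'θ at K'/K, obtained by differentiating K = (π/2) θ(K'/K)² in m and comparing with
    the differential equation of K. *)
Lemma drv_jacobi_theta_ratio (R : realType) (m : R) : 0 < m < 1 ->
  - 2 * gauss_series 1 (K_ratio m) * jacobi_theta (K_ratio m) =
  - (2 / pi ^+ 2) * ((ellipticE m - (1 - m) * ellipticK m) * ellipticK m ^+ 2).
Proof.
move=> m01; have /andP[m0 m1] := m01.
have T0 := K_ratio_gt0 m01.
have K0 : 0 < ellipticK m by rewrite ellipticK_gt0// ltW.
have d1 := drv_ellipticK m1 (lt0r_neq0 m0).
have d2 : is_derive m 1 (@ellipticK R) (pi / 2 * (2 * jacobi_theta (K_ratio m) *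
    (- 2 * gauss_series 1 (K_ratio m) *
     (- pi / (4 * m * (1 - m) * ellipticK m ^+ 2))))).
  apply: (@drv_near _ (fun m => pi / 2 * jacobi_theta (K_ratio m) ^+ 2)).
    by have := near01 m01; apply: filterS => y y01; rewrite -ellipticK_jacobi_theta.
  apply: (drv_eq (drvZ _ (drvX 2 (drv_comp (drv_K_ratio m01) (drv_jacobi_theta T0))))).
  by rewrite /= expr1.
have e := drv_unique d1 d2.
have p0 : pi != 0 :> R by rewrite gt_eqF// pi_gt0.
have m0' : m != 0 by rewrite gt_eqF.
have m1' : 1 - m != 0 by rewrite gt_eqF// subr_gt0.
have Kn : ellipticK m != 0 by rewrite gt_eqF.
move: e; move: (gauss_series _ _) (jacobi_theta _) (ellipticE m) (ellipticK m) Kn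
  (pi : R) p0 {d1 d2 K0} => g th E K Kn P p0 e.
have -> : E - (1 - m) * K = (E - (1 - m) * K) / (2 * m * (1 - m)) * (2 * m * (1 - m)).
  by field; rewrite m0' m1'.
by rewrite e; field; rewrite m0' m1' Kn p0.
Qed.

(** The identity of [drv_jacobi_theta_ratio] holds near m and is differentiated once more: the left
    side is (θ''θ + θ'²) d(K'/K)/dm, and on the right E - (1-m)K has derivative K/2. *)
Lemma drv_jacobi_theta_ratio2 (R : realType) (m : R) : 0 < m < 1 ->
  (4 * gauss_series 2 (K_ratio m) * jacobi_theta (K_ratio m) / 2 +
   (- 2 * gauss_series 1 (K_ratio m)) ^+ 2) *
  (- pi / (4 * m * (1 - m) * ellipticK m ^+ 2)) =
  - (2 / pi ^+ 2) * (ellipticK m ^+ 3 / 2 +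
    2 * (ellipticE m - (1 - m) * ellipticK m) * ellipticK m *
    ((ellipticE m - (1 - m) * ellipticK m) / (2 * m * (1 - m)))).
Proof.
move=> m01; have /andP[m0 m1] := m01.
have T0 := K_ratio_gt0 m01.
have dK := drv_ellipticK m1 (lt0r_neq0 m0).
have dE := drv_ellipticE m1 (lt0r_neq0 m0).
have dT := drv_K_ratio m01.
have d1 := drvM (drvZ (- 2) (drv_comp dT (drv_gauss_series 1 T0)))
  (drv_comp dT (drv_jacobi_theta T0)).
have d2 := drvZ (- (2 / pi ^+ 2)) (drvM (drvB dE (drvM (drvB (drv_cst 1 m) (drv_id m)) dK))
  (drvX 2 dK)).
have nr : \forall y \near m,
    -2 * gauss_series 1 (K_ratio y) * jacobi_theta (K_ratio y) =
    - (2 / pi ^+ 2) * ((ellipticE y - (1 - y) * ellipticK y) * ellipticK y ^+ 2).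
  by have := near01 m01; apply: filterS => y y01; exact: drv_jacobi_theta_ratio.
have d1' := drv_near nr d1.
have e := drv_unique d1' d2.
have p0 : pi != 0 :> R by rewrite gt_eqF// pi_gt0.
have m0' : m != 0 by rewrite gt_eqF.
have m1' : 1 - m != 0 by rewrite gt_eqF// subr_gt0.
have Kn : ellipticK m != 0 by rewrite gt_eqF// ellipticK_gt0// ltW.
move: e; rewrite /= expr1 => e.
move: e; move: (gauss_series 1 _) (gauss_series 2 _) (jacobi_theta _) (ellipticE m)
  (ellipticK m) Kn (pi : R) p0 {d1 d2 d1' dK dE dT} => g1 g2 th E K Kn P p0 e.
rewrite [LHS](_ : _ = -2 * (- g2 * (- P / (4 * m * (1 - m) * K ^+ 2))) * th +
    -2 * g1 * (-2 * g1 * (- P / (4 * m * (1 - m) * K ^+ 2)))); last first.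
  by field; rewrite m0' m1' Kn.
by rewrite e; field; rewrite m0' m1' p0.
Qed.

(** The source of the formula for U. The two derivative identities are solved for θ' and θ'',
    Legendre's relation removes E(1-m), and θ² = 2K/π accounts for the fractional powers of K and π;
    a rational identity in K, K', E and m remains. *)
Lemma U_xi_density (R : realType) (m : R) : 0 < m < 1 ->
  U m = K_ratio m `^ (1 / 4) *
    (xi_density (K_ratio m) * (pi / (4 * m * (1 - m) * ellipticK m ^+ 2))).
Proof.
move=> m01; have /andP[m0 m1] := m01.
have T0 := K_ratio_gt0 m01.
have K0 : 0 < ellipticK m by rewrite ellipticK_gt0// ltW.
have K'0 : 0 < ellipticK (1 - m).
  by rewrite ellipticK_gt0// subr_ge0 (ltW m1)/= gtrBl.
have h1 := drv_jacobi_theta_ratio m01.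
have h2 := drv_jacobi_theta_ratio2 m01.
have hL := legendre_relation m01.
have hK := ellipticK_jacobi_theta m01.
have t1 := jacobi_theta_ge1 T0.
have p0 : 0 < pi :> R := pi_gt0 R.
(* In terms of r, both π = 2r² and sqrt(2π) = 2r are polynomial, and sqrt K is r times θ. *)
pose r : R := Num.sqrt (pi / 2).
have r0 : 0 < r by rewrite sqrtr_gt0 divr_gt0.
have r2 : r ^+ 2 = pi / 2 by rewrite sqr_sqrtr// divr_ge0// ltW.
have s2pi : Num.sqrt (2 * pi) = 2 * r.
  rewrite (_ : 2 * pi = (2 * r) ^+ 2) ?sqrtr_sqr ?ger0_norm ?mulr_ge0 ?(ltW r0)//.
  by rewrite exprMn r2; field.
have piE : pi = 2 * r ^+ 2 by rewrite r2; field.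
have a0 : 0 < jacobi_theta (K_ratio m) by lra.
(* The quarter powers enter only through u² = sqrt K = rθ and the quotient v/u = (K'/K)^(1/4). *)
pose u := ellipticK m `^ (1 / 4); pose v := ellipticK (1 - m) `^ (1 / 4).
have u0 : 0 < u by exact: powR_gt0.
have u2 : u ^+ 2 = r * jacobi_theta (K_ratio m).
  rewrite -powR_mulrn ?(ltW u0)// /u -powRrM (_ : 1 / 4 * 2%:R = 2^-1); last by field.
  rewrite powR12_sqrt ?(ltW K0)// hK -r2 -exprMn sqrtr_sqr ger0_norm//.
  by rewrite mulr_ge0 ?ltW.
have Tv : K_ratio m `^ (1 / 4) = v / u.
  apply: (mulIf (lt0r_neq0 u0)); rewrite divfK ?gt_eqF// /u -powRM ?ltW//.
  by rewrite /K_ratio divfK ?gt_eqF.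
rewrite /U /= powRM ?(ltW K0) ?(ltW K'0)// -/u -/v Tv s2pi /xi_density.
have -> : K_ratio m = ellipticK (1 - m) / ellipticK m by [].
(* Legendre's relation solved for E(1-m). *)
have EE : ellipticE (1 - m) = (pi / 2 + ellipticK m * ellipticK (1 - m) -
    ellipticE m * ellipticK (1 - m)) / ellipticK m.
  apply: (mulIf (lt0r_neq0 K0)); rewrite divfK ?gt_eqF//.
  by have := hL; lra.
rewrite -/(K_ratio m) EE.
move: (gauss_series 1 _) (gauss_series 2 _) h1 h2 => g1 g2 h1 h2.
rewrite hK -r2 -exprMn piE in h1 h2 *.
rewrite [in X in _ = _ * ((X - _) * _)]/K_ratio hK -r2 -exprMn.
move: (jacobi_theta _) a0 u2 h1 h2 => a a0 u2 h1 h2.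
have an : a != 0 by rewrite gt_eqF.
have rn : r != 0 by rewrite gt_eqF.
have un : u != 0 by rewrite gt_eqF.
move: u v u0 u2 un Tv => u v u0 u2 un _.
have m0' : m != 0 by rewrite gt_eqF.
have m1' : 1 - m != 0 by rewrite gt_eqF// subr_gt0.
move: (ellipticE m) (ellipticK (1 - m)) h1 h2 => E K' h1 h2.
(* X is 2m(1-m) dK/dm, in which θ' and θ'' are expressed most simply; a stands for θ. *)
pose K := (r * a) ^+ 2; pose X := E - (1 - m) * K.
have Kn : K != 0 by rewrite expf_neq0// mulf_neq0.
have r4 : r ^+ 4 != 0 by rewrite expf_neq0.
have e1 : g1 = X * K ^+ 2 / (4 * r ^+ 4 * a).
  have h : g1 * a = X * K ^+ 2 / (4 * r ^+ 4).
    transitivity (- (1 / 2) * (- 2 * g1 * a)); first by field.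
    by rewrite h1 -/K -/X; field; rewrite rn.
  by apply: (mulIf an); rewrite h; field; rewrite an rn.
have e2 : g2 = ((K ^+ 3 / 2 + X ^+ 2 * K / (m * (1 - m))) * (m * (1 - m)) * K ^+ 2
      / r ^+ 6 - 4 * g1 ^+ 2) / (2 * a).
  have c : 2 * r ^+ 2 / (4 * m * (1 - m) * K ^+ 2) != 0.
    by rewrite mulf_neq0 ?invr_neq0 ?mulf_neq0 ?expf_neq0 ?pnatr_eq0.
  have h : 2 * g2 * a + 4 * g1 ^+ 2 =
      (K ^+ 3 / 2 + X ^+ 2 * K / (m * (1 - m))) * (m * (1 - m)) * K ^+ 2 / r ^+ 6.
    apply: (mulIf c).
    transitivity (- ((4 * g2 * a / 2 + (- 2 * g1) ^+ 2) *
      (- (2 * r ^+ 2) / (4 * m * (1 - m) * K ^+ 2)))); first by field; rewrite Kn m0' m1'.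
    by rewrite h2 -/K -/X; field; rewrite Kn m0' m1' rn.
  by rewrite -h; field; rewrite an.
have Ka : K = r ^+ 2 * a ^+ 2 by rewrite /K exprMn.
have g12 : g1 ^+ 2 = X ^+ 2 * K ^+ 3 / (16 * r ^+ 6).
  rewrite e1; transitivity (X ^+ 2 * K ^+ 3 * K / (16 * r ^+ 8 * a ^+ 2)).
    by move: K X {Ka e1 e2 Kn} => K X; field; rewrite rn an.
  rewrite [X in _ * X / _]Ka.
  by move: K X {Ka e1 e2 Kn} => K X; field; rewrite rn an.
have e3 : g2 = (m * (1 - m) * K ^+ 5 / 2 + 3 / 4 * X ^+ 2 * K ^+ 3) / (2 * a * r ^+ 6).
  rewrite e2 g12.
  by move: K X {g12 Ka e1 e2 Kn} => K X; field; rewrite rn an m0' m1'.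
have uv : u * v = K / (r * a) * (v / u).
  have -> : K / (r * a) = u ^+ 2.
    by rewrite u2 /K expr2 mulfK// mulf_neq0.
  by rewrite expr2 mulrA [u * u * v]mulrAC mulfK.
have EX : E = X + (1 - m) * K by rewrite /X subrK.
rewrite -/K e3 e1 uv EX.
move: (v / u) K X Kn {e1 e2 e3 uv EX Ka g12} => w {}K {}X Kn.
by field; rewrite an rn m0' m1' Kn.
Qed.

(** * The Mellin transform and the zeta function *)

(** The factor L^k of the term cancels the L^-k from scaling Euler's integral at z + k, so every k
    gives the same power L^-z. *)
Lemma gauss_moment (R : realType) (k n : nat) (z : R[i]) : 0 < complex.Re z ->
  cintegrable `]0, +oo[
    (fun t : R => cpow t (z - 1) * (t ^+ k * gauss_term k t n)%:C) /\
  cintegral `]0, +oo[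
    (fun t : R => cpow t (z - 1) * (t ^+ k * gauss_term k t n)%:C) =
  cpow (gauss_rate R n) (- z) * Gamma_integral (z + k%:R).
Proof.
move=> z0; have L0 := gauss_rate_gt0 R n.
have zk : 0 < complex.Re (z + k%:R).
  by rewrite ReD -(rmorph_nat (real_complex R)) ReC ltr_pwDl.
have [i1 i2] := cintegral_Gamma_scaled L0 zk.
have mD : measurable (`]0, +oo[%classic : set R) by [].
have [j1 j2] := cintegrableZ ((gauss_rate R n) ^+ k)%:C mD i1.
have e (t : R) : `]0, +oo[%classic t ->
    ((gauss_rate R n) ^+ k)%:C *
      (cpow t (z + k%:R - 1) * (expR (- (gauss_rate R n * t)))%:C) =
    cpow t (z - 1) * (t ^+ k * gauss_term k t n)%:C.
  rewrite /= in_itv/= andbT => t0.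
  rewrite /gauss_term addrAC [cpow t (z - 1 + _)]cpowD cpow_nat// !rmorphM/=.
  by ring.
split; first exact: eq_cintegrable e j1.
have {}e := eq_cintegral e.
apply: (etrans (esym e)); apply: (etrans j2); rewrite i2 opprD cpowD.
move: (gauss_rate R n) L0 (Gamma_integral _) => L L0 {e j1 j2 i1 i2} G.
rewrite [cpow _ (- k%:R)]cpowN cpow_nat//.
rewrite mulrA [cpow _ _ * _]mulrC mulrA divff ?mul1r//.
by rewrite -(rmorph0 (real_complex R)) (inj_eq (@complexI R)) expf_neq0// gt_eqF.
Qed.

(** Monotone convergence: the integral of the sum is the sum l of the integrals, hence finite. *)
Lemma ge0_integrable_series (R : realType) (D : set R) (f : nat -> R -> R)
    (g : R -> R) (c : nat -> R) (l : R) : measurable D ->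
  (forall n x, D x -> 0 <= f n x) ->
  (forall n, (@lebesgue_measure R).-integrable D (EFin \o f n)) ->
  (forall n, \int[@lebesgue_measure R]_(x in D) f n x = c n) ->
  series c @ \oo --> l ->
  (forall x, D x -> series (f ^~ x) @ \oo --> g x) ->
  (@lebesgue_measure R).-integrable D (EFin \o g).
Proof.
move=> mD f0 fi fc cl fg.
have mf n : measurable_fun D (EFin \o f n) by exact: (measurable_int _ (fi n)).
have gE x : D x -> (\sum_(0 <= n <oo) (f n x)%:E = (g x)%:E)%E.
  move=> Dx; have h : (fun n => \sum_(0 <= k < n) (f k x)%:E)%E @ \oo --> (g x)%:E.
    rewrite (_ : (fun _ => _) = EFin \o series (f ^~ x)).
      by apply: cvg_EFin; [exact: nearW|exact: fg].
    by apply/funext => n /=; rewrite sumEFin.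
  exact/cvg_lim.
have mg : measurable_fun D (EFin \o g).
  apply: (@eq_measurable_fun _ _ _ _ D (fun x => \sum_(0 <= n <oo) (f n x)%:E)%E).
    by move=> x; rewrite inE => Dx /=; exact: gE.
  apply: ge0_emeasurable_sum => //.
    by move=> k x Dx _; rewrite lee_fin f0.
  by move=> k _; exact: mf.
have g0 x : D x -> (0 <= (EFin \o g) x)%E.
  by move=> Dx; rewrite /= -gE// nneseries_ge0// => n _ _; rewrite lee_fin f0.
apply/integrableP; split; first exact: mg.
rewrite (_ : integral _ _ _ = \int[@lebesgue_measure R]_(x in D)
   (\sum_(0 <= n <oo) (f n x)%:E))%E; last first.
  apply: eq_integral => x; rewrite inE => Dx.
  by rewrite gee0_abs ?gE//; exact: g0.
rewrite integral_nneseries//.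
have cE n : (\int[@lebesgue_measure R]_(x in D) (f n x)%:E = (c n)%:E)%E.
  by rewrite -fc fineK//; apply: integrable_fin_num; [exact: mD|exact: fi].
rewrite (_ : (\sum_(0 <= n <oo) _ = l%:E)%E) ?ltry//.
apply/cvg_lim => //.
rewrite (_ : (fun _ => _) = EFin \o series c).
  by apply: cvg_EFin; [exact: nearW|].
by apply/funext => n /=; under eq_bigr do rewrite cE; rewrite sumEFin.
Qed.

Lemma gauss_rate_cpow (R : realType) (n : nat) (z : R[i]) :
  cpow (gauss_rate R n) (- (z / 2)) = cpow pi (- (z / 2)) * cpow n.+1%:R (- z).
Proof.
have n0 : 0 < n.+1%:R :> R by rewrite ltr0n.
rewrite /gauss_rate natrX cpow_mul ?pi_gt0 ?exprn_gt0// cpowX//.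
congr (_ * cpow _ _).
by field.
Qed.

Lemma Re_half (R : realType) (z : R[i]) : complex.Re (z / 2) = complex.Re z / 2.
Proof.
rewrite (_ : z / 2 = z * (2^-1 : R)%:C); first by rewrite ReM ReC ImC mulr0 subr0.
by rewrite -(rmorph_nat (real_complex R)) -fmorphV.
Qed.

(** The functional equation reduces the left side to Γ(s/2) times 4(s/2)(s/2+1) - 6(s/2), which is
    s(s-1). *)
Lemma Gamma_integral_xi (R : realType) (s : R[i]) : 0 < complex.Re s ->
  4 * Gamma_integral (s / 2 + 2) - 6 * Gamma_integral (s / 2 + 1) =
  s * (s - 1) * Gamma_integral (s / 2).
Proof.
move=> s0; have s20 : 0 < complex.Re (s / 2) by rewrite Re_half divr_gt0.
rewrite Gamma_integralD// Gamma_integralS// big_ord_recl big_ord1/= /bump/=.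
by field.
Qed.

Definition xi_term (R : realType) (s : R[i]) (n : nat) (t : R) : R[i] :=
  cpow t (s / 2 - 1) *
  (4 * (t ^+ 2 * gauss_term 2 t n) - 6 * (t * gauss_term 1 t n))%:C.

Lemma cintegral_xi_term (R : realType) (s : R[i]) (n : nat) : 0 < complex.Re s ->
  cintegrable `]0, +oo[ (xi_term s n) /\
  cintegral `]0, +oo[ (xi_term s n) = cpow n.+1%:R (- s) *
    (cpow pi (- (s / 2)) * (s * (s - 1) * Gamma_integral (s / 2))).
Proof.
move=> s0; have s20 : 0 < complex.Re (s / 2) by rewrite Re_half divr_gt0.
have mD : measurable (`]0, +oo[%classic : set R) by [].
have [i1 e1] := gauss_moment 2 n s20; have [i2 e2] := gauss_moment 1 n s20.
have [i3 e3] := cintegrableZ 4 mD i1.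
have [i4 e4] := cintegrableZ (- 6) mD i2.
have [i5 e5] := cintegrableD mD i3 i4.
have e (t : R) : `]0, +oo[%classic t ->
    4 * (cpow t (s / 2 - 1) * (t ^+ 2 * gauss_term 2 t n)%:C) +
    - 6 * (cpow t (s / 2 - 1) * (t ^+ 1 * gauss_term 1 t n)%:C) = xi_term s n t.
  move=> _; rewrite /xi_term rmorphB !rmorphM/= !rmorph_nat.
  by move: (cpow _ _) => w; ring.
split; first exact: eq_cintegrable e i5.
have {}e := eq_cintegral e.
apply: (etrans (esym e)); apply: (etrans e5); rewrite e3 e4 e1 e2.
rewrite -Gamma_integral_xi// gauss_rate_cpow.
set a := cpow pi _; set b := cpow _ _; set c := Gamma_integral _.
set d := Gamma_integral _; rewrite -/d.
by move: a b c d => a b c d; ring.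
Qed.

Lemma series_le_lim (R : realType) (u : nat -> R) (l : R) (n : nat) :
  (forall k, 0 <= u k) -> series u @ \oo --> l -> series u n <= l.
Proof.
move=> u0 ul; rewrite -(cvg_lim _ ul)//; apply: nondecreasing_cvgn_le.
  by apply/nondecreasing_seqP => k; rewrite /series/= big_nat_recr//= lerDl.
by apply/cvg_ex; exists l.
Qed.

(** Majorant for all partial sums of the Mellin integrand: the minus sign of [xi_density] is
    replaced by a plus, so that its terms are nonnegative. *)
Definition xi_bound (R : realType) (x t : R) : R :=
  expR ((x / 2 - 1) * ln t) *
  (4 * (t ^+ 2 * gauss_series 2 t) + 6 * (t * gauss_series 1 t)).

Definition xi_bound_term (R : realType) (x : R) (n : nat) (t : R) : R :=
  expR ((x / 2 - 1) * ln t) *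
  (4 * (t ^+ 2 * gauss_term 2 t n) + 6 * (t * gauss_term 1 t n)).

Lemma xi_bound_term_ge0 (R : realType) (x : R) (n : nat) (t : R) : 0 < t ->
  0 <= xi_bound_term x n t.
Proof.
move=> t0; rewrite mulr_ge0 ?expR_ge0// addr_ge0// mulr_ge0// mulr_ge0 ?gauss_term_ge0//.
  by rewrite sqr_ge0.
exact: ltW.
Qed.

Lemma cvg_seqZ (R : realType) (u : nat -> R) (c l : R) :
  u @ \oo --> l -> (fun n => c * u n) @ \oo --> c * l.
Proof. by move=> ul; apply: cvgM => //; exact: cvg_cst. Qed.

Lemma cvg_gauss_combination (R : realType) (a b t : R) : 0 < t ->
  series (fun n => a * gauss_term 2 t n + b * gauss_term 1 t n) @ \oo -->
  a * gauss_series 2 t + b * gauss_series 1 t.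
Proof.
move=> t0; pose proof (@cvg_seqZ R _ a _ (@gauss_series_cvg R 2 _ t0)) as c2.
pose proof (@cvg_seqZ R _ b _ (@gauss_series_cvg R 1 _ t0)) as c1.
pose proof (cvgD c2 c1) as c3; move: c3.
apply: cvg_trans; apply: near_eq_cvg; apply: nearW => n.
by rewrite /series/= big_split/= -!mulr_sumr.
Qed.

Lemma cvg_xi_bound (R : realType) (x t : R) : 0 < t ->
  series (fun n => xi_bound_term x n t) @ \oo --> xi_bound x t.
Proof.
move=> t0; pose E := expR ((x / 2 - 1) * ln t).
have h := @cvg_gauss_combination R (E * 4 * t ^+ 2) (E * 6 * t) _ t0.
rewrite (_ : (fun _ => _) = fun n => E * 4 * t ^+ 2 * gauss_term 2 t n +
    E * 6 * t * gauss_term 1 t n); last first.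
  by apply/funext => n; rewrite /xi_bound_term -/E; ring.
by rewrite (_ : xi_bound x t = E * 4 * t ^+ 2 * gauss_series 2 t +
    E * 6 * t * gauss_series 1 t)// /xi_bound -/E; ring.
Qed.

(** The complex moments are evaluated at a real exponent. The value is n.+1^-x times a constant
    independent of n, so summation over n gives a Dirichlet series. *)
Lemma cintegral_xi_bound_term (R : realType) (x : R) (n : nat) : 0 < x ->
  (@lebesgue_measure R).-integrable `]0, +oo[ (EFin \o xi_bound_term x n) /\
  \int[@lebesgue_measure R]_(t in `]0, +oo[) xi_bound_term x n t =
  complex.Re (cpow n.+1%:R (- x%:C)) *
  complex.Re (cpow pi (- (x%:C / 2)) * (4 * Gamma_integral (x%:C / 2 + 2) +
    6 * Gamma_integral (x%:C / 2 + 1))).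
Proof.
move=> x0; have s20 : 0 < complex.Re (x%:C / 2) by rewrite Re_half divr_gt0.
have mD : measurable (`]0, +oo[%classic : set R) by [].
have [i1 e1] := gauss_moment 2 n s20; have [i2 e2] := gauss_moment 1 n s20.
have [i3 e3] := cintegrableZ 4 mD i1.
have [i4 e4] := cintegrableZ 6 mD i2.
have [i5 e5] := cintegrableD mD i3 i4.
have x2 : x%:C / 2 - 1 = (x / 2 - 1)%:C.
  by rewrite rmorphB rmorphM/= fmorphV rmorph_nat.
have e (t : R) : `]0, +oo[%classic t ->
    4 * (cpow t (x%:C / 2 - 1) * (t ^+ 2 * gauss_term 2 t n)%:C) +
    6 * (cpow t (x%:C / 2 - 1) * (t ^+ 1 * gauss_term 1 t n)%:C) =
    (xi_bound_term x n t)%:C.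
  move=> _; rewrite x2 cpow_real /xi_bound_term !(rmorphM, rmorphD)/= !rmorph_nat.
  by ring.
have [iR _] := eq_cintegrable mD e i5.
split; first exact: iR.
have {}e := eq_cintegral e.
transitivity (complex.Re (cintegral `]0, +oo[ (fun t => (xi_bound_term x n t)%:C))).
  by [].
rewrite -e e5 e3 e4 e1 e2 gauss_rate_cpow.
rewrite -(rmorphN (real_complex R)) cpow_real.
set a := cpow pi _; set c := Gamma_integral _; set d := Gamma_integral _; set r := expR _.
transitivity (complex.Re (r%:C * (a * (4 * c + 6 * d)))).
  by congr complex.Re; move: (r%:C) a c d => ? ? ? ?; ring.
by rewrite ReM ReC ImC mul0r subr0.
Qed.

(** The integrals of the nonnegative terms sum to a constant times the Dirichlet series of zeta at
    x, which converges for x > 1. *)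
Lemma integrable_xi_bound (R : realType) (zeta : R[i] -> R[i]) (x : R) :
  is_riemann_zeta zeta -> 1 < x ->
  (@lebesgue_measure R).-integrable `]0, +oo[ (EFin \o xi_bound x).
Proof.
move=> [zs _] x1; have x0 : 0 < x by apply: lt_trans x1.
have mD : measurable (`]0, +oo[%classic : set R) by [].
pose C := complex.Re (cpow pi (- (x%:C / 2)) * (4 * Gamma_integral (x%:C / 2 + 2) +
    6 * Gamma_integral (x%:C / 2 + 1))).
have /cvgc_ReImP[zr _] := zs x%:C x1.
apply: (@ge0_integrable_series R _ (xi_bound_term x) _
  (fun n => complex.Re (cpow n.+1%:R (- x%:C)) * C) (complex.Re (zeta x%:C) * C) mD).
- by move=> n t; rewrite /= in_itv/= andbT => t0; exact: xi_bound_term_ge0.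
- by move=> n; have [] := cintegral_xi_bound_term n x0.
- by move=> n; have [_] := cintegral_xi_bound_term n x0.
- rewrite mulrC; move: (@cvg_seqZ R _ C _ zr); apply: cvg_trans.
  apply: near_eq_cvg; apply: nearW => n.
  by rewrite /series/= Re_sum mulr_sumr; apply: eq_bigr => k _; rewrite mulrC.
- by move=> t; rewrite /= in_itv/= andbT => t0; exact: cvg_xi_bound.
Qed.

Lemma xi_term_real (R : realType) (s : R[i]) (n : nat) (t : R) :
  cabs (xi_term s n t) = expR ((complex.Re s / 2 - 1) * ln t) *
    `|4 * (t ^+ 2 * gauss_term 2 t n) - 6 * (t * gauss_term 1 t n)|.
Proof.
have h : complex.Re (s / 2 - 1) = complex.Re s / 2 - 1.
  by rewrite ReD Re_half ReN -(rmorph1 (real_complex R)) ReC.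
by rewrite /xi_term cabsM cabs_real cabs_cpow h.
Qed.

Lemma cabs_xi_term_le (R : realType) (s : R[i]) (n : nat) (t : R) : 0 < t ->
  cabs (xi_term s n t) <= xi_bound_term (complex.Re s) n t.
Proof.
move=> t0; rewrite xi_term_real ler_wpM2l ?expR_ge0//.
have h1 : 0 <= t ^+ 2 * gauss_term 2 t n by rewrite mulr_ge0 ?gauss_term_ge0 ?sqr_ge0.
have h2 : 0 <= t * gauss_term 1 t n by rewrite mulr_ge0 ?gauss_term_ge0 ?ltW.
by rewrite ler_norml; apply/andP; split; lra.
Qed.

Lemma cvg_realC (R : realType) (u : nat -> R) (l : R) :
  u @ \oo --> l -> (fun n => (u n)%:C) @ \oo --> l%:C.
Proof.
move=> ul; apply/cvgc_ReImP; split; first exact: ul.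
exact: cvg_cst.
Qed.

(** Termwise integration, dominated by [xi_bound]. The n-th integral is n.+1^-s times a fixed
    factor, and the series of these powers is zeta. *)
Lemma cintegral_xi_mellin (R : realType) (zeta : R[i] -> R[i]) (s : R[i]) :
  is_riemann_zeta zeta -> 1 < complex.Re s ->
  cintegrable `]0, +oo[ (fun t => cpow t (s / 2 - 1) * (t * xi_density t)%:C) /\
  cintegral `]0, +oo[ (fun t => cpow t (s / 2 - 1) * (t * xi_density t)%:C) =
  zeta s * (cpow pi (- (s / 2)) * (s * (s - 1) * Gamma_integral (s / 2))).
Proof.
move=> zP s1; have s0 : 0 < complex.Re s by apply: lt_trans s1.
have [zs _] := zP.
have mD : measurable (`]0, +oo[%classic : set R) by [].
have it n := (cintegral_xi_term n s0).1.
have [|||| iF cF] := @cintegral_dominated_cvg R `]0, +oo[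
  (fun n t => \sum_(0 <= k < n) xi_term s k t)
  (fun t => cpow t (s / 2 - 1) * (t * xi_density t)%:C) (xi_bound (complex.Re s)) mD.
- by move=> n; exact: cintegrable_cmeasurable (cintegrable_sum n mD it).1.
- move=> t; rewrite /= in_itv/= andbT => t0.
  have h := @cvg_gauss_combination R (4 * t ^+ 2) (- 6 * t) _ t0.
  have h1 := cvg_realC h.
  have h2 : (fun=> cpow t (s / 2 - 1)) @ \oo --> cpow t (s / 2 - 1) by exact: cvg_cst.
  pose proof (@cvgcM R nat \oo _ _ _ _ _ h2 h1) as h3.
  rewrite (_ : t * xi_density t =
    4 * t ^+ 2 * gauss_series 2 t + - 6 * t * gauss_series 1 t); last first.
    by rewrite /xi_density; ring.
  move: h3; apply: cvg_trans; apply: near_eq_cvg; apply: nearW => n.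
  rewrite /series/= rmorph_sum/= mulr_sumr; apply: eq_bigr => k _; rewrite /xi_term.
  by congr (_ * _%:C); ring.
- exact: integrable_xi_bound zP s1.
- move=> n t; rewrite /= in_itv/= andbT => t0; apply: le_trans (cabs_sum _ _ _) _.
  have h := series_le_lim n (fun k => xi_bound_term_ge0 (complex.Re s) k t0)
    (@cvg_xi_bound R (complex.Re s) _ t0).
  apply: le_trans h.
  by rewrite /series/=; apply: ler_sum => k _; exact: cabs_xi_term_le.
split => //.
set c := cpow pi _ * _.
have h : (fun n => series (fun n => cpow n.+1%:R (- s)) n * c) @ \oo --> zeta s * c.
  have h2 : (fun=> c) @ \oo --> c by exact: cvg_cst.
  pose proof (@cvgcM R nat \oo _ _ _ _ _ (zs s s1) h2) as h3; exact: h3.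
apply: cvgc_unique cF _.
move: h; apply: cvg_trans; apply: near_eq_cvg; apply: nearW => n.
rewrite (cintegrable_sum n mD it).2 /series/= mulr_suml.
by apply: eq_bigr => k _; rewrite (cintegral_xi_term k s0).2.
Qed.

(** * The change of variable t = K(1-m)/K(m) *)

Lemma K_ratio_le (R : realType) (m n : R) : 0 < m < 1 -> 0 < n < 1 ->
  (K_ratio m <= K_ratio n) = (n <= m).
Proof.
move=> /andP[m0 m1] /andP[n0 n1]; have [nm|mn|->] := ltgtP n m; last by rewrite lexx.
- by rewrite ltW// K_ratio_decreasing.
- by apply/negbTE; rewrite -ltNge K_ratio_decreasing.
Qed.

(** The inverse function of [K_ratio]: the parameter at the nome e^(-πt). *)
Definition K_ratio_inverse (R : realType) (t : R) : R := modulus (expR (- (pi * t))).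

Lemma K_ratio_inverse01 (R : realType) (t : R) : 0 < t -> 0 < K_ratio_inverse t < 1.
Proof.
move=> t0; apply: modulus01; rewrite expR_gt0 expR_lt1 oppr_lt0.
by rewrite mulr_gt0 ?pi_gt0.
Qed.

Lemma K_ratio_inverseK (R : realType) (t : R) : 0 < t ->
  K_ratio (K_ratio_inverse t) = t.
Proof.
move=> t0; have p0 : pi != 0 :> R by rewrite gt_eqF ?pi_gt0.
apply: (mulfI p0); rewrite K_ratio_modulus ?expRK ?opprK//.
by rewrite expR_gt0 expR_lt1 oppr_lt0 mulr_gt0 ?pi_gt0.
Qed.

(** The preimage of [pos_itv n] under [K_ratio], with endpoints exchanged because [K_ratio]
    decreases. As [pos_itv n] is stable under t -> 1/t, this interval is stable under m -> 1 - m. *)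
Definition unit_itv (R : realType) (n : nat) : set R :=
  `[K_ratio_inverse n.+1%:R, K_ratio_inverse n.+1%:R^-1]%classic.

Lemma unit_itvP (R : realType) (n : nat) (m : R) :
  unit_itv n m <-> 0 < m < 1 /\ pos_itv n (K_ratio m).
Proof.
have n0 : 0 < n.+1%:R :> R by rewrite ltr0n.
have n1 : 0 < n.+1%:R^-1 :> R by rewrite invr_gt0.
have /andP[a0 a1] := K_ratio_inverse01 n0; have /andP[b0 b1] := K_ratio_inverse01 n1.
have bE (x : R) : 0 < x < 1 ->
    (n.+1%:R^-1 <= K_ratio x) = (x <= K_ratio_inverse n.+1%:R^-1).
  by move=> x01; rewrite -[X in X <= _](K_ratio_inverseK n1) K_ratio_le ?b0//.
have aE (x : R) : 0 < x < 1 ->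
    (K_ratio x <= n.+1%:R) = (K_ratio_inverse n.+1%:R <= x).
  by move=> x01; rewrite -[X in _ <= X](K_ratio_inverseK n0) K_ratio_le// a0.
rewrite /unit_itv /pos_itv /= !in_itv/=; split.
  move=> /andP[am mb]; have m01 : 0 < m < 1.
    by rewrite (lt_le_trans a0)//= (le_lt_trans mb).
  by rewrite aE// bE// am mb.
by move=> [m01]; rewrite aE// bE// andbC.
Qed.

Lemma unit_itv_bigcup (R : realType) :
  \bigcup_n (@unit_itv R n) = `]0, 1[%classic.
Proof.
apply/seteqP; split => [m [n _ /unit_itvP[m01 _]]|m].
  by rewrite /= in_itv/=.
rewrite /= in_itv/= => m01; have : (`]0, +oo[%classic : set R) (K_ratio m).
  by rewrite /= in_itv/= andbT K_ratio_gt0.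
by rewrite -pos_itv_bigcup => -[n _ h]; exists n => //; apply/unit_itvP.
Qed.

Lemma unit_itv_nondecreasing (R : realType) : nondecreasing_seq (@unit_itv R).
Proof.
move=> i j ij; apply/subsetPset => m /unit_itvP[m01 h]; apply/unit_itvP; split => //.
by move: h; apply/subsetPset; exact: pos_itv_nondecreasing.
Qed.

(** The Jacobian of the substitution, minus the derivative of [K_ratio]. *)
Definition K_ratio_weight (R : realType) (m : R) : R :=
  pi / (4 * m * (1 - m) * ellipticK m ^+ 2).

Lemma K_ratio_weight_gt0 (R : realType) (m : R) : 0 < m < 1 ->
  0 < K_ratio_weight m.
Proof.
move=> /andP[m0 m1]; rewrite divr_gt0 ?pi_gt0// mulr_gt0 ?exprn_gt0//.
  by rewrite mulr_gt0 ?subr_gt0// mulr_gt0.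
by rewrite ellipticK_gt0// ltW.
Qed.

Lemma continuous_K_ratio_weight (R : realType) (m : R) : 0 < m < 1 ->
  {for m, continuous (@K_ratio_weight R)}.
Proof.
move=> m01; have /andP[m0 m1] := m01.
have Kn : ellipticK m != 0 by rewrite gt_eqF// ellipticK_gt0// ltW.
have nz : 4 * m * (1 - m) * ellipticK m ^+ 2 != 0.
  by rewrite mulf_neq0 ?expf_neq0// mulf_neq0 ?mulf_neq0// gt_eqF// subr_gt0.
have d := drvZ pi (drvV (drvM (drvM (drvZ 4 (drv_id m)) (drvB (drv_cst 1 m) (drv_id m)))
  (drvX 2 (drv_ellipticK_integral m1))) nz).
exact: drv_continuous d.
Qed.

Lemma integral_K_ratio_subst (R : realType) (h : R -> R) (n : nat) :
  (forall t : R, 0 < t -> {for t, continuous h}) ->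
  (\int[@lebesgue_measure R]_(u in pos_itv n) (h u)%:E =
   \int[@lebesgue_measure R]_(x in unit_itv n)
     (h (K_ratio x) * K_ratio_weight x)%:E)%E.
Proof.
move=> ch; have n0 : 0 < n.+1%:R :> R by rewrite ltr0n.
have n1 : 0 < n.+1%:R^-1 :> R by rewrite invr_gt0.
have /andP[a0 a1] := K_ratio_inverse01 n0; have /andP[b0 b1] := K_ratio_inverse01 n1.
have x01 (x : R) : K_ratio_inverse n.+1%:R <= x <= K_ratio_inverse n.+1%:R^-1 -> 0 < x < 1.
  by move=> /andP[h1 h2]; rewrite (lt_le_trans a0)//= (le_lt_trans h2).
pose a := K_ratio_inverse (n.+1%:R : R); pose b := K_ratio_inverse (n.+1%:R^-1 : R).
pose f (x : R) := - pi / (4 * x * (1 - x) * ellipticK x ^+ 2).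
have fE x : f x = - K_ratio_weight x by rewrite /f mulNr.
have ab : a <= b.
  rewrite -(K_ratio_le (K_ratio_inverse01 n1) (K_ratio_inverse01 n0)).
  rewrite (K_ratio_inverseK n0) (K_ratio_inverseK n1).
  by rewrite (@le_trans _ _ 1)// ?ler1n// invf_le1// ler1n.
have d (x : R) : a <= x <= b -> is_derive x 1 (@K_ratio R) (f x).
  by move=> /x01 xx; exact: drv_K_ratio.
have cf (x : R) : a <= x <= b -> {for x, continuous f}.
  move=> /x01 xx; rewrite (_ : f = fun y => - K_ratio_weight y); last exact/funext/fE.
  by apply: continuousN; exact: continuous_K_ratio_weight.
have nf (x : R) : a <= x <= b -> f x < 0.
  by move=> /x01 xx; rewrite fE oppr_lt0; exact: K_ratio_weight_gt0.
have hc (u : R) : K_ratio b <= u <= K_ratio a -> {for u, continuous h}.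
  by move=> /andP[h1 _]; apply: ch; apply: lt_le_trans h1; rewrite (K_ratio_inverseK n1).
pose proof (integral_subst_decreasing ab d cf nf hc) as E.
rewrite /a /b (K_ratio_inverseK n0) (K_ratio_inverseK n1) in E; rewrite E.
by apply: eq_integral => x _; rewrite fE opprK.
Qed.

Lemma U_symmetric (R : realType) (m : R) : 0 < m < 1 -> U m = U (1 - m).
Proof.
move=> _; rewrite /U /= subKr.
rewrite [(1 - m) * m]mulrC [ellipticK (1 - m) * ellipticK m]mulrC.
by congr (_ * _); ring.
Qed.

Definition U_integrand (R : realType) (s : R[i]) (m : R) : R[i] :=
  cpow (ellipticK (1 - m) / ellipticK m) (1 / 2 * (s - 1 / 2)) * (U m)%:C.

Lemma continuous_xi_density (R : realType) (t : R) : 0 < t ->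
  {for t, continuous (fun t : R => t * xi_density t)}.
Proof.
move=> t0; have d := drvM (drv_id t) (drvB (drvM (drvZ 4 (drv_id t)) (drv_gauss_series 2 t0))
  (drvZ 6 (drv_gauss_series 1 t0))).
exact: drv_continuous d.
Qed.

(** Powers of T = K'/K are counted: T^(s/2-1) T becomes T^(s/2-1/4), where s/2 - 1/4 = (s - 1/2)/2,
    once U has taken up the factor T^(1/4). *)
Lemma U_integrandE (R : realType) (s : R[i]) (m : R) : 0 < m < 1 ->
  cpow (K_ratio m) (s / 2 - 1) * (K_ratio m * xi_density (K_ratio m))%:C *
    (K_ratio_weight m)%:C = U_integrand s m.
Proof.
move=> m01; have T0 := K_ratio_gt0 m01.
rewrite /U_integrand -/(K_ratio m) U_xi_density// -/(K_ratio_weight m).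
rewrite /powR gt_eqF//.
move: (K_ratio m) T0 (K_ratio_weight m) => T T0 w.
have -> : 1 / 2 * (s - 1 / 2) = s / 2 - 1 + 1 - (1 / 4 : R)%:C.
  by rewrite rmorphM/= fmorphV !rmorph_nat; field.
have -> : cpow T (s / 2 - 1 + 1 - (1 / 4)%:C) =
    cpow T (s / 2 - 1) * T%:C / (expR (1 / 4 * ln T))%:C.
  by rewrite cpowD [cpow T (s / 2 - 1 + 1)]cpowD cpow1// cpowN cpow_real.
rewrite !rmorphM/=.
have en : (expR (1 / 4 * ln T))%:C != 0 :> R[i].
  by rewrite -(rmorph0 (real_complex R)) (inj_eq (@complexI R)) gt_eqF// expR_gt0.
by field.
Qed.

Lemma measurable_ln_K_ratio (R : realType) :
  measurable_fun (`]0, 1[ : set R) (fun m : R => ln (K_ratio m)).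
Proof.
apply: open_continuous_measurable_fun; first exact: interval_open.
move=> x; rewrite inE/= in_itv/= => x01.
by have d := drv_ln (drv_K_ratio x01) (K_ratio_gt0 x01); exact: drv_continuous d.
Qed.

(** The Mellin integral of [cintegral_xi_mellin] under the substitution t = [K_ratio] m;
    integrability is transported along with the value. *)
Lemma cintegral_U_integrand (R : realType) (zeta : R[i] -> R[i]) (s : R[i]) :
  is_riemann_zeta zeta -> 1 < complex.Re s ->
  cintegrable `]0, 1[ (U_integrand s) /\
  cintegral `]0, 1[ (U_integrand s) =
  zeta s * (cpow pi (- (s / 2)) * (s * (s - 1) * Gamma_integral (s / 2))).
Proof.
move=> zP s1; have [iX eX] := cintegral_xi_mellin zP s1.
have mD : measurable (`]0, 1[ : set R) by exact: measurable_itv.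
pose G (t : R) := cpow t (s / 2 - 1) * (t * xi_density t)%:C.
have [|||||||||||iU eU] := @cintegral_subst R (@unit_itv R) (@pos_itv R)
  (@K_ratio R) (@K_ratio_weight R) G.
- by move=> n; exact: measurable_itv.
- exact: measurable_pos_itv.
- exact: unit_itv_nondecreasing.
- exact: pos_itv_nondecreasing.
- rewrite unit_itv_bigcup => x; rewrite /= in_itv/= => x01.
  by rewrite ltW// K_ratio_weight_gt0.
- rewrite unit_itv_bigcup; apply: open_continuous_measurable_fun; first exact: interval_open.
  by move=> x; rewrite inE/= in_itv/= => x01; exact: continuous_K_ratio_weight.
- rewrite unit_itv_bigcup; apply: cmeasurableM.
    by apply: (@cmeasurable_cpow _ _ (@K_ratio R)); exact: measurable_ln_K_ratio.
  apply: cmeasurable_real; apply: open_continuous_measurable_fun; first exact: interval_open.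
  move=> x; rewrite inE/= in_itv/= => x01.
  apply: (@continuous_comp _ _ _ (@K_ratio R) (fun t : R => t * xi_density t)).
    exact: drv_continuous (drv_K_ratio x01).
  by apply: continuous_xi_density; exact: K_ratio_gt0.
- rewrite pos_itv_bigcup => h ch n; apply: integral_K_ratio_subst => t t0.
  by apply: ch; rewrite /= in_itv/= andbT.
- rewrite pos_itv_bigcup => u Du; have {Du} u0 : 0 < u by move: Du; rewrite /= in_itv/= andbT.
  rewrite (_ : (fun _ => _) = fun u => complex.Re (cpow u (s / 2 - 1)) * (u * xi_density u)).
    by apply: continuousM; [exact: continuous_Re_cpow|exact: continuous_xi_density].
  by apply/funext => v; rewrite /G ReM ImC mulr0 subr0.
- rewrite pos_itv_bigcup => u Du; have {Du} u0 : 0 < u by move: Du; rewrite /= in_itv/= andbT.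
  rewrite (_ : (fun _ => _) = fun u => complex.Im (cpow u (s / 2 - 1)) * (u * xi_density u)).
    by apply: continuousM; [exact: continuous_Im_cpow|exact: continuous_xi_density].
  by apply/funext => v; rewrite /G ImM ImC mulr0 add0r.
- by rewrite pos_itv_bigcup; exact: iX.
rewrite pos_itv_bigcup unit_itv_bigcup in iU eU.
have E x : (`]0, 1[%classic : set R) x -> G (K_ratio x) * (K_ratio_weight x)%:C =
    U_integrand s x.
  by rewrite /= in_itv/= => x01; exact: U_integrandE.
split; first exact: eq_cintegrable mD E iU.
by have := eq_cintegral E; rewrite -eU eX => ->.
Qed.

(** * Convergence for every s and entireness *)

Lemma continuous_U (R : realType) (m : R) : 0 < m < 1 ->
  {for m, continuous (@U R)}.
Proof.
move=> m01; have T0 := K_ratio_gt0 m01.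
pose V (m : R) := expR (1 / 4 * ln (K_ratio m)) *
  (xi_density (K_ratio m) * K_ratio_weight m).
have UV : forall y : R, 0 < y < 1 -> V y = U y.
  by move=> y y01; rewrite /V U_xi_density// /powR gt_eqF// K_ratio_gt0.
have cV : {for m, continuous V}.
  apply: continuousM.
    exact: drv_continuous (drv_expR (drvZ (1 / 4) (drv_ln (drv_K_ratio m01) T0))).
  apply: continuousM; last exact: continuous_K_ratio_weight.
  apply: (@continuous_comp _ _ _ (@K_ratio R) (@xi_density R)).
    exact: drv_continuous (drv_K_ratio m01).
  exact: drv_continuous (drvB (drvM (drvZ 4 (drv_id _)) (drv_gauss_series 2 T0))
    (drvZ 6 (drv_gauss_series 1 T0))).
have h : V y @[y --> m] --> U m by rewrite -(UV m m01); exact: cV.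
suff : U y @[y --> m] --> U m by [].
move: h; apply: cvg_trans; apply: near_eq_cvg.
by near=> y; apply: UV; near: y; exact: near01.
Unshelve. all: end_near. Qed.

Lemma onem01 (R : realType) (x : R) : 0 < x < 1 -> 0 < 1 - x < 1.
Proof. by move=> /andP[x0 x1]; rewrite subr_gt0 x1/= gtrBl. Qed.

(** Both sides have [K_ratio] equal to 1/t. This shows that m -> 1 - m exchanges the endpoints of
    [unit_itv n]. *)
Lemma K_ratio_inverse_compl (R : realType) (t : R) : 0 < t ->
  1 - K_ratio_inverse t = K_ratio_inverse t^-1.
Proof.
move=> t0; have t1 : 0 < t^-1 by rewrite invr_gt0.
apply: K_ratio_inj; first exact/onem01/K_ratio_inverse01.
  exact: K_ratio_inverse01.
by rewrite (K_ratio_compl (K_ratio_inverse01 t0)) (K_ratio_inverseK t0) (K_ratio_inverseK t1).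
Qed.

Lemma integrable_reflect (R : realType) (g : R -> R) :
  (forall m : R, 0 < m < 1 -> {for m, continuous g}) ->
  (@lebesgue_measure R).-integrable `]0, 1[ (EFin \o g) ->
  (@lebesgue_measure R).-integrable `]0, 1[ (EFin \o (fun m => g (1 - m))).
Proof.
move=> cg ig; have dF (x : R) : is_derive x 1 (fun x : R => 1 - x) (- 1).
  by apply: (drv_eq (drvB (drv_cst 1 x) (drv_id x))); rewrite sub0r.
have [||||||||||ir _] := @Rintegral_subst R (@unit_itv R) (@unit_itv R)
  (fun x => 1 - x) (fun=> 1) g.
- by move=> n; exact: measurable_itv.
- by move=> n; exact: measurable_itv.
- exact: unit_itv_nondecreasing.
- exact: unit_itv_nondecreasing.
- by move=> x _; exact: ler01.
- exact: measurable_cst.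
- rewrite unit_itv_bigcup; apply: open_continuous_measurable_fun; first exact: interval_open.
  move=> x; rewrite inE/= in_itv/= => x01.
  apply: (@continuous_comp _ _ _ (fun x : R => 1 - x) g).
    exact: drv_continuous (dF x).
  by apply: cg; exact: onem01.
- rewrite unit_itv_bigcup => h ch n.
  have n0 : 0 < n.+1%:R :> R by rewrite ltr0n.
  have n1 : 0 < n.+1%:R^-1 :> R by rewrite invr_gt0.
  have s1 := K_ratio_inverse_compl n0; have s2 := K_ratio_inverse_compl n1.
  rewrite invrK in s2.
  have a01 := K_ratio_inverse01 n0; have b01 := K_ratio_inverse01 n1.
  rewrite /unit_itv.
  have d (x : R) : K_ratio_inverse n.+1%:R <= x <= K_ratio_inverse n.+1%:R^-1 ->
    is_derive x 1 (fun x : R => 1 - x) (- 1) by move=> _.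
  have ab : K_ratio_inverse n.+1%:R <= K_ratio_inverse n.+1%:R^-1 :> R.
    rewrite -(K_ratio_le b01 a01) (K_ratio_inverseK n0) (K_ratio_inverseK n1).
    by rewrite (@le_trans _ _ 1)// ?ler1n// invf_le1// ler1n.
  have cf (x : R) : K_ratio_inverse n.+1%:R <= x <= K_ratio_inverse n.+1%:R^-1 ->
    {for x, continuous (fun=> - 1 : R)} by move=> _; exact: cst_continuous.
  have nf (x : R) : K_ratio_inverse n.+1%:R <= x <= K_ratio_inverse n.+1%:R^-1 ->
    (- 1 : R) < 0 by move=> _; exact: ltrN10.
  have hc (u : R) : 1 - K_ratio_inverse n.+1%:R^-1 <= u <= 1 - K_ratio_inverse n.+1%:R ->
      {for u, continuous h}.
    rewrite s1 s2 => /andP[u1 u2]; apply: ch; rewrite /= in_itv/=.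
    move: a01 b01 => /andP[a0 _] /andP[_ b1].
    by rewrite (lt_le_trans a0)//= (le_lt_trans u2).
  pose proof (integral_subst_decreasing ab d cf nf hc) as E.
  rewrite s1 s2 in E; rewrite E.
  by apply: eq_integral => x _; rewrite opprK.
- by rewrite unit_itv_bigcup => u; rewrite /= in_itv/=; exact: cg.
- by rewrite unit_itv_bigcup.
move: ir; rewrite unit_itv_bigcup; congr (integrable _ _ _).
by apply/funext => x; rewrite /= mulr1.
Qed.

Lemma measurable_U (R : realType) : measurable_fun (`]0, 1[ : set R) (@U R).
Proof.
apply: open_continuous_measurable_fun; first exact: interval_open.
by move=> x; rewrite inE/= in_itv/= => x01; exact: continuous_U.
Qed.

Lemma integrable_U_power (R : realType) (zeta : R[i] -> R[i]) (a : R) :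
  is_riemann_zeta zeta -> 1 / 4 < a ->
  (@lebesgue_measure R).-integrable `]0, 1[
    (EFin \o (fun m => expR (a * ln (K_ratio m)) * U m)).
Proof.
(* This s makes the exponent (s - 1/2)/2 equal to a, and a > 1/4 means s > 1. *)
move=> zP a4; pose s : R[i] := (2 * a + 1 / 2)%:C.
have s1 : 1 < complex.Re s by rewrite ReC; lra.
have [[i _] _] := cintegral_U_integrand zP s1.
have e : 1 / 2 * (s - 1 / 2) = a%:C.
  by rewrite /s rmorphD !rmorphM/= fmorphV !rmorph_nat; field.
move: i; congr (integrable _ _ _); apply/funext => m.
congr _%:E; rewrite /U_integrand e cpow_real -rmorphM.
exact: ReC.
Qed.

(** Under m -> 1 - m the power K_ratio^a becomes K_ratio^-a while U is unchanged. Of the two powers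
    one equals e^(a |ln K_ratio|), so the integrable function with exponent a plus its reflection
    dominates at both ends. *)
Lemma integrable_U_bound (R : realType) (zeta : R[i] -> R[i]) (a : R) :
  is_riemann_zeta zeta -> 1 / 4 < a ->
  (@lebesgue_measure R).-integrable `]0, 1[
    (EFin \o (fun m => expR (a * `|ln (K_ratio m)|) * `|U m|)).
Proof.
move=> zP a4; have mD : measurable (`]0, 1[%classic : set R) by exact: measurable_itv.
have i1 := integrable_U_power zP a4.
have c1 (m : R) : 0 < m < 1 ->
    {for m, continuous (fun m => expR (a * ln (K_ratio m)) * U m)}.
  move=> m01; apply: continuousM; last exact: continuous_U.
  exact: drv_continuous (drv_expR (drvZ a (drv_ln (drv_K_ratio m01) (K_ratio_gt0 m01)))).
have i2 := integrable_reflect c1 i1.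
pose g (m : R) := expR (a * ln (K_ratio m)) * U m.
have j1 : (@lebesgue_measure R).-integrable `]0, 1[ (fun m => `|(g m)%:E|%E).
  exact: integrable_abse i1.
have j2 : (@lebesgue_measure R).-integrable `]0, 1[ (fun m => `|(g (1 - m))%:E|%E).
  exact: integrable_abse i2.
have i3 : (@lebesgue_measure R).-integrable `]0, 1[
    (fun m => `|(g m)%:E| + `|(g (1 - m))%:E|)%E by exact: integrableD.
apply: (@le_integrable _ _ _ (@lebesgue_measure R) _ mD _ _ _ _ i3).
  apply/measurable_EFinP; apply: measurable_funM.
    apply: measurableT_comp; first by apply: continuous_measurable_fun; exact: continuous_expR.
    apply: measurable_funM; first exact: measurable_cst.
    by apply: measurableT_comp; [|exact: measurable_ln_K_ratio].
  by apply: measurableT_comp; [|exact: measurable_U].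
move=> m; rewrite /= in_itv/= => m01.
have h : expR (a * `|ln (K_ratio m)|) * `|U m| <= `|g m| + `|g (1 - m)|.
  rewrite /g K_ratio_compl// -U_symmetric// !normrM lnV ?posrE ?K_ratio_gt0//.
  rewrite !(ger0_norm (expR_ge0 _)) mulrN -mulrDl; apply: ler_wpM2r => //.
  have [h|h] := leP 0 (ln (K_ratio m)).
    by rewrite ger0_norm// lerDl expR_ge0.
  by rewrite ltr0_norm// mulrN lerDr expR_ge0.
rewrite /= lee_fin [X in X <= _]ger0_norm ?mulr_ge0 ?expR_ge0//.
by apply: (le_trans h); exact: ler_norm.
Qed.

Lemma U_integrand_cexp (R : realType) (s : R[i]) (m : R) :
  U_integrand s m = cexp (s * (1 / 2 * ln (K_ratio m))%:C) *
    (expR (- (1 / 4) * ln (K_ratio m)) * U m)%:C.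
Proof.
rewrite /U_integrand -/(K_ratio m) /cpow (rmorphM _ (expR _))/= -cexp_real mulrA -cexpD.
congr (cexp _ * _); move: (ln _) => L.
by rewrite !rmorphM !rmorphN/= rmorphM/= !fmorphV !rmorph_nat; field.
Qed.

(** Used with c = 0 for integrability at a given s, and with c = 1 for the extra room of a disc of
    radius 1 around it. *)
Lemma xi_exponent_le (R : realType) (x c L : R) : 0 <= c <= 1 ->
  x * (1 / 2 * L) + c * `|1 / 2 * L| + - (1 / 4) * L <= (`|x| / 2 + 2) * `|L|.
Proof.
move=> /andP[c0 c1]; rewrite normrM (@ger0_norm _ (1 / 2))//.
have h1 : x * L <= `|x| * `|L| by rewrite -normrM ler_norm.
have h2 : - L <= `|L| by rewrite -normrN ler_norm.
have h3 : c * `|L| <= `|L| by rewrite ler_piMl.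
have h4 := normr_ge0 L.
move: `|x| `|L| h1 h2 h3 h4 => X M h1 h2 h3 h4.
rewrite (_ : x * (1 / 2 * L) = x * L / 2); last by field.
rewrite (_ : c * (1 / 2 * M) = c * M / 2); last by field.
by rewrite (_ : (X / 2 + 2) * M = X * M / 2 + 2 * M); [lra|field].
Qed.

Lemma cintegrable_U_integrand (R : realType) (zeta : R[i] -> R[i]) (s : R[i]) :
  is_riemann_zeta zeta -> cintegrable `]0, 1[ (U_integrand s).
Proof.
move=> zP; pose a := `|complex.Re s| / 2 + 2.
have a4 : 1 / 4 < a by rewrite /a; have := normr_ge0 (complex.Re s); lra.
apply: le_cintegrable (integrable_U_bound zP a4) _; first exact: measurable_itv.
  apply: cmeasurableM; last by apply: cmeasurable_real; exact: measurable_U.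
  by apply: (@cmeasurable_cpow _ _ (@K_ratio R)); exact: measurable_ln_K_ratio.
move=> m; rewrite /= in_itv/= => m01.
rewrite U_integrand_cexp cabsM cabs_cexp cabs_real normrM (ger0_norm (expR_ge0 _)).
rewrite mulrA -expRD ler_wpM2r// ler_expR ReM ReC ImC mulr0 subr0 /a.
have h : 0 <= (0 : R) <= 1 by rewrite lexx ler01.
have := xi_exponent_le (complex.Re s) (ln (K_ratio m)) h.
by rewrite mul0r addr0.
Qed.

(** The integrand is e^(s L) h with L = ln(K_ratio) / 2, so [exp_integral_analytic] applies around
    every z; [integrable_U_bound] with a = |Re z| / 2 + 2 supplies the majorant for radius 1. *)
Lemma entire_cintegral_U_integrand (R : realType) (zeta : R[i] -> R[i]) :
  is_riemann_zeta zeta -> entire (fun s : R[i] => cintegral `]0, 1[ (U_integrand s)).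
Proof.
move=> zP z; pose a := `|complex.Re z| / 2 + 2.
have a4 : 1 / 4 < a by rewrite /a; have := normr_ge0 (complex.Re z); lra.
have mD : measurable (`]0, 1[%classic : set R) by exact: measurable_itv.
pose L (m : R) := 1 / 2 * ln (K_ratio m).
pose h (m : R) := expR (- (1 / 4) * ln (K_ratio m)) * U m.
have -> : (fun s : R[i] => cintegral `]0, 1[ (U_integrand s)) =
    fun s : R[i] => cintegral `]0, 1[
      (fun m : R => cexp (s * (L m)%:C) * (h m)%:C).
  apply/funext => s; apply: eq_cintegral => m _; exact: U_integrand_cexp.
have mexpR : measurable_fun [set: R] (@expR R).
  by apply: continuous_measurable_fun; exact: continuous_expR.
have mL : measurable_fun (`]0, 1[ : set R) L.
  by apply: measurable_funM; [exact: measurable_cst|exact: measurable_ln_K_ratio].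
have mh : measurable_fun (`]0, 1[ : set R) h.
  apply: measurable_funM; last exact: measurable_U.
  apply: measurableT_comp => //.
  by apply: measurable_funM; [exact: measurable_cst|exact: measurable_ln_K_ratio].
apply: (@exp_integral_analytic _ _ _ _ _ 1) => //.
apply: (@le_integrable _ _ _ (@lebesgue_measure R) _ mD _ _ _ _ (integrable_U_bound zP a4)).
  apply/measurable_EFinP; apply: measurable_funM; last exact: measurableT_comp.
  apply: measurableT_comp => //; apply: measurable_funD.
    by apply: measurable_funM; [exact: measurable_cst|].
  by apply: measurable_funM; [exact: measurable_cst|exact: measurableT_comp].
move=> m; rewrite /= in_itv/= => m01; rewrite lee_fin.
rewrite [leLHS]ger0_norm ?mulr_ge0 ?expR_ge0//.
rewrite [leRHS]ger0_norm ?mulr_ge0 ?expR_ge0//.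
have hE : `|h m| = expR (- (1 / 4) * ln (K_ratio m)) * `|U m|.
  by rewrite normrM (ger0_norm (expR_ge0 _)).
rewrite hE mulrA -expRD ler_wpM2r// ler_expR /a /L.
have c1 : 0 <= (1 : R) <= 1 by rewrite lexx ler01.
exact: (xi_exponent_le (complex.Re z) (ln (K_ratio m)) c1).
Qed.

(** * Analytic continuation to the whole plane *)

Definition xi_integral (R : realType) (s : R[i]) : R[i] :=
  cintegral `]0, 1[ (U_integrand s).

(** The difference of the two sides multiplied by π^(w/2) and by the product w/2 (w/2 + 1) ... (w/2
    + N - 1) that continues Γ(w/2). Without these denominators it is analytic at every w other than
    1 with Re w / 2 + N > 0. *)
Definition xi_defect (R : realType) (zeta : R[i] -> R[i]) (N : nat) (w : R[i]) : R[i] :=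
  w * (w - 1) * zeta w * Gamma_integral (2^-1 * w + N%:R) -
  (\prod_(k < N) (2^-1 * w + k%:R)) * cpow pi (2^-1 * w) * xi_integral w.

Lemma Re_half_nat (R : realType) (w : R[i]) (N : nat) :
  complex.Re (2^-1 * w + N%:R) = complex.Re w / 2 + N%:R.
Proof.
by rewrite ReD mulrC Re_half -(rmorph_nat (real_complex R)) ReC.
Qed.

Lemma analytic_at_xi_defect (R : realType) (zeta : R[i] -> R[i]) (N : nat) (w : R[i]) :
  is_riemann_zeta zeta -> w != 1 -> 0 < complex.Re w / 2 + N%:R ->
  analytic_at (xi_defect zeta N) w.
Proof.
move=> zP w1 wN; have [_ za] := zP.
have aff (b : R[i]) : analytic_at (fun w => 2^-1 * w + b) w.
  by apply: (@analytic_at_affine R id); exact: analytic_at_id.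
apply: analytic_atD.
  apply: analytic_atM; last first.
    by apply: analytic_at_affine; apply: analytic_at_Gamma_integral; rewrite Re_half_nat.
  apply: analytic_atM; last exact: za.
  apply: analytic_atM; first exact: analytic_at_id.
  by apply: analytic_atD; [exact: analytic_at_id|exact: analytic_at_cst].
rewrite (_ : (fun _ => _) = fun w => (-1) *
  ((\prod_(k < N) (2^-1 * w + k%:R)) * cpow pi (2^-1 * w) * xi_integral w)); last first.
  by apply/funext => v; rewrite mulN1r.
apply: analytic_atM; first exact: analytic_at_cst.
apply: analytic_atM; last exact: entire_cintegral_U_integrand zP w.
apply: analytic_atM; first by apply: analytic_at_prod => k; exact: aff.
rewrite (_ : (fun _ => _) = fun w => cpow pi (2^-1 * w + 0)); last first.
  by apply/funext => v; rewrite addr0.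
by apply: analytic_at_affine; exact: analytic_at_cpow.
Qed.

Lemma xi_defect_half_plane (R : realType) (zeta : R[i] -> R[i]) (N : nat) (w : R[i]) :
  is_riemann_zeta zeta -> 1 < complex.Re w -> xi_defect zeta N w = 0.
Proof.
move=> zP w1; have [_ e] := cintegral_U_integrand zP w1.
rewrite /xi_defect /xi_integral e [2^-1 * w]mulrC Gamma_integralD; last first.
  by rewrite Re_half divr_gt0// (lt_trans _ w1).
rewrite cpowN; have := cpow_neq0 pi (w / 2).
move: (cpow _ _) (\prod_(k < N) _) (Gamma_integral _) (zeta w) => a b c d a0.
by field.
Qed.

Lemma complex_eq (R : realType) (z w : R[i]) :
  complex.Re z = complex.Re w -> complex.Im z = complex.Im w -> z = w.
Proof. by case: z => ? ?; case: w => ? ? /= -> ->. Qed.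

Lemma ReD_real (R : realType) (z : R[i]) (x : R) :
  complex.Re (z + x%:C) = complex.Re z + x.
Proof. by rewrite ReD ReC. Qed.

Lemma ImD_real (R : realType) (z : R[i]) (x : R) :
  complex.Im (z + x%:C) = complex.Im z.
Proof. by rewrite ImD ImC addr0. Qed.

(** The horizontal segment from 2 + i Im s to s avoids the pole 1 because Im s is nonzero, and it
    stays in the half-plane by convexity. The defect vanishes near its starting point, where Re >
    1. *)
Lemma xi_defect_nonreal (R : realType) (zeta : R[i] -> R[i]) (N : nat) (s : R[i]) :
  is_riemann_zeta zeta -> complex.Im s != 0 -> 0 < complex.Re s / 2 + N%:R ->
  xi_defect zeta N s = 0.
Proof.
move=> zP s0 sN; pose p : R[i] := 2 +i* complex.Im s.
rewrite (_ : s = p + (complex.Re s - 2)%:C); last first.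
  apply: complex_eq; last by rewrite ImD_real.
  by rewrite ReD_real (_ : complex.Re p = 2)// addrC subrK.
apply: analytic_segment_zero => [x /andP[x0 x1]|].
  have Rw : complex.Re (p + x%:C * (complex.Re s - 2)%:C) =
      (1 - x) * 2 + x * complex.Re s.
    by rewrite -rmorphM ReD_real (_ : complex.Re p = 2)//; ring.
  have Iw : complex.Im (p + x%:C * (complex.Re s - 2)%:C) = complex.Im s.
    by rewrite -rmorphM ImD_real.
  apply: analytic_at_xi_defect => //.
    apply/eqP => e; move: s0; rewrite -Iw e.
    by rewrite -(rmorph1 (real_complex R)) ImC eqxx.
  rewrite Rw; have N0 : 0 <= N%:R :> R by [].
  move: (N%:R : R) (complex.Re s) sN N0 => M r sN N0.
  have [r2|r2] := leP r 2.
    have : 0 <= (1 - x) * (2 - r) by rewrite mulr_ge0 ?subr_ge0.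
    by lra.
  have : 0 <= x * (r - 2) by rewrite mulr_ge0 ?subr_ge0// ltW.
  by lra.
apply/nbhs_cabsP; exists 1 => // w wp; apply: xi_defect_half_plane => //.
have := le_lt_trans (normr_Re_le (w - p)) wp.
rewrite ReD ReN (_ : complex.Re p = 2)// ltr_norml => /andP[h _]; lra.
Qed.

(** A nonzero value at s would persist nearby by continuity, but points arbitrarily close to s on a
    vertical line are nonreal, where the defect vanishes. *)
Lemma xi_defect_eq0 (R : realType) (zeta : R[i] -> R[i]) (N : nat) (s : R[i]) :
  is_riemann_zeta zeta -> s != 1 -> 0 < complex.Re s / 2 + N%:R ->
  xi_defect zeta N s = 0.
Proof.
move=> zP s1 sN; apply/eqP/negPn/negP => n0.
have c0 : 0 < cabs (xi_defect zeta N s) by rewrite lt_neqAle cabs_ge0 eq_sym cabs_eq0 n0.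
have /cvgc_eps_deltaP/(_ _ c0)[d d0 hd] :=
  analytic_at_continuous (analytic_at_xi_defect zP s1 sN).
have near_s (y : R) : 0 < y < d -> cabs (xi_defect zeta N (s + 0 +i* y) - xi_defect zeta N s) <
    cabs (xi_defect zeta N s).
  move=> /andP[y0 yd]; apply: hd; rewrite addrAC subrr add0r.
  by rewrite cabs_sqrt /= expr0n add0r sqrtr_sqr gtr0_norm.
(* Two vertical offsets are tried, since at most one of them can land on the real axis. *)
have /(near_s _) : 0 < d / 2 < d by apply/andP; split; lra.
have /(near_s _) : 0 < d / 3 < d by apply/andP; split; lra.
have h (y : R) : complex.Im s + y != 0 -> xi_defect zeta N (s + 0 +i* y) = 0.
  by move=> sy; apply: xi_defect_nonreal; rewrite ?ImD ?ReD ?addr0.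
have [e|e] := eqVneq (complex.Im s + d / 3) 0; last by rewrite h// sub0r cabsN ltxx.
have e' : complex.Im s + d / 2 != 0.
  by apply/eqP => e'; move: (complex.Im s) e e' => y e e'; lra.
by rewrite (h _ e') sub0r cabsN ltxx.
Qed.

(** With N the shift chosen in the definition of [Gamma] at s/2, the vanishing defect is divided by
    the product and by π^(s/2). *)
Lemma completed_zeta_xi (R : realType) (zeta : R[i] -> R[i]) (s : R[i]) :
  is_riemann_zeta zeta -> ~ @removable_singularities R s ->
  completed_zeta zeta s = xi_integral s.
Proof.
move=> zP sA; have s1 : s != 1 by apply/eqP => e; apply: sA; left.
rewrite /completed_zeta /Gamma.
set N := if _ then _ else _.
have sN : 0 < complex.Re s / 2 + N%:R.
  rewrite /N Re_half; case: ifP => [h|/negbT]; first by rewrite addr0.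
  rewrite -leNgt => h; rewrite -ltrBlDl sub0r.
  by have /truncn_itv/andP[] : 0 <= - (complex.Re s / 2) by rewrite oppr_ge0.
have := xi_defect_eq0 zP s1 sN; rewrite /xi_defect [2^-1 * s]mulrC => /subr0_eq e.
(* A vanishing factor s/2 + k would make s = -2k, one of the removable singularities. *)
have nz : \prod_(k < N) (s / 2 + k%:R) != 0.
  apply/prodf_neq0 => k _; apply/eqP => h; apply: sA; right; exists k.
  apply/eqP; rewrite -addr_eq0 natrM.
  have -> : s + 2 * k%:R = 2 * (s / 2 + k%:R) by field.
  by rewrite h mulr0.
have c0 := cpow_neq0 pi (s / 2).
rewrite (_ : _ * (_ / _ / _) = s * (s - 1) * zeta s * Gamma_integral (s / 2 + N%:R) /
    (\prod_(k < N) (s / 2 + k%:R) * cpow pi (s / 2))); last first.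
  move: (cpow _ _) (\prod_(k < N) _) (Gamma_integral _) (zeta s) c0 nz {e} => a b c d a0 b0.
  by field; rewrite a0 b0.
rewrite e.
by move: (cpow _ _) (\prod_(k < N) _) c0 nz {e} => a b a0 b0; field; rewrite a0 b0.
Qed.

Lemma removable_singularities_int (R : realType) (z : R[i]) :
  removable_singularities z -> exists k : int, z = (k%:~R : R)%:C.
Proof.
case=> [->|[n ->]]; first by exists 1; rewrite rmorph1.
by exists (- (2 * n)%:Z); rewrite rmorph_int rmorphN.
Qed.

Lemma removable_singularities_discrete (R : realType) (z w : R[i]) :
  removable_singularities z -> removable_singularities w -> cabs (w - z) < 1 ->
  w = z.
Proof.
move=> /removable_singularities_int[k ->] /removable_singularities_int[l ->].
rewrite -rmorphB cabs_real -rmorphB -intr_norm -[1]/(1%:~R) ltr_int.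
by rewrite -[1]add0r ltzD1 normr_le0 subr_eq0 => /eqP ->.
Qed.

(** The exceptional points are integers, hence isolated: on a punctured disc of radius at most 1
    around one of them the completed zeta function coincides with the integral, which is continuous
    there. *)
Lemma xi_extends (R : realType) (zeta : R[i] -> R[i]) :
  is_riemann_zeta zeta ->
  extends_by_continuity (@removable_singularities R) (completed_zeta zeta)
    (@xi_integral R).
Proof.
move=> zP; split=> [z zA|z zA P /nbhs_cabsP[e e0 hP]].
  exact/esym/completed_zeta_xi.
have /cvgc_eps_deltaP/(_ _ e0)[d d0 hd] :=
  analytic_at_continuous (entire_cintegral_U_integrand zP z).
apply/nbhs_cabsP; exists (Num.min d 1); first by rewrite lt_min d0 ltr01.
move=> w; rewrite lt_min => /andP[wd w1] wz; apply: hP.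
rewrite completed_zeta_xi//; first exact: hd.
move=> wA; case/eqP: wz; exact: removable_singularities_discrete zA wA w1.
Qed.

Theorem theorem15 (R : realType) (zeta : R[i] -> R[i])
    (zetaP : is_riemann_zeta zeta) :
  (forall m : R, 0 < m < 1 -> U m = U (1 - m)) /\
  exists xi : R[i] -> R[i],
    [/\ entire xi,
        extends_by_continuity (@removable_singularities R)
          (completed_zeta zeta) xi &
        forall s : R[i],
          let integrand (m : R) : R[i] :=
            cpow (ellipticK (1 - m) / ellipticK m) (1 / 2 * (s - 1 / 2)) *
            (U m)%:C in
          cintegrable `]0, 1[ integrand /\
          xi s = cintegral `]0, 1[ integrand].
Proof.
split; first exact: U_symmetric.
exists (@xi_integral R); split.
- exact: entire_cintegral_U_integrand zetaP.
- exact: xi_extends zetaP.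
- by move=> s; split; first exact: cintegrable_U_integrand zetaP.
Qed.
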